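(* Let $\mathbb{F}$ be a field, $\Gamma$ an arbitrary digraph and $J$ an ideal of $L_{\mathbb{F}}(\Gamma)$ such that $\mathbb{F}$ contains all the roots of all canonical polynomial generators $f_C$ of $J$. Let $J'$ be the ideal of $L_{\mathbb{F}}(\Gamma)$ generated by $J$ and all elements $g_C(C)$, where for each canonical polynomial generator $f_C(C)$ of $J$, $g_C(x)$ is the product of the distinct irreducible factors of $f_C(x)$, normalized by $g_C(0)=1$. Then the Jacobson radical of $L_{\mathbb{F}}(\Gamma)/J$ equals the nilradical $N$ of $L_{\mathbb{F}}(\Gamma)/J$, and $$(L_{\mathbb{F}}(\Gamma)/J)/N\cong L_{\mathbb{F}}(\Gamma\mathbin{/\!/}J').$$
   Context: A digraph $\Gamma=(V,E,s,t)$ consists of arbitrary (possibly infinite) sets $V$ of vertices and $E$ of arrows and functions $s,t:E\to V$ (source, target). The Leavitt path algebra $L_{\mathbb{F}}(\Gamma)$ is the (not necessarily unital) $\mathbb{F}$-algebra generated by $V\sqcup E\sqcup\{e^*: e\in E\}$ subject to: $uv=\delta_{u,v}u$ for $u,v\in V$; $s(e)e=e=e\,t(e)$ and $t(e)e^*=e^*=e^*s(e)$ for $e\in E$; (CK1) $e^*f=\delta_{e,f}t(e)$; (CK2) $v=\sum_{s(e)=v}ee^*$ for every $v$ with $0<|s^{-1}(v)|<\infty$. Ideals are two-sided. The nilradical of a ring is its largest nil ideal (the sum of all nil ideals). A path of length $n>0$ is a sequence of arrows $e_1\cdots e_n$ with $t(e_i)=s(e_{i+1})$. A cycle is a path $C=e_1\cdots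 e_n$ with $n>0$, $s(C)=t(C)$ and $s(e_1),\dots,s(e_n)$ distinct; cyclic rotations are identified (geometric cycles). Canonical polynomial generators of an ideal $J$: for a cycle $C$, $\mathbb{F}[C]$ is the subalgebra spanned by $s(C),C,C^2,\dots$, isomorphic to $\mathbb{F}[x]$ via $C\leftrightarrow x$. For each cycle $C$ such that $J\cap\mathbb{F}[C]$ is a proper nonzero ideal of $\mathbb{F}[C]$, $f_C(x)$ is the unique generator with $f_C(0)=1$ of the corresponding ideal of $\mathbb{F}[x]$; the elements $f_C(C)$ (constant term read as $s(C)$) are the canonical polynomial generators of $J$. The polynomial $f_C$ depends only on the geometric cycle, and such cycles have no exit in the digraph $\Gamma/J$ defined next (an exit of a path $p$ is an arrow not on $p$ whose source is on $p$). The digraph $\Gamma/J$: let $H=J\cap V$, $B_H=\{v\in V: s^{-1}(v)\text{ infinite},\ 0<|s^{-1}(v)\cap t^{-1}(V\setminus H)|<\infty\}$, $v^H=v-\sum_{s(e)=v,\,t(e)\notin H}ee^*$ for $v\in B_H$, and $S_J=\{v\in B_H: v^H\in J\}$. Then $\Gamma/J$ has vertex set $(V\setminus H)\cup\{v': v\in B_H\setminus S_J\}$ and arrow set $\{e\in E: t(e)\notin H\}\cup\{e': e\in E,\ t(e)\in B_H\setminus S_J\}$, with $s(e')=s(e)$, $t(e')=t(e)'$. The digraph $\Gamma\mathbin{/\!/}J$: it is obtained from $\Gamma/J$ as follows. For each geometric cycle $C$ contributing a canonical polynomial generator $f_C(C)$ of $J$, choose an arrow $e_C$ on $C$, replace $e_C$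 by a loop at $v_C:=s(e_C)$ (after which this loop is the only arrow with source $v_C$), then delete this loop, replace the vertex $v_C$ by $\deg f_C$ sinks $v_{C,1},\dots,v_{C,\deg f_C}$, and replace each remaining arrow $e$ with target $v_C$ by $\deg f_C$ arrows $e_j$ with $s(e_j)=s(e)$ and $t(e_j)=v_{C,j}$. *)

(* Defs.v *)
From HB Require Import structures.
From mathcomp Require Import all_boot all_order all_algebra.
From mathcomp Require Import boolp classical_sets functions cardinality fsbigop.

Set Implicit Arguments.
Unset Strict Implicit.
Unset Printing Implicit Defensive.

Import GRing.Theory.
Local Open Scope classical_set_scope.
Local Open Scope ring_scope.
Local Open Scope quotient_scope.

Reserved Notation "x ** y" (at level 40, left associativity).

HB.mixin Record Lmodule_isNonUnitalAlgebra (F : fieldType) A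
    of GRing.Lmodule F A := {
  nmul : A -> A -> A;
  nmulA : associative nmul;
  nmulDl : left_distributive nmul +%R;
  nmulDr : right_distributive nmul +%R;
  nmulZl : forall (a : F) (x y : A), nmul (a *: x) y = a *: nmul x y;
  nmulZr : forall (a : F) (x y : A), nmul x (a *: y) = a *: nmul x y
}.

#[short(type="nuAlgType")]
HB.structure Definition NonUnitalAlgebra (F : fieldType) :=
  {A of Lmodule_isNonUnitalAlgebra F A & GRing.Lmodule F A}.

Notation "x ** y" := (nmul x y) : ring_scope.

Definition nu_isomorphic (F : fieldType) (A B : nuAlgType F) : Prop :=
  exists f : {linear A -> B}, bijective f /\ {morph f : x y / x ** y}.

(* Two-sided ideals are taken to be linear subspaces. This is no restriction  *)
(* for Leavitt path algebras and their quotients: they have local units, so   *)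
(* every two-sided ring ideal is a subspace.                                  *)

Record nuIdeal (F : fieldType) (A : nuAlgType F) := NuIdeal {
  ideal_pred :> {pred A};
  ideal_submod_closed : submod_closed ideal_pred;
  ideal_nmull : forall a x : A, x \in ideal_pred -> a ** x \in ideal_pred;
  ideal_nmulr : forall a x : A, x \in ideal_pred -> x ** a \in ideal_pred
}.

HB.instance Definition _ (F : fieldType) (A : nuAlgType F) (I : nuIdeal A) :=
  GRing.isSubmodClosed.Build F A (ideal_pred I)
    (GRing.submod_closed_semi (ideal_submod_closed I)).

Section IdealGen.
Context (F : fieldType) (A : nuAlgType F) (X : set A).

Definition ideal_gen_pred : {pred A} :=
  fun x => `[< forall I : nuIdeal A, X `<=` [set` I] -> x \in I >].

Fact ideal_gen_submod_closed : submod_closed ideal_gen_pred.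
Proof.
split; first by apply/asboolP => I _; exact: rpred0.
move=> a x y /asboolP Xx /asboolP Xy; apply/asboolP => I XI.
by rewrite rpredD ?rpredZ ?Xx ?Xy.
Qed.

Fact ideal_gen_nmull (a x : A) : x \in ideal_gen_pred -> a ** x \in ideal_gen_pred.
Proof.
by move=> /asboolP Xx; apply/asboolP => I XI; apply: ideal_nmull; exact: Xx.
Qed.

Fact ideal_gen_nmulr (a x : A) : x \in ideal_gen_pred -> x ** a \in ideal_gen_pred.
Proof.
by move=> /asboolP Xx; apply/asboolP => I XI; apply: ideal_nmulr; exact: Xx.
Qed.

Definition ideal_gen : nuIdeal A :=
  NuIdeal ideal_gen_submod_closed ideal_gen_nmull ideal_gen_nmulr.

Lemma ideal_gen_sub : X `<=` [set` ideal_gen].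
Proof. by move=> x Xx /=; apply/asboolP => I; apply. Qed.

End IdealGen.

Definition nuquot (F : fieldType) (A : nuAlgType F) (I : nuIdeal A) : Type :=
  Quotient.quot I.

Section Quotient.
Context (F : fieldType) (A : nuAlgType F) (I : nuIdeal A).
Local Notation Q := (nuquot I).

HB.instance Definition _ := GRing.Zmodule.on Q.
HB.instance Definition _ := EqQuotient.on Q.

Definition to_quot : A -> Q := \pi_(Q).

Lemma to_quotP (x y : A) : to_quot x = to_quot y <-> x - y \in I.
Proof. by rewrite Quotient.idealrBE; split=> [xy|/eqP]; first exact/eqP. Qed.

Lemma to_quotK (q : Q) : to_quot (repr q) = q.
Proof. exact: reprK. Qed.

Lemma to_quotD : {morph to_quot : x y / x + y}.
Proof. by move=> x y; rewrite [LHS]Quotient.pi_add. Qed.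

Definition qscale (a : F) (q : Q) : Q := to_quot (a *: repr q).
Definition qmul (p q : Q) : Q := to_quot (repr p ** repr q).

Lemma to_quot_scale (a : F) (x : A) : qscale a (to_quot x) = to_quot (a *: x).
Proof.
by apply/to_quotP; rewrite -scalerBr rpredZ//; apply/to_quotP; exact: to_quotK.
Qed.

Lemma nmulBl (x y z : A) : (x - y) ** z = x ** z - y ** z.
Proof. by rewrite nmulDl -scaleN1r nmulZl scaleN1r. Qed.

Lemma nmulBr (x y z : A) : x ** (y - z) = x ** y - x ** z.
Proof. by rewrite nmulDr -scaleN1r nmulZr scaleN1r. Qed.

Lemma to_quot_mul (x y : A) : qmul (to_quot x) (to_quot y) = to_quot (x ** y).
Proof.
have /to_quotP Hx := to_quotK (to_quot x).
have /to_quotP Hy := to_quotK (to_quot y).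
apply/to_quotP; set x' := repr _ in Hx *; set y' := repr _ in Hy *.
have -> : x' ** y' - x ** y = (x' - x) ** y' + x ** (y' - y).
  by rewrite nmulBl nmulBr addrA subrK.
by apply: rpredD; [exact: ideal_nmulr | exact: ideal_nmull].
Qed.

Fact qscaleA (a b : F) (q : Q) : qscale a (qscale b q) = qscale (a * b) q.
Proof. by rewrite -(to_quotK q) !to_quot_scale scalerA. Qed.
Fact qscale1 : left_id 1 qscale.
Proof. by move=> q; rewrite -(to_quotK q) to_quot_scale scale1r. Qed.
Fact qscaleDr : right_distributive qscale +%R.
Proof.
move=> a p q; rewrite -(to_quotK p) -(to_quotK q).
by rewrite -to_quotD !to_quot_scale -to_quotD scalerDr.
Qed.
Fact qscaleDl (q : Q) : {morph qscale^~ q : a b / a + b}.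
Proof. by move=> a b; rewrite -(to_quotK q) !to_quot_scale -to_quotD scalerDl. Qed.

HB.instance Definition _ := GRing.Zmodule_isLmodule.Build F Q
  qscaleA qscale1 qscaleDr qscaleDl.

Fact qmulA : associative qmul.
Proof.
move=> p q r; rewrite -(to_quotK p) -(to_quotK q) -(to_quotK r).
by rewrite !to_quot_mul nmulA.
Qed.
Fact qmulDl : left_distributive qmul +%R.
Proof.
move=> p q r; rewrite -(to_quotK p) -(to_quotK q) -(to_quotK r).
by rewrite -to_quotD !to_quot_mul -to_quotD nmulDl.
Qed.
Fact qmulDr : right_distributive qmul +%R.
Proof.
move=> p q r; rewrite -(to_quotK p) -(to_quotK q) -(to_quotK r).
by rewrite -to_quotD !to_quot_mul -to_quotD nmulDr.
Qed.
Fact qmulZl (a : F) (p q : Q) : qmul (a *: p) q = a *: qmul p q.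
Proof.
rewrite -(to_quotK p) -(to_quotK q) /GRing.scale /=.
by rewrite !(to_quot_scale, to_quot_mul) nmulZl.
Qed.
Fact qmulZr (a : F) (p q : Q) : qmul p (a *: q) = a *: qmul p q.
Proof.
rewrite -(to_quotK p) -(to_quotK q) /GRing.scale /=.
by rewrite !(to_quot_scale, to_quot_mul) nmulZr.
Qed.

HB.instance Definition _ := Lmodule_isNonUnitalAlgebra.Build F Q
  qmulA qmulDl qmulDr qmulZl qmulZr.

Lemma to_quotM : {morph to_quot : x y / x ** y}.
Proof. by move=> x y; rewrite [RHS]to_quot_mul. Qed.

Fact to_quot_linear : linear to_quot.
Proof.
by move=> a x y; rewrite to_quotD -to_quot_scale.
Qed.
HB.instance Definition _ := GRing.isLinear.Build F A Q _ to_quot to_quot_linear.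

End Quotient.

Section Radicals.
Context (F : fieldType) (A : nuAlgType F).

(* iter n (nmul x) x is the power x^(n+1). *)
Definition nil_ideal (I : nuIdeal A) : Prop :=
  forall x : A, x \in I -> exists n : nat, iter n (nmul x) x = 0.

Definition nilradical : nuIdeal A :=
  ideal_gen [set x | exists2 I : nuIdeal A, nil_ideal I & x \in I].

Definition left_ideal (M : set A) : Prop :=
  [/\ M 0, forall x y, M x -> M y -> M (x - y)
    & forall a x, M x -> M (a ** x)].

Definition modular (M : set A) : Prop := exists e : A, forall x, M (x - x ** e).

Definition maximal_left_ideal (M : set A) : Prop :=
  [/\ left_ideal M, M <> setT
    & forall M', left_ideal M' -> M `<=` M' -> M' = M \/ M' = setT].

(* Without a unit, the maximal left ideals to intersect are the modular       *)
(* (= regular) ones; for unital rings every left ideal is modular.            *)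
Definition jacobson_radical : set A :=
  [set x | forall M, maximal_left_ideal M -> modular M -> M x].

End Radicals.

Arguments nilradical {F} A.
Arguments jacobson_radical {F} A.

(* The free non-unital F-algebra on X: formal expressions modulo the          *)
(* congruence generated by the axioms of a non-unital F-algebra.              *)

Section FreeAlgebra.
Context (F : fieldType) (X : Type).

Inductive nuterm : Type :=
| TGen of X
| TZero
| TOpp of nuterm
| TAdd of nuterm & nuterm
| TScale of F & nuterm
| TMul of nuterm & nuterm.

Inductive nuterm_eq : nuterm -> nuterm -> Prop :=
| teq_refl s : nuterm_eq s s
| teq_sym s t : nuterm_eq s t -> nuterm_eq t s
| teq_trans s t u : nuterm_eq s t -> nuterm_eq t u -> nuterm_eq s u
| teq_opp s t : nuterm_eq s t -> nuterm_eq (TOpp s) (TOpp t)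
| teq_add s s' t t' : nuterm_eq s s' -> nuterm_eq t t' ->
    nuterm_eq (TAdd s t) (TAdd s' t')
| teq_scale a s t : nuterm_eq s t -> nuterm_eq (TScale a s) (TScale a t)
| teq_mul s s' t t' : nuterm_eq s s' -> nuterm_eq t t' ->
    nuterm_eq (TMul s t) (TMul s' t')
| teq_addA s t u : nuterm_eq (TAdd s (TAdd t u)) (TAdd (TAdd s t) u)
| teq_addC s t : nuterm_eq (TAdd s t) (TAdd t s)
| teq_add0 s : nuterm_eq (TAdd TZero s) s
| teq_addN s : nuterm_eq (TAdd (TOpp s) s) TZero
| teq_scaleA a b s : nuterm_eq (TScale a (TScale b s)) (TScale (a * b) s)
| teq_scale1 s : nuterm_eq (TScale 1 s) s
| teq_scaleDr a s t :
    nuterm_eq (TScale a (TAdd s t)) (TAdd (TScale a s) (TScale a t))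
| teq_scaleDl a b s :
    nuterm_eq (TScale (a + b) s) (TAdd (TScale a s) (TScale b s))
| teq_mulA s t u : nuterm_eq (TMul s (TMul t u)) (TMul (TMul s t) u)
| teq_mulDl s t u : nuterm_eq (TMul (TAdd s t) u) (TAdd (TMul s u) (TMul t u))
| teq_mulDr s t u : nuterm_eq (TMul s (TAdd t u)) (TAdd (TMul s t) (TMul s u))
| teq_mulZl a s t : nuterm_eq (TMul (TScale a s) t) (TScale a (TMul s t))
| teq_mulZr a s t : nuterm_eq (TMul s (TScale a t)) (TScale a (TMul s t)).

HB.instance Definition _ := gen_eqMixin nuterm.
HB.instance Definition _ := gen_choiceMixin nuterm.

Definition nuterm_eqb (s t : nuterm) : bool := `[< nuterm_eq s t >].

Fact nuterm_eqb_equiv : equiv_class_of nuterm_eqb.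
Proof.
split=> [s|s t|t s u]; first by apply/asboolP; exact: teq_refl.
- by apply/asboolP/asboolP => /teq_sym.
- by move=> /asboolP st /asboolP tu; apply/asboolP; exact: teq_trans st tu.
Qed.

Canonical nuterm_equiv := EquivRelPack nuterm_eqb_equiv.
Canonical nuterm_encModRel := defaultEncModRel nuterm_eqb.

Definition freealg : Type := {eq_quot nuterm_eqb}.

HB.instance Definition _ := Choice.on freealg.
HB.instance Definition _ : EqQuotient nuterm nuterm_eqb freealg :=
  EqQuotient.on freealg.

Definition of_term : nuterm -> freealg := \pi_(freealg).

Lemma of_termP (s t : nuterm) : of_term s = of_term t <-> nuterm_eq s t.
Proof. by split=> [/eqquotP/asboolP|st]; last exact/eqquotP/asboolP. Qed.

Lemma of_termK (x : freealg) : of_term (repr x) = x.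
Proof. exact: reprK. Qed.

Lemma repr_of_term (s : nuterm) : nuterm_eq (repr (of_term s)) s.
Proof. by apply/of_termP; exact: of_termK. Qed.

Definition fzero : freealg := of_term TZero.
Definition fopp (x : freealg) : freealg := of_term (TOpp (repr x)).
Definition fadd (x y : freealg) : freealg := of_term (TAdd (repr x) (repr y)).
Definition fscale (a : F) (x : freealg) : freealg := of_term (TScale a (repr x)).
Definition fmul (x y : freealg) : freealg := of_term (TMul (repr x) (repr y)).

Lemma foppE s : fopp (of_term s) = of_term (TOpp s).
Proof. by apply/of_termP/teq_opp/repr_of_term. Qed.
Lemma faddE s t : fadd (of_term s) (of_term t) = of_term (TAdd s t).
Proof. by apply/of_termP/teq_add; exact: repr_of_term. Qed.
Lemma fscaleE a s : fscale a (of_term s) = of_term (TScale a s).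
Proof. by apply/of_termP/teq_scale/repr_of_term. Qed.
Lemma fmulE s t : fmul (of_term s) (of_term t) = of_term (TMul s t).
Proof. by apply/of_termP/teq_mul; exact: repr_of_term. Qed.

Lemma freealg_ind (P : freealg -> Prop) : (forall s, P (of_term s)) -> forall x, P x.
Proof. by move=> Ps x; rewrite -(of_termK x). Qed.

Let fE := (foppE, faddE, fscaleE, fmulE).

Fact faddA : associative fadd.
Proof.
by elim/freealg_ind=> s; elim/freealg_ind=> t; elim/freealg_ind=> u;
  rewrite !fE; apply/of_termP; constructor.
Qed.
Fact faddC : commutative fadd.
Proof.
by elim/freealg_ind=> s; elim/freealg_ind=> t;
  rewrite !fE; apply/of_termP; apply: teq_addC.
Qed.
Fact fadd0 : left_id fzero fadd.
Proof. by elim/freealg_ind=> s; rewrite !fE; apply/of_termP; constructor. Qed.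
Fact faddN : left_inverse fzero fopp fadd.
Proof. by elim/freealg_ind=> s; rewrite !fE; apply/of_termP; constructor. Qed.

HB.instance Definition _ := GRing.isZmodule.Build freealg faddA faddC fadd0 faddN.

Fact fscaleA a b x : fscale a (fscale b x) = fscale (a * b) x.
Proof. by elim/freealg_ind: x=> s; rewrite !fE; apply/of_termP; constructor. Qed.
Fact fscale1 : left_id 1 fscale.
Proof. by elim/freealg_ind=> s; rewrite !fE; apply/of_termP; constructor. Qed.
Fact fscaleDr : right_distributive fscale +%R.
Proof.
by move=> a; elim/freealg_ind=> s; elim/freealg_ind=> t;
  rewrite /GRing.add /= !fE; apply/of_termP; constructor.
Qed.
Fact fscaleDl x : {morph fscale^~ x : a b / a + b}.
Proof.
by elim/freealg_ind: x => s a b; rewrite [in RHS]/GRing.add /= !fE;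
  apply/of_termP; constructor.
Qed.

HB.instance Definition _ := GRing.Zmodule_isLmodule.Build F freealg
  fscaleA fscale1 fscaleDr fscaleDl.

Fact fmulA : associative fmul.
Proof.
by elim/freealg_ind=> s; elim/freealg_ind=> t; elim/freealg_ind=> u;
  rewrite !fE; apply/of_termP; constructor.
Qed.
Fact fmulDl : left_distributive fmul +%R.
Proof.
by elim/freealg_ind=> s; elim/freealg_ind=> t; elim/freealg_ind=> u;
  rewrite /GRing.add /= !fE; apply/of_termP; constructor.
Qed.
Fact fmulDr : right_distributive fmul +%R.
Proof.
by elim/freealg_ind=> s; elim/freealg_ind=> t; elim/freealg_ind=> u;
  rewrite /GRing.add /= !fE; apply/of_termP; constructor.
Qed.
Fact fmulZl a x y : fmul (a *: x) y = a *: fmul x y.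
Proof.
by elim/freealg_ind: x=> s; elim/freealg_ind: y => t;
  rewrite /GRing.scale /= !fE; apply/of_termP; constructor.
Qed.
Fact fmulZr a x y : fmul x (a *: y) = a *: fmul x y.
Proof.
by elim/freealg_ind: x=> s; elim/freealg_ind: y => t;
  rewrite /GRing.scale /= !fE; apply/of_termP; constructor.
Qed.

HB.instance Definition _ := Lmodule_isNonUnitalAlgebra.Build F freealg
  fmulA fmulDl fmulDr fmulZl fmulZr.

Definition fgen (x : X) : freealg := of_term (TGen x).

End FreeAlgebra.

(* The carriers are choiceTypes so that the library's sequences, paths and    *)
(* sums apply; classically every set carries such a structure.                *)

Record digraph := Digraph {
  vertex : choiceType;
  arrow : choiceType;
  source : arrow -> vertex;
  target : arrow -> vertex
}.

Arguments source {d}.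
Arguments target {d}.

Definition out (G : digraph) (v : vertex G) : set (arrow G) :=
  [set e | source e = v].

Section Leavitt.
Context (F : fieldType) (G : digraph).

Inductive leavitt_gen : Type :=
| LVertex of vertex G
| LArrow of arrow G
| LGhost of arrow G.

Local Notation free := (freealg F leavitt_gen).
Local Notation V v := (fgen F (LVertex v)).
Local Notation E e := (fgen F (LArrow e)).
Local Notation E' e := (fgen F (LGhost e)).

(* Each listed element is set to zero. *)
Inductive leavitt_rel : set free :=
| rel_vertex u v : leavitt_rel (V u ** V v - (u == v)%:R *: V u)
| rel_source e : leavitt_rel (V (source e) ** E e - E e)
| rel_target e : leavitt_rel (E e ** V (target e) - E e)
| rel_ghost_target e : leavitt_rel (V (target e) ** E' e - E' e)
| rel_ghost_source e : leavitt_rel (E' e ** V (source e) - E' e)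
| rel_CK1 e f : leavitt_rel (E' e ** E f - (e == f)%:R *: V (target e))
| rel_CK2 v : finite_set (out v) -> out v !=set0 ->
    leavitt_rel (V v - \sum_(e \in out v) (E e ** E' e)).

Definition leavitt : nuAlgType F := nuquot (ideal_gen leavitt_rel).

Definition lvertex (v : vertex G) : leavitt := to_quot _ (V v).
Definition larrow (e : arrow G) : leavitt := to_quot _ (E e).
Definition lghost (e : arrow G) : leavitt := to_quot _ (E' e).

End Leavitt.

Arguments leavitt F G : clear implicits.
Arguments lvertex F {G} v.
Arguments larrow F {G} e.
Arguments lghost F {G} e.

(* A cycle is stored as its first arrow and the remaining ones; for a         *)
(* sequence c, [cycle r c] also relates the last arrow to the first.          *)

Section Cycles.
Context (G : digraph).

Definition is_cycle (c : seq (arrow G)) : bool :=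
  cycle (fun e f => target e == source f) c && uniq (map source c).

Definition gcycle : Type := {c : arrow G * seq (arrow G) | is_cycle (c.1 :: c.2)}.
HB.instance Definition _ := Choice.on gcycle.

Definition cycle_seq (c : gcycle) : seq (arrow G) := (val c).1 :: (val c).2.
Definition cycle_source (c : gcycle) : vertex G := source (val c).1.

Definition rotation (c c' : gcycle) : Prop :=
  exists n : nat, cycle_seq c' = rot n (cycle_seq c).

End Cycles.

Section CanonicalPolynomials.
Context (F : fieldType) (G : digraph).
Local Notation L := (leavitt F G).

Definition cycle_elt (c : gcycle G) : L :=
  foldl (fun x e => x ** larrow F e) (larrow F (val c).1) (val c).2.

(* f(C); the factor s(C) in each power only matters for the constant term.    *)
Definition cycle_eval (c : gcycle G) (f : {poly F}) : L :=
  \sum_(i < size f) f`_i *: iter i (nmul (cycle_elt c)) (lvertex F (cycle_source c)).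

Definition cycle_subalg (c : gcycle G) : set L := range (cycle_eval c).

Definition contributes (J : nuIdeal L) (c : gcycle G) : Prop :=
  [set` J] `&` cycle_subalg c <> [set 0] /\
  [set` J] `&` cycle_subalg c <> cycle_subalg c.

Definition canonical_poly (J : nuIdeal L) (c : gcycle G) : {poly F} :=
  xget 0 [set f : {poly F} |
    f.[0] = 1 /\ forall g : {poly F}, cycle_eval c g \in J <-> f %| g].

End CanonicalPolynomials.

Definition splits (F : fieldType) (f : {poly F}) : Prop :=
  exists rs : seq F, f %= \prod_(a <- rs) ('X - a%:P).

(* Distinct irreducible factors are counted up to scalars, hence monic.       *)
Definition poly_radical (F : fieldType) (f : {poly F}) : {poly F} :=
  let p := \big[*%R/1]_(q \in [set q : {poly F} |
             [/\ q \is monic, irreducible_poly q & q %| f]]) q in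
  (p.[0])^-1 *: p.

Definition ideal_prime (F : fieldType) (G : digraph) (J : nuIdeal (leavitt F G)) :
    nuIdeal (leavitt F G) :=
  ideal_gen ([set` J] `|`
    [set x | exists2 c, contributes J c &
       x = cycle_eval c (poly_radical (canonical_poly J c))]).

Section QuotientDigraph.
Context (F : fieldType) (G : digraph) (J : nuIdeal (leavitt F G)).

Definition ideal_vertices : set (vertex G) := [set v | lvertex F v \in J].
Local Notation H := ideal_vertices.

Definition out_notin (v : vertex G) : set (arrow G) :=
  out v `&` [set e | ~ H (target e)].

Definition breaking : set (vertex G) :=
  [set v | [/\ infinite_set (out v), out_notin v !=set0
             & finite_set (out_notin v)]].

Definition breaking_elt (v : vertex G) : leavitt F G :=
  lvertex F v - \sum_(e \in out_notin v) (larrow F e ** lghost F e).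

Definition breaking_ideal : set (vertex G) :=
  breaking `&` [set v | breaking_elt v \in J].

Definition primed : set (vertex G) := breaking `\` breaking_ideal.

Lemma ideal_vertices_hereditary (e : arrow G) : H (source e) -> H (target e).
Proof.
rewrite /ideal_vertices /= => Hs.
have relL x : leavitt_rel x -> to_quot (ideal_gen (@leavitt_rel F G)) x = 0.
  by move=> Rx; rewrite -(linear0 (to_quot _)); apply/to_quotP; rewrite subr0;
    exact: ideal_gen_sub.
have s_e : lvertex F (source e) ** larrow F e = larrow F e.
  apply/eqP; rewrite -subr_eq0 -to_quotM -linearB; apply/eqP/relL.
  exact: rel_source.
have ee : lghost F e ** larrow F e = lvertex F (target e).
  apply/eqP; rewrite -subr_eq0 -to_quotM -linearB.
  by have /relL := rel_CK1 F e e; rewrite eqxx scale1r => /eqP.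
by rewrite -ee -s_e; apply/ideal_nmull/ideal_nmulr.
Qed.

Lemma source_notin (e : arrow G) : ~ H (target e) -> ~ H (source e).
Proof. by move=> Ht /ideal_vertices_hereditary. Qed.

Lemma primed_notin (v : vertex G) : primed v -> ~ H v.
Proof. by move=> [[_ [e [<- He]] _] _]; exact: source_notin. Qed.

Definition qvertex : choiceType := ((~` H) + primed)%type.
Definition qarrow : choiceType :=
  ([set e | ~ H (target e)] + [set e | primed (target e)])%type.

Definition old_vertex (v : vertex G) (vH : ~ H v) : qvertex :=
  inl (SigSub (mem_set vH : v \in ~` H)).

Definition qsource (e : qarrow) : qvertex :=
  match e with
  | inl e => old_vertex (source_notin (set_mem (valP e)))
  | inr e => old_vertex (source_notin (primed_notin (set_mem (valP e))))
  end.

Definition qtarget (e : qarrow) : qvertex :=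
  match e with
  | inl e => old_vertex (set_mem (valP e))
  | inr e => inr (SigSub (valP e : target (val e) \in primed))
  end.

Definition quotient_digraph : digraph := Digraph qsource qtarget.

End QuotientDigraph.

(* Each vertex w i becomes d i sinks (i, j), j < d i: the arrows leaving w i  *)
(* are deleted, and each remaining arrow into w i is replaced by d i arrows.  *)

Section SplitSinks.
Context (D : digraph) (I : choiceType) (w : I -> vertex D) (d : I -> nat).

Definition new_sink : choiceType := {i : I & 'I_(d i)}.

Definition kept_arrow : set (arrow D) :=
  [set e | ~ range w (source e) /\ ~ range w (target e)].
Definition new_arrow : set (arrow D * new_sink) :=
  [set x | ~ range w (source x.1) /\ target x.1 = w (tag x.2)].

Definition svertex : choiceType := ((~` range w) + new_sink)%type.
Definition sarrow : choiceType := (kept_arrow + new_arrow)%type.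

Definition kept_vertex (v : vertex D) (vw : ~ range w v) : svertex :=
  inl (SigSub (mem_set vw : v \in ~` range w)).

Definition ssource (e : sarrow) : svertex :=
  match e with
  | inl e => kept_vertex (proj1 (set_mem (valP e)))
  | inr x => kept_vertex (proj1 (set_mem (valP x)))
  end.

Definition starget (e : sarrow) : svertex :=
  match e with
  | inl e => kept_vertex (proj2 (set_mem (valP e)))
  | inr x => inr (val x).2
  end.

Definition split_sinks : digraph := Digraph ssource starget.

End SplitSinks.

Section SplitQuotient.
Context (F : fieldType) (G : digraph) (J : nuIdeal (leavitt F G)).

Definition contributing_cycle : choiceType := [set c | contributes J c].

(* Choosing an arrow e_C on each geometric cycle C amounts to choosing the    *)
(* rotation of C that starts with e_C, so that v_C is the source of the       *)
(* chosen representative.                                                     *)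
Definition geometric_transversal (K : set contributing_cycle) : Prop :=
  forall c : contributing_cycle,
    exists! k : contributing_cycle, K k /\ rotation (val c) (val k).

Lemma contributes_notin (c : gcycle G) :
  contributes J c -> ~ ideal_vertices J (cycle_source c).
Proof.
move=> [_]; apply: contra_not => Hc; apply/setIidr => _ [f _ <-] /=.
rewrite rpred_sum// => i _; rewrite rpredZ//.
by elim: {i}(i : nat) => [//|i IH] /=; exact: ideal_nmull.
Qed.

Context (K : set contributing_cycle).

(* Contributing cycles have no exit in the quotient digraph, so that e_C is   *)
(* the only arrow leaving v_C: deleting the arrows that leave v_C, as         *)
(* split_sinks does, deletes e_C only.                                        *)
Definition split_quotient_digraph : digraph :=
  split_sinks (D := quotient_digraph J) (I := K)
    (fun c => old_vertex (contributes_notin (set_mem (valP (val c)))))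
    (fun c => (size (canonical_poly J (val (val c)))).-1).

End SplitQuotient.

(* Main.v *)
(* For a contributing cycle C of J, f_C(C) in J makes C exitless modulo J, so the
   corner of L/J at s(C) commutes with C; hence the ideal of L/J generated by
   g_C(C) is nilpotent, and J' maps into the nilradical N, which is contained in
   the Jacobson radical.  Conversely L/J' is isomorphic to L(Gamma//J'), and
   Leavitt path algebras are semiprimitive, so the Jacobson radical lies in the
   image of J'; all three ideals coincide.

   In both places the tool is the reduction theorem: every nonzero a in a Leavitt
   path algebra has x a y equal to a vertex, or to f(C) with f <> 0 and C an
   exitless cycle.  For semiprimitivity, a vertex or a suitable f(C) is not left
   quasi-regular, as witnessed by a representation on functions with values in
   F[x]/(p).  For the isomorphism, a sink (C, j) is sent to the j-th Lagrange
   idempotent of F[C]/(f_C); a vertex in the kernel of the resulting map is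
   excluded directly, and f(C) in the kernel would make C contribute to J',
   whereas the vertices of C have not been cut. *)

From HB Require Import structures.
Require Import Defs.
From mathcomp Require Import all_boot all_order all_algebra.
From mathcomp Require Import finmap boolp classical_sets functions cardinality fsbigop.

Set Implicit Arguments.
Unset Strict Implicit.
Unset Printing Implicit Defensive.

Import GRing.Theory.
Local Open Scope classical_set_scope.
Local Open Scope ring_scope.

(** * Families satisfying the Leavitt relations *)

(** The algebras need not be unital, so radicals are handled through left quasi-regularity, and
    finite sums of vertices replace 1. The isomorphism is proved once, for any surjection [q] out of
    the path algebra with kernel [I]. It is then used twice: for L/J', to transport semiprimitivity,
    and for (L/J)/N, where it is the claim itself.

    The passage to J' and the roots in F enter together: the polynomial of J' at C divides g_C, so
    it has distinct roots in F, and F[C] modulo J' is a product of copies of F. There C is the sum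
    of the lam_j u_j, with orthogonal idempotents u_j, which become the sinks, and with roots lam_j
    that are nonzero because f_C(0) = 1. Hence the inverse of C in its corner also lies in the span
    of the u_j, and this is how the deleted arrow e_C and its ghost are recovered from the sinks and
    the remaining arrows of C. Those arrows survive because only one vertex of each geometric cycle
    is cut. *)

Section NonUnitalTheory.
Context (F : fieldType) (A : nuAlgType F).
Implicit Types x y z : A.

Lemma nmul0l x : 0 ** x = 0.
Proof. by rewrite -(scale0r x) nmulZl !scale0r. Qed.

Lemma nmul0r x : x ** 0 = 0.
Proof. by rewrite -(scale0r x) nmulZr !scale0r. Qed.

Lemma nmulNl x y : (- x) ** y = - (x ** y).
Proof. by rewrite -scaleN1r nmulZl scaleN1r. Qed.

Lemma nmulNr x y : x ** (- y) = - (x ** y).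
Proof. by rewrite -scaleN1r nmulZr scaleN1r. Qed.

Lemma nmul_suml (I : Type) (r : seq I) (P : pred I) (f : I -> A) y :
  (\sum_(i <- r | P i) f i) ** y = \sum_(i <- r | P i) f i ** y.
Proof. exact: (big_morph (nmul^~ y) (fun _ _ => nmulDl _ _ _) (nmul0l y)). Qed.

Lemma nmul_sumr (I : Type) (r : seq I) (P : pred I) (f : I -> A) y :
  y ** (\sum_(i <- r | P i) f i) = \sum_(i <- r | P i) y ** f i.
Proof. exact: (big_morph (nmul y) (nmulDr y) (nmul0r y)). Qed.

End NonUnitalTheory.

Section LeavittFamily.
Context (F : fieldType) (G : digraph).

(** The universal property: the representations and the isomorphism below are homomorphisms
    [leavitt_eval] given by such families. *)
Record leavitt_family (B : nuAlgType F) := LeavittFamily {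
  fv : vertex G -> B;
  fe : arrow G -> B;
  fg : arrow G -> B;
  fvv : forall u v, fv u ** fv v = (u == v)%:R *: fv u;
  fve : forall e, fv (source e) ** fe e = fe e;
  fev : forall e, fe e ** fv (target e) = fe e;
  fvg : forall e, fv (target e) ** fg e = fg e;
  fgv : forall e, fg e ** fv (source e) = fg e;
  fge : forall e f, fg e ** fe f = (e == f)%:R *: fv (target e);
  fCK2 : forall v, finite_set (out v) -> out v !=set0 ->
    fv v = \sum_(e \in out v) (fe e ** fg e)
}.

Section Eval.
Context (B : nuAlgType F) (p : leavitt_family B).

Definition gen_eval (x : leavitt_gen G) : B :=
  match x with
  | LVertex v => fv p v
  | LArrow e => fe p e
  | LGhost e => fg p e
  end.

Fixpoint term_eval (t : nuterm F (leavitt_gen G)) : B :=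
  match t with
  | TGen x => gen_eval x
  | TZero => 0
  | TOpp s => - term_eval s
  | TAdd s t => term_eval s + term_eval t
  | TScale a s => a *: term_eval s
  | TMul s t => term_eval s ** term_eval t
  end.

Lemma term_eval_eq s t : nuterm_eq s t -> term_eval s = term_eval t.
Proof.
elim=> //= {s t}.
- by move=> s t u _ -> _ ->.
- by move=> s t _ ->.
- by move=> s s' t t' _ -> _ ->.
- by move=> a s t _ ->.
- by move=> s s' t t' _ -> _ ->.
- by move=> s t u; rewrite addrA.
- by move=> s t; rewrite addrC.
- by move=> s; rewrite add0r.
- by move=> s; rewrite addNr.
- by move=> a b s; rewrite scalerA.
- by move=> s; rewrite scale1r.
- by move=> a s t; rewrite scalerDr.
- by move=> a b s; rewrite scalerDl.
- by move=> s t u; rewrite nmulA.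
- by move=> s t u; rewrite nmulDl.
- by move=> s t u; rewrite nmulDr.
- by move=> a s t; rewrite nmulZl.
- by move=> a s t; rewrite nmulZr.
Qed.

Definition free_eval (x : freealg F (leavitt_gen G)) : B := term_eval (repr x).

Lemma free_evalE s : free_eval (of_term s) = term_eval s.
Proof. exact/term_eval_eq/repr_of_term. Qed.

Fact free_eval_linear : linear free_eval.
Proof.
move=> a; elim/freealg_ind=> s; elim/freealg_ind=> t.
rewrite {1}/GRing.scale /= {1}/GRing.add /= fscaleE faddE !free_evalE /=.
by [].
Qed.

HB.instance Definition _ :=
  GRing.isLinear.Build F (freealg F (leavitt_gen G)) B _ free_eval free_eval_linear.

Lemma free_evalM : {morph free_eval : x y / x ** y}.
Proof.
elim/freealg_ind=> s; elim/freealg_ind=> t.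
by rewrite {1}/nmul /= fmulE !free_evalE.
Qed.

Lemma free_eval_gen x : free_eval (fgen F x) = gen_eval x.
Proof. by rewrite free_evalE. Qed.

Lemma free_eval_rel x : leavitt_rel x -> free_eval x = 0.
Proof.
case=> *; rewrite linearB /= ?linearZ /= ?free_evalM !free_eval_gen /=.
- by rewrite fvv scalerN subrr.
- by rewrite fve subrr.
- by rewrite fev subrr.
- by rewrite fvg subrr.
- by rewrite fgv subrr.
- by rewrite fge scalerN subrr.
rewrite fCK2 // !fsbig_finite// linear_sum/=; apply/eqP; rewrite subr_eq0; apply/eqP.
by apply: eq_bigr => e _; rewrite free_evalM !free_eval_gen.
Qed.

Definition free_ker : {pred freealg F (leavitt_gen G)} := fun x => free_eval x == 0.

Fact free_ker_submod : submod_closed free_ker.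
Proof.
split; first by rewrite unfold_in /free_ker linear0.
by move=> a x y /eqP x0 /eqP y0; rewrite unfold_in /free_ker linearP /= x0 y0 scaler0 addr0.
Qed.

Fact free_ker_mull a x : x \in free_ker -> a ** x \in free_ker.
Proof. by move=> /eqP x0; rewrite unfold_in /free_ker free_evalM x0 nmul0r. Qed.

Fact free_ker_mulr a x : x \in free_ker -> x ** a \in free_ker.
Proof. by move=> /eqP x0; rewrite unfold_in /free_ker free_evalM x0 nmul0l. Qed.

Definition free_ker_ideal := NuIdeal free_ker_submod free_ker_mull free_ker_mulr.

Definition leavitt_eval (x : leavitt F G) : B := free_eval (repr x).

(** Independence of the representative: the kernel of [free_eval] is an ideal containing the
    relations, hence the ideal that they generate. *)
Lemma leavitt_evalE x : leavitt_eval (to_quot _ x) = free_eval x.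
Proof.
have /to_quotP := to_quotK (to_quot (ideal_gen (@leavitt_rel F G)) x).
move=> /asboolP /(_ free_ker_ideal) H.
have {}H : repr (to_quot (ideal_gen (@leavitt_rel F G)) x) - x \in free_ker.
  by apply: H => y /free_eval_rel y0; apply/eqP.
by move/eqP: H; rewrite linearB/= => /eqP; rewrite subr_eq0 => /eqP.
Qed.

Fact leavitt_eval_linear : linear leavitt_eval.
Proof.
move=> a x y; rewrite -(to_quotK x) -(to_quotK y) -linearP /= !leavitt_evalE.
exact: linearP.
Qed.

HB.instance Definition _ :=
  GRing.isLinear.Build F (leavitt F G) B _ leavitt_eval leavitt_eval_linear.

Lemma leavitt_evalM : {morph leavitt_eval : x y / x ** y}.
Proof.
move=> x y; rewrite -(to_quotK x) -(to_quotK y) -to_quotM !leavitt_evalE.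
exact: free_evalM.
Qed.

Lemma leavitt_evalV v : leavitt_eval (lvertex F v) = fv p v.
Proof. by rewrite leavitt_evalE free_eval_gen. Qed.

Lemma leavitt_evalA e : leavitt_eval (larrow F e) = fe p e.
Proof. by rewrite leavitt_evalE free_eval_gen. Qed.

Lemma leavitt_evalG e : leavitt_eval (lghost F e) = fg p e.
Proof. by rewrite leavitt_evalE free_eval_gen. Qed.

End Eval.

Lemma leavitt_ind (P : leavitt F G -> Prop) :
  (forall a x y, P x -> P y -> P (a *: x + y)) -> P 0 ->
  (forall x y, P x -> P y -> P (x ** y)) ->
  (forall v, P (lvertex F v)) -> (forall e, P (larrow F e)) ->
  (forall e, P (lghost F e)) -> forall x, P x.
Proof.
move=> PL P0 PM PV PE PG x; rewrite -(to_quotK x); elim/freealg_ind: (repr x).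
have PZ a y : P y -> P (a *: y) by move=> Py; rewrite -[_ *: _]addr0; exact: PL.
elim=> [[v|e|e]||s IH|s IHs t IHt|a s IH|s IHs t IHt].
- exact: PV.
- exact: PE.
- exact: PG.
- by have -> : of_term (TZero F (leavitt_gen G)) = 0 by []; rewrite linear0.
- have -> : of_term (TOpp s) = - of_term s by rewrite [RHS]foppE.
  by rewrite linearN -scaleN1r; exact: PZ.
- have -> : of_term (TAdd s t) = of_term s + of_term t by rewrite [RHS]faddE.
  by rewrite to_quotD -[to_quot _ (of_term s)]scale1r; exact: PL.
- have -> : of_term (TScale a s) = a *: of_term s by rewrite [RHS]fscaleE.
  by rewrite linearZ; exact: PZ.
- have -> : of_term (TMul s t) = of_term s ** of_term t by rewrite [RHS]fmulE.
  by rewrite to_quotM; exact: PM.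
Qed.

Lemma leavitt_rel0 x : leavitt_rel x -> to_quot (ideal_gen (@leavitt_rel F G)) x = 0.
Proof.
by move=> Rx; rewrite -(linear0 (to_quot _)); apply/to_quotP; rewrite subr0;
  exact: ideal_gen_sub.
Qed.

Lemma leavitt_relE x y : leavitt_rel (x - y) ->
  to_quot (ideal_gen (@leavitt_rel F G)) x = to_quot _ y.
Proof. by move=> /leavitt_rel0; rewrite linearB => /eqP; rewrite subr_eq0 => /eqP. Qed.

(** Transparent, because later proofs convert between [fv], [fe], [fg] of this family and the
    generators. *)
Definition canonical_family : leavitt_family (leavitt F G).
Proof.
apply: (@LeavittFamily (leavitt F G) (lvertex F) (larrow F) (lghost F)).
- by move=> u v; rewrite -to_quotM -linearZ; apply/leavitt_relE/rel_vertex.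
- by move=> e; rewrite -to_quotM; apply/leavitt_relE/rel_source.
- by move=> e; rewrite -to_quotM; apply/leavitt_relE/rel_target.
- by move=> e; rewrite -to_quotM; apply/leavitt_relE/rel_ghost_target.
- by move=> e; rewrite -to_quotM; apply/leavitt_relE/rel_ghost_source.
- by move=> e f; rewrite -to_quotM -linearZ; apply/leavitt_relE/rel_CK1.
- move=> v fin v0; rewrite [LHS](leavitt_relE (rel_CK2 F fin v0)) !fsbig_finite// linear_sum.
  by apply: eq_bigr => e _; rewrite /= to_quotM.
Defined.

Definition map_family (A B : nuAlgType F) (q : {linear A -> B})
  (qM : {morph q : x y / x ** y}) (p : leavitt_family A) : leavitt_family B.
Proof.
apply: (@LeavittFamily B (q \o fv p) (q \o fe p) (q \o fg p)) => /=.
- by move=> u v; rewrite -qM fvv linearZ.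
- by move=> e; rewrite -qM fve.
- by move=> e; rewrite -qM fev.
- by move=> e; rewrite -qM fvg.
- by move=> e; rewrite -qM fgv.
- by move=> e f; rewrite -qM fge linearZ.
- move=> v fin v0; rewrite (fCK2 p fin v0) !fsbig_finite// linear_sum.
  by apply: eq_bigr => e _; rewrite /= qM.
Defined.

End LeavittFamily.

Arguments canonical_family F G : clear implicits.
Arguments fv : simpl never.
Arguments fe : simpl never.
Arguments fg : simpl never.

(** * Paths, cycles and evaluation of polynomials *)

Section Paths.
Context (G : digraph).
Implicit Types (v : vertex G) (e : arrow G) (s : seq (arrow G)).

(** The initial vertex is kept beside the list of arrows, so that every vertex has its trivial
    path. *)
Fixpoint is_path v s : bool :=
  if s is e :: s then (source e == v) && is_path (target e) s else true.

Definition path_end v s : vertex G := last v (map target s).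

Lemma is_path_cat v s1 s2 :
  is_path v (s1 ++ s2) = is_path v s1 && is_path (path_end v s1) s2.
Proof. by elim: s1 v => //= e s1 IH v; rewrite IH andbA. Qed.

Lemma path_end_cat v s1 s2 : path_end v (s1 ++ s2) = path_end (path_end v s1) s2.
Proof. by rewrite /path_end map_cat last_cat. Qed.

Lemma path_end_cons v e s : path_end v (e :: s) = path_end (target e) s.
Proof. by []. Qed.

Lemma is_cycleE e s :
  is_cycle (e :: s) =
  [&& is_path (source e) (e :: s), path_end (source e) (e :: s) == source e
    & uniq (map source (e :: s))].
Proof.
rewrite /is_cycle andbA; congr (_ && _); rewrite /= eqxx /= path_end_cons.
have H f t : path (fun e f => target e == source f) f (rcons t e) =
    is_path (target f) t && (path_end (target f) t == source e).
  elim: t f => /= [|g t IH] f; first by rewrite andbT.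
  by rewrite IH path_end_cons andbA [target f == _]eq_sym.
exact: H.
Qed.

End Paths.

Section PathElements.
Context (F : fieldType) (G : digraph) (B : nuAlgType F) (p : leavitt_family G B).
Implicit Types (v : vertex G) (e : arrow G) (s : seq (arrow G)).

Fixpoint pelt v s : B :=
  if s is e :: s then fe p e ** pelt (target e) s else fv p v.

Fixpoint gelt v s : B :=
  if s is e :: s then gelt (target e) s ** fg p e else fv p v.

Lemma fvK v : fv p v ** fv p v = fv p v.
Proof. by rewrite fvv eqxx scale1r. Qed.

Lemma fv_neq u v : u != v -> fv p u ** fv p v = 0.
Proof. by move=> /negbTE uv; rewrite fvv uv scale0r. Qed.

Lemma fgeK e : fg p e ** fe p e = fv p (target e).
Proof. by rewrite fge eqxx scale1r. Qed.

Lemma fge_neq e f : e != f -> fg p e ** fe p f = 0.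
Proof. by move=> /negbTE ef; rewrite fge ef scale0r. Qed.

Lemma fv_fe v e : fv p v ** fe p e = (v == source e)%:R *: fe p e.
Proof.
rewrite -{1}[fe p e]fve nmulA fvv nmulZl.
by case: eqP => [->|]; rewrite ?fve // !scale0r.
Qed.

Lemma fg_fv v e : fg p e ** fv p v = (source e == v)%:R *: fg p e.
Proof. by rewrite -{1}[fg p e]fgv -nmulA fvv nmulZr fgv. Qed.

Lemma fv_pelt v s : is_path v s -> fv p v ** pelt v s = pelt v s.
Proof. by case: s => [_|e s /= /andP[/eqP <- _]]; rewrite ?fvK // nmulA fve. Qed.

Lemma pelt_fv v s : pelt v s ** fv p (path_end v s) = pelt v s.
Proof. by elim: s v => [|e s IH] v /=; rewrite ?fvK // -nmulA IH. Qed.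

Lemma gelt_fv v s : is_path v s -> gelt v s ** fv p v = gelt v s.
Proof. by case: s => [_|e s /= /andP[/eqP <- _]]; rewrite ?fvK // -nmulA fgv. Qed.

Lemma fv_gelt v s : fv p (path_end v s) ** gelt v s = gelt v s.
Proof. by elim: s v => [|e s IH] v /=; rewrite ?fvK // nmulA IH. Qed.

Lemma pelt_cat v s1 s2 : is_path v (s1 ++ s2) ->
  pelt v (s1 ++ s2) = pelt v s1 ** pelt (path_end v s1) s2.
Proof.
elim: s1 v => /= [|e s1 IH] v; first by move=> ?; rewrite fv_pelt.
by move=> /andP[_ s12]; rewrite IH // nmulA.
Qed.

Lemma gelt_cat v s1 s2 : is_path v (s1 ++ s2) ->
  gelt v (s1 ++ s2) = gelt (path_end v s1) s2 ** gelt v s1.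
Proof.
elim: s1 v => /= [|e s1 IH] v; first by move=> ?; rewrite gelt_fv.
by move=> /andP[_ s12]; rewrite IH // nmulA.
Qed.

Lemma pelt1 e : pelt (source e) [:: e] = fe p e.
Proof. by rewrite /= fev. Qed.

Lemma gelt1 e : gelt (source e) [:: e] = fg p e.
Proof. by rewrite /= fvg. Qed.

Lemma geltK v s : is_path v s -> gelt v s ** pelt v s = fv p (path_end v s).
Proof.
elim: s v => /= [|e s IH] v; first by rewrite fvK.
move=> /andP[/eqP _ es]; rewrite -nmulA [fg p e ** _]nmulA fgeK fv_pelt //.
exact: IH.
Qed.

(** CK1 cancels the arrows pairwise from the middle; the first mismatch gives 0. *)
Lemma gelt_pelt u s0 v s : is_path u s0 -> is_path v s -> (size s0 <= size s)%N ->
  gelt u s0 ** pelt v s =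
  ((u == v) && prefix s0 s)%:R *: pelt (path_end u s0) (drop (size s0) s).
Proof.
elim: s0 u v s => [|e s0 IH] u v s /=.
  move=> _ vs _; rewrite prefix0s andbT drop0.
  case: s vs => [_|f s /= /andP[/eqP <- fs]] /=; first by rewrite fvv.
  by rewrite nmulA fv_fe nmulZl.
case: s => // f s /= /andP[/eqP <- es] /andP[/eqP <- fs] ss.
rewrite -nmulA [fg p e ** _]nmulA fge.
move: es; have [->|_] /= := eqVneq e f; last first.
  by move=> _; rewrite andbF scale0r nmul0l nmul0r scale0r.
by move=> es; rewrite !eqxx scale1r fv_pelt // IH // eqxx.
Qed.

Lemma iter_pelt v s n : is_path v s -> path_end v s = v ->
  iter n (nmul (pelt v s)) (fv p v) = pelt v (flatten (nseq n s)).
Proof.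
move=> vs ends; have pn k : is_path v (flatten (nseq k s)).
  by elim: k => //= k IH; rewrite is_path_cat vs ends.
elim: n => //= n ->.
by rewrite pelt_cat ?ends // is_path_cat vs ends pn.
Qed.

End PathElements.

Section PolyEval.
Context (F : fieldType) (B : nuAlgType F).
Implicit Types (v C : B) (f g : {poly F}).

(** Evaluation at [C] in a corner with unit [v]; it becomes multiplicative once [v] is an idempotent
    fixing [C] on both sides. *)
Definition cpoly v C f : B := \sum_(i < size f) f`_i *: iter i (nmul C) v.

Lemma cpoly_widen v C f n : (size f <= n)%N ->
  cpoly v C f = \sum_(i < n) f`_i *: iter i (nmul C) v.
Proof.
move=> fn; rewrite /cpoly (big_ord_widen n (fun i => f`_i *: iter i (nmul C) v) fn).
rewrite big_mkcond; apply: eq_bigr => i _; case: ltnP => // fi.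
by rewrite nth_default // scale0r.
Qed.

Fact cpoly_linear v C : linear (cpoly v C).
Proof.
move=> a f g; pose n := maxn (size (a *: f + g)) (maxn (size f) (size g)).
rewrite !(@cpoly_widen _ _ _ n) ?leq_max ?leqnn ?orbT //.
rewrite scaler_sumr -big_split; apply: eq_bigr => i _ /=.
by rewrite coefD coefZ scalerDl scalerA.
Qed.

HB.instance Definition _ v C :=
  GRing.isLinear.Build F {poly F} B _ (cpoly v C) (cpoly_linear v C).

Lemma cpolyXn v C i : cpoly v C 'X^i = iter i (nmul C) v.
Proof.
rewrite /cpoly size_polyXn big_ord_recr /= coefXn eqxx scale1r big1 ?add0r //.
by move=> j _; rewrite coefXn (ltn_eqF (ltn_ord j)) scale0r.
Qed.

Lemma cpoly1 v C : cpoly v C 1 = v.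
Proof. exact: (cpolyXn v C 0). Qed.

Lemma cpolyC v C a : cpoly v C a%:P = a *: v.
Proof. by rewrite -[a%:P]mulr1 mul_polyC linearZ /= cpoly1. Qed.

Lemma poly_linear_ind (P : {poly F} -> Prop) : (forall i, P 'X^i) ->
  (forall a f g, P f -> P g -> P (a *: f + g)) -> forall f, P f.
Proof.
move=> PX PL f.
have P0 : P 0 by have := PL (-1) _ _ (PX 0%N) (PX 0%N); rewrite scaleN1r addNr.
rewrite -[f]coefK poly_def.
by elim/big_rec: _ => // i x _ Px; exact: PL.
Qed.

Lemma cpolyXM v C f : cpoly v C ('X * f) = C ** cpoly v C f.
Proof.
elim/poly_linear_ind: f => [i|a f g IHf IHg].
  by rewrite -exprS !cpolyXn.
by rewrite mulrDr -scalerAr !linearP /= IHf IHg nmulDr nmulZr.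
Qed.

Lemma cpolyM v C f g : v ** v = v -> v ** C = C -> C ** v = C ->
  cpoly v C (f * g) = cpoly v C f ** cpoly v C g.
Proof.
move=> vv vC Cv; have vg : v ** cpoly v C g = cpoly v C g.
  elim/poly_linear_ind: g => [i|a f' g IHf IHg].
    by rewrite cpolyXn; case: i => [|i] //=; rewrite nmulA vC.
  by rewrite linearP /= nmulDr nmulZr IHf IHg.
elim/poly_linear_ind: f => [i|a f f' IHf IHf'].
  elim: i => [|i IH]; first by rewrite mul1r cpoly1 vg.
  by rewrite exprS -mulrA cpolyXM IH cpolyXM nmulA.
by rewrite mulrDl -scalerAl !linearP /= IHf IHf' nmulDl nmulZl.
Qed.

Lemma cpoly_vl v C f : v ** v = v -> v ** C = C -> C ** v = C ->
  v ** cpoly v C f = cpoly v C f.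
Proof. by move=> *; rewrite -{1}(cpoly1 v C) -cpolyM // mul1r. Qed.

Lemma cpoly_vr v C f : v ** v = v -> v ** C = C -> C ** v = C ->
  cpoly v C f ** v = cpoly v C f.
Proof. by move=> *; rewrite -{2}(cpoly1 v C) -cpolyM // mulr1. Qed.

Lemma cpolyX v C : C ** v = C -> cpoly v C 'X = C.
Proof. by move=> Cv; rewrite -['X]expr1 cpolyXn /= Cv. Qed.

End PolyEval.

Lemma cpoly_morph (F : fieldType) (A B : nuAlgType F) (q : {linear A -> B})
    (qM : {morph q : x y / x ** y}) v C f : q (cpoly v C f) = cpoly (q v) (q C) f.
Proof.
rewrite linear_sum; apply: eq_bigr => i _; rewrite linearZ /=; congr (_ *: _).
by elim: (i : nat) => //= n <-; rewrite qM.
Qed.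

Section CycleElement.
Context (F : fieldType) (G : digraph) (B : nuAlgType F) (p : leavitt_family G B).

Definition celt (c : gcycle G) : B := pelt p (cycle_source c) (cycle_seq c).

Lemma cycle_is_path (c : gcycle G) : is_path (cycle_source c) (cycle_seq c).
Proof. by case: c => [[e s] H]; have := H; rewrite is_cycleE => /and3P[]. Qed.

Lemma cycle_path_end (c : gcycle G) : path_end (cycle_source c) (cycle_seq c) = cycle_source c.
Proof. by case: c => [[e s] H]; have := H; rewrite is_cycleE => /and3P[_ /eqP]. Qed.

Lemma cycle_uniq (c : gcycle G) : uniq (map source (cycle_seq c)).
Proof. by case: c => [[e s] H]; have := H; rewrite is_cycleE => /and3P[]. Qed.

Lemma fv_celt c : fv p (cycle_source c) ** celt c = celt c.
Proof. exact/fv_pelt/cycle_is_path. Qed.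

Lemma celt_fv c : celt c ** fv p (cycle_source c) = celt c.
Proof. by rewrite /celt -[in RHS]pelt_fv cycle_path_end. Qed.

End CycleElement.

(** [cycle_elt] is a product nested to the left, [celt] one nested to the right and closed by a
    vertex. The induction therefore generalizes the head to any [x] with [x ** fv p v = x]. *)
Lemma cycle_elt_celt (F : fieldType) (G : digraph) (B : nuAlgType F)
    (q : {linear leavitt F G -> B}) (qM : {morph q : x y / x ** y}) (c : gcycle G) :
  q (cycle_elt F c) = celt (map_family qM (canonical_family F G)) c.
Proof.
rewrite /celt /cycle_elt /cycle_source /cycle_seq.
case: c => [[e s] H] /=; move: H; rewrite is_cycleE => /and3P[/= /andP[_ es] _ _].
set p := map_family _ _.
have -> : q (foldl (fun x e => x ** larrow F e) (larrow F e) s)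
  = foldl (fun x e => x ** fe p e) (fe p e) s.
  rewrite -[fe p e]/(q (larrow F e)).
  by elim: s (larrow F e) {es} => //= f s IH x; rewrite IH qM.
move: (p) (e) es => {p}p {}e es.
have: fe p e ** fv p (target e) = fe p e by exact: fev.
move: (fe p e) (target e) es => x v.
elim: s x v => //= f s IH x v /andP[/eqP fv' fs] xv.
rewrite (IH (x ** fe p f) (target f)) //; first by rewrite nmulA.
by rewrite -nmulA fev.
Qed.

Lemma cycle_eval_cpoly (F : fieldType) (G : digraph) (B : nuAlgType F)
    (q : {linear leavitt F G -> B}) (qM : {morph q : x y / x ** y})
    (p := map_family qM (canonical_family F G)) (c : gcycle G) (f : {poly F}) :
  q (cycle_eval c f) = cpoly (fv p (cycle_source c)) (celt p c) f.
Proof.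
by rewrite -cycle_elt_celt -[cycle_eval c f]/(cpoly _ _ f) cpoly_morph.
Qed.

(** * The reduction theorem *)

Section NormalForm.
Context (F : fieldType) (G : digraph).
Local Notation L := (leavitt F G).
Local Notation P := (canonical_family F G).
Implicit Types (v : vertex G) (e : arrow G) (a b x y : L).

Definition path_comb (l : seq (F * (vertex G * seq (arrow G)))) : L :=
  \sum_(t <- l) t.1 *: pelt P t.2.1 t.2.2.

(* Spanned by real paths, that is, without ghost arrows. *)
Definition real a : Prop :=
  exists2 l, all (fun t => is_path t.2.1 t.2.2) l & a = path_comb l.

(* Combinations of elements [pelt v s ** gelt w s'] with [size s' <= n]. *)
Fixpoint ghost_degree n a : Prop :=
  if n is n.+1 then
    exists b (l : seq (L * arrow G)), [/\ real b,
      forall t, t \in l -> ghost_degree n t.1 &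
      a = b + \sum_(t <- l) t.1 ** fg P t.2]
  else real a.

Lemma real_linear c x y : real x -> real y -> real (c *: x + y).
Proof.
move=> [l lp ->] [l' lp' ->].
exists ([seq (c * t.1, t.2) | t <- l] ++ l').
  by rewrite all_cat lp' andbT all_map.
rewrite /path_comb big_cat big_map /=; congr (_ + _).
by rewrite scaler_sumr; apply: eq_bigr => t _; rewrite scalerA.
Qed.

Lemma real0 : real 0.
Proof. by exists [::]; rewrite // /path_comb big_nil. Qed.

Lemma real_scale c x : real x -> real (c *: x).
Proof. by move=> rx; rewrite -[_ *: _]addr0; apply: real_linear => //; exact: real0. Qed.

Lemma real_path v s : is_path v s -> real (pelt P v s).
Proof.
by move=> vs; exists [:: (1, (v, s))]; rewrite /= ?vs // /path_comb big_seq1 scale1r.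
Qed.

Lemma real_sum (I : eqType) (r : seq I) (f : I -> L) :
  (forall i, i \in r -> real (f i)) -> real (\sum_(i <- r) f i).
Proof.
move=> H; rewrite big_seq; elim/big_ind: _ => //; first exact: real0.
by move=> x y rx ry; rewrite -[x]scale1r; exact: real_linear.
Qed.

Lemma real_fv v x : real x -> real (x ** fv P v).
Proof.
move=> [l lp ->]; rewrite nmul_suml; apply: real_sum => t tl.
rewrite nmulZl; apply: real_scale; rewrite -pelt_fv -nmulA fvv nmulZr pelt_fv.
by apply/real_scale/real_path/(allP lp).
Qed.

Lemma real_fe e x : real x -> real (x ** fe P e).
Proof.
move=> [l lp ->]; rewrite nmul_suml; apply: real_sum => t tl.
rewrite nmulZl; apply: real_scale; rewrite -pelt_fv -nmulA fv_fe nmulZr.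
have [te|_] := eqVneq; last by rewrite scale0r; exact: real0.
rewrite scale1r; have tp : is_path t.2.1 (t.2.2 ++ [:: e]).
  by rewrite is_path_cat (allP lp _ tl) /= te eqxx.
have := real_path tp; rewrite pelt_cat // te pelt1.
by [].
Qed.

Lemma real_ghost n x : real x -> ghost_degree n x.
Proof. by case: n => // n rx; exists x, [::]; split; rewrite // big_nil addr0. Qed.

Lemma ghost_linear n c x y :
  ghost_degree n x -> ghost_degree n y -> ghost_degree n (c *: x + y).
Proof.
elim: n c x y => [|n IH] c x y; first exact: real_linear.
move=> [b [l [rb lg ->]]] [b' [l' [rb' lg' ->]]].
exists (c *: b + b'), ([seq (c *: t.1, t.2) | t <- l] ++ l'); split.
- exact: real_linear.
- move=> t; rewrite mem_cat => /orP[/mapP[t' /lg gt' ->]|/lg' //] /=.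
  by rewrite -[_ *: _]addr0; apply: IH => //; exact/real_ghost/real0.
rewrite big_cat big_map /= scalerDr addrACA; congr (_ + (_ + _)).
by rewrite scaler_sumr; apply: eq_bigr => t _; rewrite nmulZl.
Qed.

Lemma ghost_scale n c x : ghost_degree n x -> ghost_degree n (c *: x).
Proof.
by move=> gx; rewrite -[_ *: _]addr0; apply: ghost_linear => //; exact/real_ghost/real0.
Qed.

Lemma ghost_sum n (I : eqType) (r : seq I) (f : I -> L) :
  (forall i, i \in r -> ghost_degree n (f i)) -> ghost_degree n (\sum_(i <- r) f i).
Proof.
move=> H; rewrite big_seq; elim/big_ind: _ => //; first exact/real_ghost/real0.
by move=> x y rx ry; rewrite -[x]scale1r; exact: ghost_linear.
Qed.

Lemma ghostS n x : ghost_degree n x -> ghost_degree n.+1 x.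
Proof.
elim: n x => [|n IH] x; first exact: (@real_ghost 1).
by move=> [b [l [rb lg ->]]]; exists b, l; split=> // t /lg /IH.
Qed.

Lemma ghost_leq m n x : (m <= n)%N -> ghost_degree m x -> ghost_degree n x.
Proof.
move=> /subnK <-; elim: (n - m)%N => // k IH /IH.
by rewrite addSn; exact: ghostS.
Qed.

Lemma ghost_fv n v x : ghost_degree n x -> ghost_degree n (x ** fv P v).
Proof.
case: n => [|n]; first exact: real_fv.
move=> [b [l [rb lg ->]]]; rewrite nmulDl nmul_suml.
exists (b ** fv P v), [seq ((source t.2 == v)%:R *: t.1, t.2) | t <- l]; split.
- exact: real_fv.
- by move=> t /mapP[t' /lg gt' ->] /=; exact: ghost_scale.
congr (_ + _); rewrite big_map; apply: eq_bigr => t _.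
by rewrite -nmulA fg_fv nmulZr nmulZl.
Qed.

(** The final ghost of each term is absorbed by CK1. This descent drives the induction in
    [reduction]. *)
Lemma ghost_fe n e x : ghost_degree n.+1 x -> ghost_degree n (x ** fe P e).
Proof.
move=> [b [l [rb lg ->]]]; rewrite nmulDl nmul_suml -[b ** _]scale1r.
apply: ghost_linear; first exact/real_ghost/real_fe.
apply: ghost_sum => t /lg gt; rewrite -nmulA fge nmulZr.
exact/ghost_scale/ghost_fv.
Qed.

Lemma ghost_fg n e x : ghost_degree n x -> ghost_degree n.+1 (x ** fg P e).
Proof.
move=> gx; exists 0, [:: (x, e)]; split; first exact: real0.
  by move=> t; rewrite inE => /eqP ->.
by rewrite big_seq1 add0r.
Qed.

Lemma ghost_degreeP a : exists n, ghost_degree n a.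
Proof.
(* The second conjunct, on right multiplication by [a], carries the product case of the
   induction. *)
suff [] : (exists n, ghost_degree n a) /\
  (forall m x, ghost_degree m x -> exists n, ghost_degree n (x ** a)) by [].
elim/leavitt_ind: a => [c x y [[m gx] mx] [[n gy] my]||x y [ex mx] [ey my]|v|e|e].
- split.
    by exists (maxn m n); apply: ghost_linear; [apply: ghost_leq gx|apply: ghost_leq gy];
      rewrite leq_max leqnn ?orbT.
  move=> k z gz; have [m' gx'] := mx _ _ gz; have [n' gy'] := my _ _ gz.
  exists (maxn m' n'); rewrite nmulDr nmulZr.
  by apply: ghost_linear; [apply: ghost_leq gx'|apply: ghost_leq gy'];
      rewrite leq_max leqnn ?orbT.
- split; first by exists 0%N; exact: real0.
  by move=> m x _; exists 0%N; rewrite nmul0r; exact: real0.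
- split; first by case: ex => n /my.
  by move=> m z /mx[n /my]; rewrite nmulA.
- split; first by exists 0%N; exact: (@real_path v [::]).
  by move=> m x gx; exists m; exact: ghost_fv.
- split; last by move=> m x /ghostS gx; exists m; exact: ghost_fe.
  exists 0%N; rewrite -[larrow F e]/(fe P e) -pelt1; apply: real_path.
  by rewrite /= eqxx.
- split; last by move=> m x gx; exists m.+1; exact: ghost_fg.
  exists 1%N; rewrite -[lghost F e]/(fg P e) -fvg; apply: ghost_fg.
  exact: (@real_path (target e) [::]).
Qed.

(** A finite sum of distinct vertices, including those that [a] uses on the right, is a right unit
    for [a]. Allowing every larger list lets the lists of two summands be merged. *)
Lemma local_unit a : a <> 0 -> exists v, a ** fv P v <> 0.
Proof.
have sum_fe x v (vs : seq (vertex G)) : uniq vs -> v \in vs -> x ** fv P v = x ->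
    x ** \sum_(w <- vs) fv P w = x.
  move=> us vs_v xv; rewrite nmul_sumr (bigD1_seq v) //= xv big1 ?addr0 // => w wv.
  by rewrite -xv -nmulA fv_neq ?nmul0r // eq_sym.
have [vs vsP] : exists vs : seq (vertex G), forall ws, uniq ws -> {subset vs <= ws} ->
    a ** \sum_(v <- ws) fv P v = a.
  elim/leavitt_ind: a => [c x y [vs vx] [ws wy]||x y [vs vx] [ws wy]|v|e|e].
  - exists (vs ++ ws) => us uu sub; rewrite nmulDl nmulZl vx ?wy // => v vv.
    + by apply: sub; rewrite mem_cat vv orbT.
    + by apply: sub; rewrite mem_cat vv.
  - by exists [::] => ws _ _; rewrite nmul0l.
  - by exists ws => us uu sub; rewrite -nmulA wy.
  - exists [:: v] => ws uw sub; apply: (@sum_fe _ v); rewrite ?sub ?inE //.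
    exact: (fvK P).
  - exists [:: target e] => ws uw sub; apply: (@sum_fe _ (target e)); rewrite ?sub ?inE //.
    exact: (fev P).
  - exists [:: source e] => ws uw sub; apply: (@sum_fe _ (source e)); rewrite ?sub ?inE //.
    exact: (fgv P).
move=> a0; apply: contrapT => H; apply: a0.
rewrite -(vsP (undup vs)) ?undup_uniq //; last by move=> v; rewrite mem_undup.
rewrite nmul_sumr big1_seq // => v _.
by apply: contrapT => av; apply: H; exists v.
Qed.

End NormalForm.

Section ClosedPaths.
Context (G : digraph).
Implicit Types (v : vertex G) (s : seq (arrow G)).

Definition closed_path v s : bool :=
  [&& is_path v s, path_end v s == v & s != [::]].

(** Each arrow of [s] is the only one leaving its source. For a cycle, whose sources are distinct,
    this is the absence of exits. *)
Definition exitless s : Prop :=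
  forall e f : arrow G, e \in s -> source f = source e -> f = e.

Lemma exitless_prefix v s1 s2 : is_path v s1 -> is_path v s2 -> exitless s1 ->
  (size s1 <= size s2)%N -> prefix s1 s2.
Proof.
elim: s1 v s2 => [|e s1 IH] v s2 /=; first by rewrite prefix0s.
case: s2 => // f s2 /= /andP[/eqP ev es] /andP[/eqP fv fs] ex ss.
have fe : f = e by apply: ex; rewrite ?inE ?eqxx // ev.
rewrite fe eqxx /=; apply: (IH (target e)) => //; first by rewrite -fe.
by move=> g h gs; apply: ex; rewrite inE gs orbT.
Qed.

Lemma path_end_take v s e0 i : is_path v s -> (i < size s)%N ->
  path_end v (take i s) = source (nth e0 s i).
Proof.
move=> vs is_; move: vs; rewrite -{1}(cat_take_drop i s) (drop_nth e0) // is_path_cat /=.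
by move=> /and3P[_ /eqP ->].
Qed.

(** A shortest exitless closed path at [v] is a cycle, as the loop between two visits to a vertex
    could be cut out. It is a prefix of every other one by [exitless_prefix], and stripping it
    repeatedly exhibits the other as a power. *)
Lemma exitless_cycle v s0 : closed_path v s0 -> exitless s0 ->
  exists c : gcycle G, [/\ cycle_source c = v, exitless (cycle_seq c) &
    forall s, closed_path v s -> exitless s ->
      exists n, s = flatten (nseq n.+1 (cycle_seq c))].
Proof.
move=> cs0 ex0; pose ok s := closed_path v s /\ exitless s.
have [|n /asboolP[C [[Cc Ce] Cn]] Cmin] := @ex_minnP (fun n => `[< exists s, ok s /\ size s = n >]).
  by exists (size s0); apply/asboolP; exists s0.
have {}Cmin s : ok s -> (size C <= size s)%N.
  by move=> oks; rewrite Cn; apply: Cmin; apply/asboolP; exists s.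
have /and3P[vC /eqP endC C0] := Cc.
have uC : uniq (map source C).
  apply: contrapT => /negP/(uniqPn v)[i [j [ij jC]]].
  rewrite size_map in jC; have iC := ltn_trans ij jC.
  case: C C0 Cc Ce Cn Cmin vC endC jC iC => // e0 C0.
  set C := e0 :: C0 => _ Cc Ce Cn Cmin vC endC jC iC.
  rewrite !(nth_map e0) // => sij.
  have : ok (take i C ++ drop j C).
    split; last first.
      by move=> e f; rewrite mem_cat => /orP[/mem_take|/mem_drop]; exact: Ce.
    have endij : path_end v (take i C) = path_end v (take j C).
      by rewrite !(path_end_take e0).
    have := vC; rewrite -{1}(cat_take_drop j C) is_path_cat => /andP[_ jp].
    have := vC; rewrite -{1}(cat_take_drop i C) is_path_cat => /andP[ip _].
    apply/and3P; split.
    - by rewrite is_path_cat ip endij.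
    - by rewrite path_end_cat endij -path_end_cat cat_take_drop endC.
    - by rewrite -size_eq0 size_cat size_drop -lt0n addn_gt0 subn_gt0 jC orbT.
  move=> /Cmin; rewrite size_cat size_drop size_take iC leqNgt => /negP; apply.
  by rewrite -[X in (_ < X)%N](subnKC (ltnW jC)) ltn_add2r.
case: C C0 Cc Ce Cn Cmin vC endC uC => // e0 C0.
set C := e0 :: C0 => _ Cc Ce Cn Cmin vC endC uC.
have e0v : source e0 = v by move: vC => /andP[/eqP].
have cC : is_cycle C by rewrite is_cycleE e0v vC endC eqxx.
pose c : gcycle G := exist _ (e0, C0) cC.
exists c; split => // s.
have [m] := ubnP (size s); elim: m s => // m IH s sm cs exs.
have CsS := Cmin s (conj cs exs); have /and3P[vs /eqP ends s_neq0] := cs.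
have /prefixP[s' sE] := exitless_prefix vC vs Ce CsS.
have [s'0|s'0] := eqVneq s' [::].
  by exists 0%N; rewrite /= cats0 sE s'0 cats0.
have [||| n' s'E] := IH s'.
- by move: sm; rewrite sE size_cat /= ltnS; apply: leq_trans; rewrite ltnS leq_addl.
- move: vs ends; rewrite sE is_path_cat path_end_cat endC => /andP[_ vs'] ends.
  by rewrite /closed_path vs' ends eqxx.
- by move=> e f es; apply: exs; rewrite sE mem_cat es orbT.
by exists n'.+1; rewrite sE s'E.
Qed.

End ClosedPaths.

Section Reduction.
Context (F : fieldType) (G : digraph).
Local Notation L := (leavitt F G).
Local Notation P := (canonical_family F G).
Implicit Types (v : vertex G) (e : arrow G) (a b x y : L).

Definition reduces a : Prop := exists x y,
  (exists v, x ** a ** y = lvertex F v) \/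
  exists (c : gcycle G) (f : {poly F}),
    [/\ exitless (cycle_seq c), f != 0 & x ** a ** y = cycle_eval c f].

Lemma reduces_mul x a y : reduces (x ** a ** y) -> reduces a.
Proof.
move=> [x' [y' H]]; exists (x' ** x), (y ** y').
by move: H; rewrite !nmulA.
Qed.

Definition loop_comb v (k : F) (l : seq (F * seq (arrow G))) : L :=
  k *: fv P v + \sum_(t <- l) t.1 *: pelt P v t.2.

Lemma iter_celt (c : gcycle G) n :
  iter n (nmul (celt P c)) (fv P (cycle_source c)) =
  pelt P (cycle_source c) (flatten (nseq n (cycle_seq c))).
Proof. exact: (iter_pelt _ _ (cycle_is_path c) (cycle_path_end c)). Qed.

Lemma cycle_evalE (c : gcycle G) f :
  cycle_eval c f = cpoly (fv P (cycle_source c)) (celt P c) f.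
Proof.
have qM : {morph (@idfun L) : x y / x ** y} by [].
exact: (@cycle_eval_cpoly F G L idfun qM c f).
Qed.

(** Conjugation by [lam] preserves the coefficient [k]; a closed path mu becomes the nu with mu lam
    = lam nu, or 0 if there is none. *)
Lemma loop_combM v k l lam : is_path v lam ->
  all (fun t => closed_path v t.2) l ->
  gelt P v lam ** loop_comb v k l ** pelt P v lam =
  loop_comb (path_end v lam) k
    [seq (t.1, drop (size lam) (t.2 ++ lam)) | t <- l & prefix lam (t.2 ++ lam)].
Proof.
move=> vlam cl; rewrite /loop_comb nmulDr nmulDl nmulZr nmulZl gelt_fv // geltK //.
congr (_ + _); rewrite nmul_sumr nmul_suml big_map big_filter [RHS]big_mkcond.
apply: eq_big_seq => t tl; have /and3P[vt /eqP et _] := allP cl _ tl.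
rewrite nmulZr nmulZl -nmulA.
have vtl : is_path v (t.2 ++ lam) by rewrite is_path_cat vt et.
have -> : pelt P v t.2 ** pelt P v lam = pelt P v (t.2 ++ lam) by rewrite pelt_cat ?et.
rewrite gelt_pelt // ?size_cat ?leq_addl // eqxx /=.
by case: prefix; rewrite ?scale1r // scale0r scaler0.
Qed.

(* If an arrow f leaves some closed path s1 ++ e :: s2 of the combination, then
   conjugating by s1 ++ [:: f] kills that path and leaves a combination of the
   same kind with fewer terms.  Without exits, all the closed paths are powers of
   one cycle. *)
Lemma reduces_loop_comb v k l : k != 0 -> all (fun t => closed_path v t.2) l ->
  reduces (loop_comb v k l).
Proof.
move=> k0; have [n] := ubnP (size l); elim: n v l => // n IH v l ln cl.
have [ex|/existsNP[t /not_implyP[tl nex]]] :=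
  pselect (forall t, t \in l -> exitless t.2); last first.
  rewrite /exitless in nex; move/existsNP: nex => [e /existsNP[f]].
  move=> /not_implyP[et /not_implyP[sfe /eqP fe]].
  have /and3P[vt /eqP ent _] := allP cl _ tl.
  have [s1 [s2 tE]] : exists s1 s2, t.2 = s1 ++ e :: s2.
    by case/splitPr: et => s1 s2; exists s1, s2.
  pose lam := s1 ++ [:: f].
  have vlam : is_path v lam.
    by move: vt; rewrite tE !is_path_cat /= sfe => /andP[-> /andP[-> _]].
  have lamt : ~~ prefix lam (t.2 ++ lam).
    apply/negP => /prefixP[r] /eqP; rewrite tE /lam -!catA eqseq_cat // eqxx /=.
    by rewrite eqseq_cons eq_sym (negbTE fe).
  apply: (@reduces_mul (gelt P v lam) _ (pelt P v lam)); rewrite loop_combM //.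
  apply: IH.
    rewrite size_map size_filter; rewrite ltnS in ln; apply: leq_trans ln.
    rewrite -(count_predC (fun t => prefix lam (t.2 ++ lam)) l) -addn1 leq_add2l.
    by rewrite -has_count; apply/hasP; exists t.
  apply/allP => u /mapP[t']; rewrite mem_filter => /andP[/prefixP[r rE] t'l ->] /=.
  have /and3P[vt' /eqP et' t'0] := allP cl _ t'l.
  have : is_path v (t'.2 ++ lam) by rewrite is_path_cat vt' et'.
  have : path_end v (t'.2 ++ lam) = path_end v lam by rewrite path_end_cat et'.
  rewrite rE path_end_cat is_path_cat drop_size_cat // => re /andP[_ rp].
  rewrite /closed_path rp re eqxx /= -size_eq0 -(eqn_add2l (size lam)) -size_cat -rE.
  by rewrite size_cat addn0 -[X in _ == X]add0n eqn_add2r size_eq0.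
case: l {IH ln} cl ex => [|t0 l] cl ex.
  exists (k^-1 *: fv P v), (fv P v); left; exists v.
  by rewrite /loop_comb big_nil addr0 !(nmulZl, nmulZr) !fvK scalerA mulVf // scale1r.
have t0l : t0 \in t0 :: l by rewrite inE eqxx.
have [c [cv exc cP]] := exitless_cycle (allP cl _ t0l) (ex _ t0l).
exists (fv P v), (fv P v); right.
(* Every path in the sum is a positive power of C, so [k] survives as the constant term of the total
   polynomial, which is therefore nonzero. *)
have [f f0 fE] : exists2 f : {poly F}, f.[0] = 0 &
    \sum_(t <- t0 :: l) t.1 *: pelt P v t.2 = cycle_eval c f.
  elim: (t0 :: l) cl ex => [|t s IHs] /= cl ex.
    by exists 0; rewrite ?horner0 // big_nil cycle_evalE linear0.
  case/andP: cl => ct cs.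
  have [|f f0 fE] := IHs cs; first by move=> u us; apply: ex; rewrite inE us orbT.
  have [m tE] := cP _ ct (ex _ (mem_head _ _)).
  exists (t.1 *: 'X^(m.+1) + f).
    by rewrite hornerD hornerZ hornerXn f0 exprS mul0r mulr0 addr0.
  by rewrite big_cons fE !cycle_evalE linearP /= cpolyXn iter_celt -tE cv.
exists c, (k%:P + f); split => //.
  apply: contra_neq k0 => /(congr1 (horner^~ 0)).
  by rewrite hornerD hornerC f0 addr0 horner0.
rewrite /loop_comb fE !cycle_evalE linearD /= cpolyC cv.
rewrite nmulDr nmulDl !(nmulZl, nmulZr) !fvK -cv.
by rewrite cpoly_vl ?cpoly_vr ?fvK ?celt_fv ?fv_celt.
Qed.

(** The ghost of a shortest path [s0] turns the terms at [s0] into multiples of [v] and each other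
    term into 0 or a nontrivial closed path. If the coefficients at [s0] add up to 0, these terms
    are dropped and the argument repeated. *)
Lemma leading_loop_comb v (l : seq (F * (vertex G * seq (arrow G)))) :
  all (fun t => is_path t.2.1 t.2.2) l ->
  all (fun t => path_end t.2.1 t.2.2 == v) l -> path_comb l <> 0 ->
  exists x k l', [/\ k != 0, all (fun t => closed_path v t.2) l' &
    x ** path_comb l = loop_comb v k l'].
Proof.
have [n] := ubnP (size l); elim: n l => // n IH l ln pl el l0.
have [[k0 [u0 s0]] [t0l s0min]] : exists t0, t0 \in l /\
    forall t, t \in l -> (size t0.2.2 <= size t.2.2)%N.
  have [|m /hasP[t0 t0l /eqP t0m] mmin] :=
      @ex_minnP (fun m => has (fun t => size t.2.2 == m) l).
    case: l l0 {IH ln pl el} => [|t l] l0; first by case: l0; rewrite /path_comb big_nil.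
    by exists (size t.2.2); rewrite /= eqxx.
  exists t0; split=> // t tl; rewrite t0m; apply: mmin.
  by apply/hasP; exists t.
have /= us0 := allP pl _ t0l; have /eqP /= es0 := allP el _ t0l.
rewrite /= in s0min.
have -> : path_comb l = (\sum_(t <- l | t.2 == (u0, s0)) t.1) *: pelt P u0 s0
    + path_comb [seq t <- l | t.2 != (u0, s0)].
  rewrite /path_comb (bigID (fun t => t.2 == (u0, s0))) /= big_filter; congr (_ + _).
  by rewrite scaler_suml; apply: eq_bigr => t /eqP ->.
have [k0E|k0E] := eqVneq (\sum_(t <- l | t.2 == (u0, s0)) t.1) 0.
  rewrite k0E scale0r add0r; apply: IH.
  - rewrite size_filter; rewrite ltnS in ln; apply: leq_trans ln.
    rewrite -(count_predC (fun t => t.2 != (u0, s0)) l) -addn1 leq_add2l.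
    by rewrite -has_count; apply/hasP; exists (k0, (u0, s0)); rewrite //= eqxx.
  - by apply/allP => t; rewrite mem_filter => /andP[_]; exact: (allP pl).
  - by apply/allP => t; rewrite mem_filter => /andP[_]; exact: (allP el).
  - move=> H; apply: l0; rewrite -H /path_comb big_filter.
    rewrite (bigID (fun t => t.2 == (u0, s0))) /=.
    rewrite [X in X + _](_ : _ = 0) ?add0r // -[RHS](scale0r (pelt P u0 s0)) -k0E.
    by rewrite scaler_suml; apply: eq_bigr => t /eqP ->.
exists (gelt P u0 s0), (\sum_(t <- l | t.2 == (u0, s0)) t.1).
exists [seq (t.1, drop (size s0) t.2.2) |
  t <- l & [&& t.2 != (u0, s0), u0 == t.2.1 & prefix s0 t.2.2]].
split=> //.
  apply/allP => u /mapP[t]; rewrite mem_filter => /andP[/and3P[t0 /eqP ut pt] tl ->] /=.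
  have := allP pl _ tl; have := allP el _ tl.
  case/prefixP: pt => r tE; rewrite tE drop_size_cat // -ut is_path_cat path_end_cat.
  rewrite /closed_path es0 => -> /andP[_ ->] /=.
  apply: contraNneq t0 => r0; move: tE; rewrite r0 cats0 => <-.
  by rewrite ut -surjective_pairing.
rewrite nmulDr nmulZr geltK // es0; congr (_ + _).
rewrite /path_comb nmul_sumr big_filter big_map big_filter.
rewrite big_mkcond [RHS]big_mkcond; apply: eq_big_seq => t tl.
case: eqP => //= _; rewrite nmulZr gelt_pelt ?s0min ?(allP pl) // es0.
by case: (_ && _); rewrite ?scale1r // scale0r scaler0.
Qed.

(** Induction on the ghost degree. The hard case is [a ** fv P v <> 0] with [a] killed by every
    arrow leaving [v]. CK2 excludes this at a regular vertex, and at a sink the ghost terms end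
    elsewhere, so only the real part [b] counts. An infinite emitter needs a separate argument. *)
Theorem reduction a : a <> 0 -> reduces a.
Proof.
have realP b v : real b -> b ** fv P v <> 0 -> exists x k l, [/\ k != 0,
    all (fun t => closed_path v t.2) l & x ** (b ** fv P v) = loop_comb v k l].
  move=> [l pl ->] bv; have bvE : path_comb l ** fv P v =
      path_comb [seq t <- l | path_end t.2.1 t.2.2 == v].
    rewrite /path_comb nmul_suml big_filter [RHS]big_mkcond; apply: eq_bigr => t _.
    rewrite nmulZl -pelt_fv -nmulA fvv nmulZr pelt_fv.
    by case: eqP; rewrite ?scale1r // scale0r scaler0.
  rewrite bvE in bv *; apply: leading_loop_comb => //; last exact: filter_all.
  by apply/allP => t; rewrite mem_filter => /andP[_]; exact: (allP pl).
have realR b v : real b -> b ** fv P v <> 0 -> reduces (b ** fv P v).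
  move=> rb /(realP _ _ rb)[x [k [l [k0 cl bE]]]].
  apply: (@reduces_mul x _ (fv P v)); rewrite -nmulA -(nmulA b) fvK bE.
  exact: reduces_loop_comb.
have reducesr a' y : reduces (a' ** y) -> reduces a'.
  by move=> [x' [y' H]]; exists x', (y ** y'); move: H; rewrite !nmulA.
have [n] := ghost_degreeP a; elim: n a => [|n IH] a ga /local_unit[v av].
  exact: (reducesr _ (fv P v) (realR _ _ ga av)).
have [[e [_ /(IH _ (ghost_fe e ga))]]|ae0] :=
    pselect (exists e, source e = v /\ a ** fe P e <> 0); first exact: reducesr.
have {}ae0 e : source e = v -> a ** fe P e = 0.
  by move=> ev; apply: contrapT => ?; apply: ae0; exists e.
have [fin|inf] := pselect (finite_set (out v)).
  have [v0|v0] := pselect (out v !=set0).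
    case: av; rewrite (fCK2 P fin v0) fsbig_finite // nmul_sumr big1_seq // => e /=.
    by rewrite in_fset_set // inE => /ae0 ae; rewrite nmulA ae nmul0l.
  move: ga av => [b [l [rb lg aE]]] av; apply: (reducesr _ (fv P v)).
  have avb : a ** fv P v = b ** fv P v.
    rewrite aE nmulDl nmul_suml big1 ?addr0 // => t _.
    rewrite -nmulA fg_fv; case: eqP => [tv|_]; first by case: v0; exists t.2.
    by rewrite scale0r nmul0r.
  by rewrite avb in av *; exact: realR.
move: ga => [b [l [rb lg aE]]].
have aeE e : a ** fe P e = b ** fe P e + \sum_(t <- l | t.2 == e) t.1 ** fv P (target e).
  rewrite aE nmulDl nmul_suml; congr (_ + _); rewrite [RHS]big_mkcond.
  apply: eq_bigr => t _; rewrite -nmulA fge; case: eqP => [->|_].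
    by rewrite scale1r.
  by rewrite scale0r nmul0r.
have [bv|bv] := pselect (b ** fv P v = 0).
  case: av; rewrite aE nmulDl bv add0r.
  (* Grouped by last ghost [e], the coefficient of [e^*] is [a e - b e], which is 0 for every [e]
     leaving [v]. *)
  pose U := undup (map snd l).
  have -> : \sum_(t <- l) t.1 ** fg P t.2 =
      \sum_(e <- U) (\sum_(t <- l | t.2 == e) t.1 ** fv P (target e)) ** fg P e.
    under [RHS]eq_bigr do rewrite nmul_suml.
    rewrite (exchange_big_dep xpredT) //=; apply: eq_big_seq => t tl.
    rewrite big_mkcond /= (bigD1_seq t.2) ?undup_uniq ?mem_undup ?map_f //=.
    rewrite eqxx -nmulA fvg big1 ?addr0 // => e; rewrite eq_sym.
    by case: eqP.
  rewrite nmul_suml big1 // => e _; rewrite -nmulA fg_fv.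
  case: eqP => [ev|_]; last by rewrite scale0r nmul0r.
  have := ae0 e ev; rewrite aeE -[fe P e]fve ev nmulA bv nmul0l add0r => ->.
  by rewrite nmul0l.
have [x [k [l' [k0 cl bE]]]] := realP _ _ rb bv.
(* For f at the infinite emitter v outside the finitely many arrows involved,
   f^* x b f = k t(f), while b f = a f = 0; so t(f) = 0, which is 0 ** a ** 0. *)
have [f [fv_ fl fl']] : exists f, [/\ source f = v, f \notin map snd l &
    forall t, t \in l' -> ohead t.2 != Some f].
  have /infinite_setN0[f [fv_ fs]] :=
    infinite_setD inf (finite_seq (map snd l ++ pmap (fun t => ohead t.2) l')).
  exists f; split=> //; first by apply: contra_notN fs => /= fl; rewrite mem_cat fl.
  move=> t tl'; apply: contra_notN fs => /= /eqP tf.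
  by rewrite mem_cat mem_pmap; apply/orP; right; apply/mapP; exists t.
exists 0, 0; left; exists (target f); rewrite nmul0l nmul0r.
have : fg P f ** (x ** (b ** fv P v)) ** fe P f = k *: fv P (target f).
  rewrite bE /loop_comb nmulDr nmulDl nmulZr nmulZl -fv_ fgv fgeK.
  rewrite nmul_sumr big1_seq ?nmul0l ?addr0 // => t tl'.
  have /and3P[vt _] := allP cl _ tl'; have := fl' _ tl'.
  case: t.2 => //= e s ef _; rewrite nmulZr nmulA fge_neq ?nmul0l ?scaler0 //.
  by apply: contraNneq ef => ->.
rewrite -!nmulA -fv_ fve; have := ae0 f fv_; rewrite aeE big1_seq ?addr0.
  move=> ->; rewrite !nmul0r => /esym/eqP; rewrite scaler_eq0 (negbTE k0) /=.
  by move/eqP.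
by move=> t /andP[/eqP tf tl]; case/mapP: fl; exists t.
Qed.

End Reduction.

(** * Representations on branching systems *)

Section EndomorphismAlgebra.
Context (F : fieldType) (M : lmodType F).

Definition linear_pred : {pred M -> M} := fun f => `[< linear f >].

Fact linear_pred_closed : submod_closed linear_pred.
Proof.
split; first by apply/asboolP => a x y; rewrite scaler0 addr0.
move=> c f g /asboolP fl /asboolP gl; apply/asboolP => a x y /=.
rewrite !fctE fl gl !scalerDr !scalerA addrACA; congr (_ + _ + (_ + _)).
by rewrite mulrC.
Qed.

HB.instance Definition _ :=
  GRing.isSubmodClosed.Build F (M -> M) linear_pred
    (GRing.submod_closed_semi linear_pred_closed).

Record endo := Endo { endo_fun :> M -> M; _ : endo_fun \in linear_pred }.

HB.instance Definition _ := [isSub for endo_fun].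
HB.instance Definition _ := [Choice of endo by <:].
HB.instance Definition _ := [SubChoice_isSubLmodule of endo by <:].

Lemma endo_linear (f : endo) : linear f.
Proof. by case: f => f fP; exact/asboolP. Qed.

HB.instance Definition _ (f : endo) := GRing.isLinear.Build F M M _ f (endo_linear f).

Fact endo_comp_linear (f g : endo) : f \o g \in linear_pred.
Proof. by apply/asboolP => a x y /=; rewrite !linearP. Qed.

Definition endo_mul (f g : endo) : endo := Endo (endo_comp_linear f g).

Lemma endoP (f g : endo) : (forall x, f x = g x) <-> f = g.
Proof. by split=> [fg|->//]; apply/val_inj/funext. Qed.

Lemma endo_add (f g : endo) x : (f + g) x = f x + g x.
Proof. by []. Qed.

Lemma endo_scale c (f : endo) x : (c *: f) x = c *: f x.
Proof. by []. Qed.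

Fact endo_mulA : associative endo_mul.
Proof. by move=> f g h; apply/endoP. Qed.
Fact endo_mulDl : left_distributive endo_mul +%R.
Proof. by move=> f g h; apply/endoP. Qed.
Fact endo_mulDr : right_distributive endo_mul +%R.
Proof. by move=> f g h; apply/endoP => x; exact: (linearD f (g x) (h x)). Qed.
Fact endo_mulZl c (f g : endo) : endo_mul (c *: f) g = c *: endo_mul f g.
Proof. by apply/endoP. Qed.
Fact endo_mulZr c (f g : endo) : endo_mul f (c *: g) = c *: endo_mul f g.
Proof. by apply/endoP => x; exact: (linearZ_LR f c (g x)). Qed.

HB.instance Definition _ := Lmodule_isNonUnitalAlgebra.Build F endo
  endo_mulA endo_mulDl endo_mulDr endo_mulZl endo_mulZr.

Lemma endo_mulE (f g : endo) x : (f ** g) x = f (g x).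
Proof. by []. Qed.

Lemma endo_sumE (I : Type) (r : seq I) (f : I -> endo) x :
  (\sum_(i <- r) f i) x = \sum_(i <- r) f i x.
Proof. by elim/big_rec2: _ => // i y g _ <-. Qed.

End EndomorphismAlgebra.

Section BranchingSystem.
Context (F : fieldType) (G : digraph).

(* [step y = Some (e, x)] says that [y] lies in the image of the bijection
   [fwd e] from the points over [target e] onto a set of points over [source e];
   these images are disjoint for distinct [e]. *)
Record branching_system := BranchingSystem {
  point : Type;
  over : point -> vertex G;
  step : point -> option (arrow G * point);
  fwd : arrow G -> point -> point;
  step_over : forall e x y, step y = Some (e, x) ->
    [/\ over y = source e, over x = target e & fwd e x = y];
  step_fwd : forall e x, over x = target e -> step (fwd e x) = Some (e, x);
  step_regular : forall y, finite_set (out (over y)) -> out (over y) !=set0 ->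
    exists e x, step y = Some (e, x)
}.

Context (S : branching_system) (p : {poly F}) (wt wt' : arrow G -> {poly F}).
Hypothesis wtK : forall e, (wt' e * wt e) %% p = 1 %% p.

Local Notation M := (point S -> {poly F}).

(** Functions with values in F[x]/(p), except that values stay polynomials and the reduction modulo
    [p] is built into the operators. *)
Definition vertex_op v (f : M) : M := fun x => if over x == v then f x %% p else 0.
Definition arrow_op e (f : M) : M := fun y =>
  if step y is Some (e', x) then if e' == e then (wt e * f x) %% p else 0 else 0.
Definition ghost_op e (f : M) : M := fun x =>
  if over x == target e then (wt' e * f (fwd e x)) %% p else 0.

Fact vertex_op_linear v : vertex_op v \in @linear_pred F M.
Proof.
apply/asboolP => a f g; apply/funext => x; rewrite /vertex_op !fctE.
by case: eqP => _; rewrite ?scaler0 ?addr0 // modpD modpZl.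
Qed.

Fact arrow_op_linear e : arrow_op e \in @linear_pred F M.
Proof.
apply/asboolP => a f g; apply/funext => y; rewrite /arrow_op !fctE.
case: step => [[e' x]|]; last by rewrite scaler0 addr0.
case: eqP => _; rewrite ?scaler0 ?addr0 // mulrDr modpD -modpZl.
by rewrite -scalerAr.
Qed.

Fact ghost_op_linear e : ghost_op e \in @linear_pred F M.
Proof.
apply/asboolP => a f g; apply/funext => x; rewrite /ghost_op !fctE.
case: eqP => _; rewrite ?scaler0 ?addr0 // mulrDr modpD -modpZl.
by rewrite -scalerAr.
Qed.

(** CK1 holds because [step] inverts [fwd] and the weights are mutually inverse modulo [p]; CK2
    because every point over a regular vertex has a step. *)
Definition rep_family : leavitt_family G (endo M).
Proof.
apply: (@LeavittFamily F G (endo M) (fun v => Endo (vertex_op_linear v))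
  (fun e => Endo (arrow_op_linear e)) (fun e => Endo (ghost_op_linear e))).
- move=> u v; apply/endoP => f; apply/funext => x; rewrite endo_mulE endo_scale /= fctE.
  rewrite /vertex_op; have [->|_] := eqVneq (over x) u; last by rewrite scaler0.
  by case: eqP => _; rewrite /= ?(scale1r, scale0r, mod0p) ?modp_id.
- move=> e; apply/endoP => f; apply/funext => y; rewrite endo_mulE /= /vertex_op /arrow_op.
  case sy: (step y) => [[e' x]|]; last by rewrite mod0p; case: ifP.
  have [ye _ _] := step_over sy; rewrite ye.
  case: (eqVneq e' e) => [->|_]; last by rewrite mod0p; case: ifP.
  by rewrite eqxx modp_id.
- move=> e; apply/endoP => f; apply/funext => y; rewrite endo_mulE /= /vertex_op /arrow_op.
  case sy: (step y) => [[e' x]|] //; have [_ xe _] := step_over sy; rewrite xe.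
  by case: (eqVneq e' e) => [->|//]; rewrite eqxx modp_mul.
- move=> e; apply/endoP => f; apply/funext => x; rewrite endo_mulE /= /vertex_op /ghost_op.
  by case: eqP => //; rewrite modp_id.
- move=> e; apply/endoP => f; apply/funext => x; rewrite endo_mulE /= /vertex_op /ghost_op.
  case: eqP => // /step_fwd/step_over[-> _ _].
  by rewrite eqxx modp_mul.
- move=> e f; apply/endoP => h; apply/funext => x; rewrite endo_mulE endo_scale /= fctE.
  rewrite /ghost_op /arrow_op /vertex_op; case: eqP => [xe|_]; last by rewrite scaler0.
  rewrite (step_fwd xe); case: (eqVneq e f) => [<-|_].
    by rewrite scale1r modp_mul mulrA [_ * h x]mulrC -modp_mul wtK modp_mul mulr1.
  by rewrite mulr0 mod0p scale0r.
- move=> v fin v0; apply/endoP => f; apply/funext => y.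
  rewrite fsbig_finite // endo_sumE fct_sumE /= /vertex_op.
  have [yv|yv] := eqVneq (over y) v; last first.
    rewrite big1_seq // => e /=; rewrite in_fset_set // inE => ev.
    rewrite /arrow_op; case sy: (step y) => [[e' x]|] //.
    by have [ye _ _] := step_over sy; case: eqP => // ee'; rewrite ye ee' ev eqxx in yv.
  have [||e [x sy]] := @step_regular S y; rewrite ?yv //.
  have [ye xe fy] := step_over sy.
  rewrite (bigD1_seq e) /= ?fset_uniq //=; last first.
    by rewrite in_fset_set // inE /out /= -ye yv.
  rewrite big1 ?addr0 => [|e' /negbTE e'e]; rewrite /arrow_op sy.
    rewrite eqxx /ghost_op xe eqxx fy modp_mul mulrA [_ * f y]mulrC -modp_mul.
    by rewrite [wt e * _]mulrC wtK modp_mul mulr1.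
  by rewrite eq_sym e'e.
Defined.

End BranchingSystem.

Lemma onth_lt (T : Type) (x0 : T) (s : seq T) n :
  (n < size s)%N -> onth s n = Some (nth x0 s n).
Proof. by rewrite -odflt_onth -onthTE; case: onth. Qed.

Section CanonicalBranching.
Context (G : digraph).

(** At a sink the list [s] is empty, so [onth] yields [None] and there is no step. *)
Definition branch_step (y : vertex G * (nat * seq (arrow G))) :
    option (arrow G * (vertex G * (nat * seq (arrow G)))) :=
  let: (u, (m, t)) := y in
  if `[< finite_set (out u) >] then
    let s := fset_set (out u) : seq (arrow G) in
    omap (fun e => (e, (target e, (m %/ size s, t)%N))) (onth s (m %% size s))
  else if t is e :: t then
    if source e == u then Some (e, (target e, (m, t))) else None
  else None.

Definition branch_fwd (e : arrow G) (x : vertex G * (nat * seq (arrow G))) :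
    vertex G * (nat * seq (arrow G)) :=
  let: (_, (m, t)) := x in
  if `[< finite_set (out (source e)) >] then
    let s := fset_set (out (source e)) : seq (arrow G) in
    (source e, ((m * size s + index e s)%N, t))
  else (source e, (m, e :: t)).

(* Over a regular vertex with [n] outgoing arrows the points are split according
   to the residue modulo [n] of the natural number; over an infinite emitter the
   sequence records the arrow. *)
Definition canonical_branching : branching_system G.
Proof.
apply: (@BranchingSystem G _ fst branch_step branch_fwd).
- move=> e [u' [m' t']] [u [m t]] /=; case: ifP => [fin|nfin].
    set s : seq (arrow G) := fset_set (out u).
    have [sm|sm] := ltnP (m %% size s) (size s); last by rewrite onth_default.
    rewrite (onth_lt e) //= => -[ee <- <- <-].
    have es : e \in s by rewrite -ee mem_nth.
    have eu : source e = u.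
      by move: es; rewrite /s in_fset_set ?inE //; apply/asboolP.
    rewrite ee eu fin; split=> //; congr (_, (_, _)).
    rewrite -/s -{1}ee index_uniq ?fset_uniq //.
    by rewrite -divn_eq.
  case: t => // f t; case: eqP => // fu [<- <- <- <-].
  by rewrite fu nfin.
- move=> e [u [m t]] /= ->; case: ifP => [fin|nfin] /=; rewrite ?fin ?nfin ?eqxx //.
  set s : seq (arrow G) := fset_set (out (source e)).
  have es : e \in s by rewrite /s in_fset_set ?inE //; apply/asboolP.
  have s0 : (index e s < size s)%N by rewrite index_mem.
  rewrite modnMDl modn_small // (onth_lt e) ?nth_index //=.
  rewrite divnMDl ?(leq_ltn_trans _ s0) // divn_small // addn0.
  by [].
- move=> [u [m t]] /= fin [e eu]; rewrite asboolT //.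
  set s : seq (arrow G) := fset_set (out u).
  have es : e \in s by rewrite /s in_fset_set ?inE.
  have sm : (m %% size s < size s)%N by rewrite ltn_mod; case: (s) es.
  exists (nth e s (m %% size s)).
  by rewrite (onth_lt e) //=; eexists.
Defined.

End CanonicalBranching.

Arguments over : simpl never.
Arguments step : simpl never.
Arguments fwd : simpl never.

Section RepresentationOfCycles.
Context (F : fieldType) (G : digraph) (S : branching_system G).
Context (p : {poly F}) (wt wt' : arrow G -> {poly F}).
Hypothesis wtK : forall e, (wt' e * wt e) %% p = 1 %% p.
Local Notation R := (rep_family S wtK).
Local Notation M := (point S -> {poly F}).
Local Notation fwds s x := (foldr (@fwd G S) x s).

Lemma rep_vertex v (f : M) x :
  (fv R v : endo M) f x = if over x == v then f x %% p else 0.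
Proof. by []. Qed.

Lemma rep_arrow e (a : endo M) (f : M) y : (fe R e ** a : endo M) f y =
  if step y is Some (e', x) then if e' == e then (wt e * a f x) %% p else 0 else 0.
Proof. by []. Qed.

Lemma over_fwds v s x : is_path v s -> over x = path_end v s -> over (fwds s x) = v.
Proof.
elim: s v => //= e s IH v /andP[/eqP <- es] /(IH _ es).
by move=> /step_fwd/step_over[].
Qed.

Lemma rep_path v s (h : M) x : is_path v s -> over x = path_end v s ->
  (pelt R v s : endo M) h (fwds s x) = (\prod_(e <- s) wt e * h x) %% p.
Proof.
elim: s v => [|e s IH] v /=.
  by move=> _ xv; rewrite [LHS]rep_vertex xv eqxx big_nil mul1r.
move=> /andP[_ es] xv; rewrite [LHS]rep_arrow.
by rewrite (step_fwd (over_fwds es xv)) eqxx (IH (target e)) // modp_mul big_cons mulrA.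
Qed.

Lemma rep_cycle_pow (c : gcycle G) i (h : M) x : over x = cycle_source c ->
  over (iter i (fun x => fwds (cycle_seq c) x) x) = cycle_source c /\
  (iter i (nmul (celt R c)) (fv R (cycle_source c)) : endo M) h
    (iter i (fun x => fwds (cycle_seq c) x) x) =
  ((\prod_(e <- cycle_seq c) wt e) ^+ i * h x) %% p.
Proof.
move=> xv; have cp := cycle_is_path c; have ce := cycle_path_end c.
elim: i => [|i [IH1 IH2]].
  by split=> //; rewrite [LHS]rep_vertex xv eqxx mul1r.
split; first by rewrite iterS (over_fwds cp) ?ce.
rewrite !iterS endo_mulE /celt rep_path ?ce // IH2 modp_mul.
by rewrite exprS mulrA.
Qed.

(** After [n >= size f] turns every relevant power of C can be followed back along the cycle, and
    one turn multiplies by the total weight ['X]. *)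
Lemma rep_cycle_poly (c : gcycle G) (f : {poly F}) x n (w : {poly F}) :
  \prod_(e <- cycle_seq c) wt e = 'X -> over x = cycle_source c -> (size f <= n)%N ->
  (cpoly (fv R (cycle_source c)) (celt R c) f : endo M) (fun _ => w)
    (iter n (fun x => fwds (cycle_seq c) x) x) = (f * w) %% p.
Proof.
move=> wc xv fn; have pow i : (i <= n)%N ->
    (iter i (nmul (celt R c)) (fv R (cycle_source c)) : endo M) (fun _ => w)
      (iter n (fun x => fwds (cycle_seq c) x) x) = ('X^i * w) %% p.
  move=> /subnKC <-; rewrite iterD.
  have [yv _] := rep_cycle_pow (n - i) (fun _ => w) xv.
  by have [_ ->] := rep_cycle_pow i (fun _ => w) yv; rewrite wc.
rewrite /cpoly endo_sumE fct_sumE.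
have -> : f * w = \sum_(i < size f) (f`_i *: 'X^i) * w.
  by rewrite -{1}[f]coefK poly_def mulr_suml.
have modp_sum (I : Type) (r : seq I) (g : I -> {poly F}) :
    (\sum_(j <- r) g j) %% p = \sum_(j <- r) g j %% p.
  by elim/big_rec2: _ => [|j u w' _ <-]; rewrite ?mod0p ?modpD.
rewrite modp_sum; apply: eq_bigr => i _.
by rewrite endo_scale fctE pow ?(leq_trans (ltnW (ltn_ord i))) // -scalerAl modpZl.
Qed.

(** Each source on [s] is regular with a single outgoing arrow, so the step from a point above it
    can only follow [s]. *)
Lemma exitless_fwds v s y : is_path v s -> exitless s -> over y = v ->
  exists2 x, over x = path_end v s & y = fwds s x.
Proof.
elim: s v y => [|e s IH] v y /=; first by exists y.
move=> /andP[/eqP ev es] ex yv.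
have oute : out v = [set e].
  apply/seteqP; split=> [f fv|f ->] /=; last by [].
  by apply: ex; rewrite ?inE ?eqxx // ev.
have [||e' [x sy]] := @step_regular G S y; rewrite ?yv ?oute //; first by exists e.
have [ye xe fy] := step_over sy.
have e'e : e' = e.
  have : out v e' by rewrite /out /= -ye.
  by rewrite oute.
rewrite {e'}e'e in sy ye xe fy.
have [f g fs|z zv xz] := IH (target e) x es _ xe.
  by apply: ex; rewrite inE fs orbT.
by exists z => //; rewrite -xz fy.
Qed.

End RepresentationOfCycles.

(** Writing [p = p(0) + x h], the inverse of x modulo [p] is [- h / p(0)]. *)
Lemma modX_inv (F : fieldType) (p : {poly F}) : p.[0] != 0 ->
  exists q, (q * 'X) %% p = 1 %% p.
Proof.
move=> p0; have /factor_theorem[h pE] : root (p - p.[0]%:P) 0.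
  by rewrite /root !hornerE subrr.
exists (- (p.[0])^-1 *: h).
have -> : - (p.[0])^-1 *: h * 'X = 1 + (- (p.[0])^-1 *: 1) * p.
  rewrite subr0 in pE; rewrite -scalerAl -pE scalerBr -!scalerAl mul1r addrC.
  congr (_ + _); rewrite scaleNr opprK -mul_polyC -polyCM mulVf //.
by rewrite modpD modp_mull addr0.
Qed.

(** * Detecting vertices and polynomials in cycles *)

Section FaithfulOnCycles.
Context (F : fieldType) (G : digraph).
Local Notation L := (leavitt F G).
Local Notation P := (canonical_family F G).
Local Notation S := (canonical_branching G).

Lemma over_surj v : exists x : point S, over x = v.
Proof. by exists (v, (0%N, [::])). Qed.

Lemma leavitt_eval_path (B : nuAlgType F) (R : leavitt_family G B) v s :
  leavitt_eval R (pelt P v s) = pelt R v s.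
Proof.
elim: s v => /= [|e s IH] v; first exact: leavitt_evalV.
by rewrite leavitt_evalM IH; congr (_ ** _); exact: leavitt_evalA.
Qed.

Lemma leavitt_eval_cycle (B : nuAlgType F) (R : leavitt_family G B) c f :
  leavitt_eval R (cycle_eval c f) = cpoly (fv R (cycle_source c)) (celt R c) f.
Proof.
rewrite cycle_evalE (cpoly_morph (leavitt_evalM R)) /= /celt leavitt_eval_path.
by congr cpoly; exact: leavitt_evalV.
Qed.

Lemma lvertex_neq0 (v : vertex G) : lvertex F v <> 0.
Proof.
(* Modulo ['X], with trivial weights, the values are just those of F. *)
have wtK (e : arrow G) : (1 * 1 : {poly F}) %% 'X = 1 %% 'X by rewrite mulr1.
pose R := rep_family S wtK.
move=> /(congr1 (leavitt_eval R)); rewrite leavitt_evalV linear0 => v0.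
have [x xv] := over_surj v.
have := rep_vertex (S := S) wtK v (fun _ => 1) x; rewrite xv eqxx -/R v0.
rewrite modp_small ?size_polyX ?size_poly1 // => /esym/eqP.
by rewrite oner_eq0.
Qed.

(** All the weight sits on the first arrow, which occurs only once in the cycle, so a full turn
    multiplies by exactly [q]. *)
Definition cycle_weight (c : gcycle G) (q : {poly F}) (e : arrow G) : {poly F} :=
  if e == (val c).1 then q else 1.

Lemma cycle_weight_prod c q : \prod_(e <- cycle_seq c) cycle_weight c q e = q.
Proof.
have := map_uniq (cycle_uniq c).
rewrite /cycle_seq /= big_cons /cycle_weight eqxx => /andP[e0 _].
rewrite big1_seq ?mulr1 // => e /= es.
by case: eqP => // ee; rewrite ee (negbTE e0) in es.
Qed.

Lemma cycle_weightK c p q : (q * 'X) %% p = 1 %% p ->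
  forall e, (cycle_weight c q e * cycle_weight c 'X e) %% p = 1 %% p.
Proof. by move=> qX e; rewrite /cycle_weight; case: eqP => // _; rewrite mulr1. Qed.

Lemma cycle_eval_inj (c : gcycle G) (f : {poly F}) : cycle_eval c f = 0 -> f = 0.
Proof.
(* The degree exceeds that of [f], so [f] is its own residue; the constant term 1 makes x invertible
   modulo [p]. *)
move=> f0; pose p : {poly F} := 'X^((size f).+1) + 1.
have p0 : p.[0] != 0 by rewrite !hornerE exprS mul0r add0r oner_eq0.
have [q qX] := modX_inv p0; pose R := rep_family S (cycle_weightK c qX).
have [x xv] := over_surj (cycle_source c).
have := rep_cycle_poly (cycle_weightK c qX) 1 (cycle_weight_prod c 'X) xv (leqnn (size f)).
rewrite -leavitt_eval_cycle f0 linear0 mulr1 modp_small => [<-//|].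
by rewrite /p size_polyDl size_polyXn // size_poly1.
Qed.

(* Modulo p = 1 - x f(x), the element C f(C) fixes the function equal to 1 over the
   source of C and to 0 elsewhere. *)
Lemma cycle_eval_not_quasiregular (c : gcycle G) (f : {poly F}) z :
  exitless (cycle_seq c) -> f != 0 -> z + cycle_eval c ('X * f) <> z ** cycle_eval c ('X * f).
Proof.
(* The factor ['X] gives p(0) = 1, so x is invertible modulo [p], and makes [p] nonconstant, so 1 is
   nonzero modulo [p]. *)
move=> exc f0; set g := 'X * f; pose p : {poly F} := 1 - g.
have sg : (1 < size g)%N.
  by rewrite size_mul ?polyX_eq0 // size_polyX addSn /= ltnS size_poly_gt0.
have p0 : p.[0] != 0 by rewrite /p /g !hornerE subr0 oner_eq0.
have sp : (1 < size p)%N by rewrite /p addrC size_polyDl size_polyN // size_poly1.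
have [q qX] := modX_inv p0; pose R := rep_family S (cycle_weightK c qX).
set v := cycle_source c.
pose w : point S -> {poly F} := fun x => if over x == v then 1 else 0.
have mod1 : 1 %% p = 1 by rewrite modp_small // size_poly1.
have w1 : (fv R v : endo _) (fun _ => 1) = w.
  by apply/funext => x; rewrite rep_vertex mod1.
pose C := cpoly (fv R v) (celt R c) g.
have vC : fv R v ** C = C by rewrite cpoly_vl ?fvK ?fv_celt ?celt_fv.
have Cv : C ** fv R v = C by rewrite cpoly_vr ?fvK ?fv_celt ?celt_fv.
have Cw : (C : endo _) w = w.
  rewrite -w1 -endo_mulE Cv; apply/funext => y; rewrite w1 /w.
  have [yv|yv] := eqVneq (over y) v; last first.
    by rewrite -vC endo_mulE rep_vertex (negbTE yv).
  have [x xv ->] : exists2 x, over x = v &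
      y = iter (size g) (fun x => foldr (@fwd G S) x (cycle_seq c)) x.
    elim: (size g) y yv => [|n IH] y yv; first by exists y.
    have [x xv yE] := exitless_fwds (cycle_is_path c) exc yv.
    have [x' xv' xE] := IH x (etrans xv (cycle_path_end c)).
    by exists x'; rewrite // yE xE.
  rewrite rep_cycle_poly ?cycle_weight_prod // mulr1.
  have -> : g = 1 + (-1) *: p by rewrite /p scaleN1r opprB addrC subrK.
  by rewrite modpD modpZl modpp scaler0 addr0.
move=> /(congr1 (leavitt_eval R)); rewrite linearD /= leavitt_evalM.
rewrite leavitt_eval_cycle -/C => /endoP /(_ w).
rewrite endo_add endo_mulE Cw => /eqP; rewrite -subr_eq0 addrC addKr => /eqP w0.
have [x xv] := over_surj v; have := congr1 (fun h => h x) w0.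
by rewrite /w xv eqxx => /eqP; rewrite oner_eq0.
Qed.

End FaithfulOnCycles.

(** * Radicals *)

Section Radical.
Context (F : fieldType) (A : nuAlgType F).
Implicit Types x y z : A.

(** With a unit this reads (1 - z)(1 - y) = 1. *)
Definition left_quasi_regular y : Prop := exists z, z + y = z ** y.

(** The nonunital form of: if u is a left inverse of 1 - yx, then 1 + x u y is one of 1 - xy. *)
Lemma lqr_swap x y : left_quasi_regular (y ** x) -> left_quasi_regular (x ** y).
Proof.
move=> [z zE]; exists (x ** z ** y - x ** y).
rewrite subrK nmulBl -!nmulA -nmulBr; congr (_ ** _).
rewrite !nmulA -nmulBl; congr (_ ** _).
by rewrite -nmulA -zE addrK.
Qed.

(** [N] plays the role of A(1 - y). If it omits [y], a left ideal maximal among those containing [N]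
    and omitting [y] is a maximal left ideal, modular with witness [y]; it must then contain [y], a
    contradiction. *)
Lemma jacobson_lqr y : jacobson_radical A y -> left_quasi_regular y.
Proof.
move=> Jy; pose N : set A := [set z - z ** y | z in setT].
have N0 : N 0 by exists 0; rewrite // nmul0l subrr.
have NB a b : N a -> N b -> N (a - b).
  move=> [u _ <-] [w _ <-]; exists (u - w) => //.
  by rewrite nmulBl opprD addrACA -opprD.
have NM c a : N a -> N (c ** a).
  by move=> [u _ <-]; exists (c ** u) => //; rewrite nmulBr nmulA.
have [[z _ zE]|Ny] := pselect (N y).
  by exists (- z); rewrite nmulNl -{1}zE addKr.
(* The union with [N] is part of the condition because the empty chain has the empty union. *)
pose ok (M : set A) := left_ideal (M `|` N) /\ ~ (M `|` N) y.
have [F' F'ok F'tot|M [[Ml My] Mmax]] := @Zorn_bigcup A ok.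
  have sub2 a b : (\bigcup_(X in F') X `|` N) a -> (\bigcup_(X in F') X `|` N) b ->
      (N a /\ N b) \/ exists2 X, F' X & (X `|` N) a /\ (X `|` N) b.
    move=> [[X FX Xa]|Na] [[Y FY Yb]|Nb].
    - have [XY|YX] := F'tot _ _ FX FY.
        by right; exists Y => //; split; left=> //; exact: XY.
      by right; exists X => //; split; left=> //; exact: YX.
    - by right; exists X => //; split; [left|right].
    - by right; exists Y => //; split; [right|left].
    - by left.
  have sup X : F' X -> X `|` N `<=` \bigcup_(X in F') X `|` N.
    by move=> FX a [Xa|Na]; [left; exists X|right].
  split; last first.
    move=> [[X FX Xy]|//]; have [_] := F'ok _ FX; apply; by left.
  split; first by right.
  - move=> a b Xa Xb; have [[Na Nb]|[X FX [Xa' Xb']]] := sub2 _ _ Xa Xb.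
      by right; exact: NB.
    by apply: (sup X FX); have [[_ XB _] _] := F'ok _ FX; exact: XB.
  - move=> c a [[X FX Xa]|Na]; last by right; exact: NM.
    by apply: (sup X FX); have [[_ _ XM] _] := F'ok _ FX; apply: XM; left.
exfalso; apply: (My); apply: Jy; last by exists y => x; right; exists x.
split => //; first by move=> MT; apply: My; rewrite MT.
move=> M' [M'0 M'B M'M] MM'.
have NM' : N `<=` M' by move=> a Na; apply: MM'; right.
have [M'y|M'y] := pselect (M' y).
  right; apply/seteqP; split=> // z _.
  have -> : z = (z - z ** y) - (0 - z ** y) by rewrite sub0r opprK subrK.
  by apply: (M'B); [apply: NM'; exists z|apply: (M'B) => //; exact: M'M].
left; apply/seteqP; split=> // a M'a; apply: contrapT => Ma.
apply: (Mmax M'); last by rewrite /ok (setUidl NM').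
split; first by move=> b Mb; apply: MM'; left.
by move=> M'M0; apply: Ma; left; exact: M'M0.
Qed.

(** If [I] is not inside the modular maximal left ideal [M], then I + M is everything, so e = n + m.
    The quasi-inverse of [n] forces [n], hence [e], into [M], which makes [M] everything. *)
Lemma lqr_ideal_jacobson (I : nuIdeal A) :
  (forall x, x \in I -> left_quasi_regular x) -> [set` I] `<=` jacobson_radical A.
Proof.
move=> Iq x /= Ix M [[M0 MB MM] MT Mmax] [e Me]; apply: contrapT => Mx.
have MD a b : M a -> M b -> M (a + b).
  by move=> Ma Mb; rewrite -[b]opprK -(sub0r b); apply: (MB) => //; exact: (MB).
pose M' : set A := [set u + m | u in [set` I] & m in M].
have [|||] := Mmax M'; last 1 first.
- move=> M'T; have [n In [m Mm nm]] : M' e by rewrite M'T.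
  have [z zE] := Iq _ In.
  have Mn : M n.
    have -> : n = - (z - z ** e) - z ** m.
      by rewrite -nm nmulDr -zE opprB addrAC addrK addrC addKr.
    by apply: (MB); [rewrite -sub0r; apply: (MB)|exact: MM].
  apply: MT; apply/seteqP; split=> // a _; rewrite -[a](subrK (a ** e)).
  by apply: (MD) => //; apply: (MM); rewrite -nm; exact: MD.
- split; first by exists 0; [exact: rpred0|exists 0; rewrite ?addr0].
  + move=> _ _ [u Iu [m Mm <-]] [u' Iu' [m' Mm' <-]].
    exists (u - u'); first exact: rpredB.
    by exists (m - m'); [exact: MB|rewrite opprD addrACA].
  + move=> c _ [u Iu [m Mm <-]]; exists (c ** u); first exact: ideal_nmull.
    by exists (c ** m); [exact: MM|rewrite nmulDr].
- by move=> a Ma; exists 0; [exact: rpred0|exists a; rewrite ?add0r].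
move=> M'M; apply: Mx; rewrite -M'M; exists x => //.
by exists 0; rewrite ?addr0.
Qed.

Lemma ideal_gen_ind (X : set A) (P : A -> Prop) : X `<=` P -> P 0 ->
  (forall a x y, P x -> P y -> P (a *: x + y)) ->
  (forall a x, P x -> P (a ** x)) -> (forall a x, P x -> P (x ** a)) ->
  forall x, x \in ideal_gen X -> P x.
Proof.
move=> XP P0 PL Pl Pr.
have cl : submod_closed (fun x => `[< P x >] : bool).
  by split=> [|a x y /asboolP ? /asboolP ?]; apply/asboolP; [exact: P0|exact: PL].
have ml a x : x \in (fun x => `[< P x >] : bool) -> a ** x \in (fun x => `[< P x >] : bool).
  by move=> /asboolP ?; apply/asboolP/Pl.
have mr a x : x \in (fun x => `[< P x >] : bool) -> x ** a \in (fun x => `[< P x >] : bool).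
  by move=> /asboolP ?; apply/asboolP/Pr.
move=> x /asboolP /(_ (NuIdeal cl ml mr)) H.
by have /asboolP := H (fun y Xy => asboolT (XP y Xy)).
Qed.

Lemma iter_nmul n x y : iter n (nmul x) x ** y = iter n.+1 (nmul x) y.
Proof. by elim: n => //= n IH; rewrite -nmulA IH. Qed.

Lemma iter_iter_nmul m n x y :
  iter m (nmul (iter n (nmul x) x)) y = iter (m * n.+1) (nmul x) y.
Proof. by elim: m => //= m ->; rewrite iter_nmul -iterD. Qed.

(** The quasi-inverse is minus the finite geometric series x + ... + x^n. *)
Lemma nilpotent_lqr n x : iter n (nmul x) x = 0 -> left_quasi_regular x.
Proof.
have xr i : iter i (nmul x) x ** x = iter i.+1 (nmul x) x.
  by rewrite iter_nmul iterSr.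
have sumE m : - (\sum_(i < m) iter i (nmul x) x) + x =
    - (\sum_(i < m) iter i (nmul x) x) ** x + iter m (nmul x) x.
  elim: m => [|m IH]; first by rewrite big_ord0 oppr0 nmul0l.
  rewrite !big_ord_recr /= !opprD addrAC IH addrK nmulDl.
  by rewrite [(- iter m _ _) ** x]nmulNl xr subrK.
move=> xn; exists (- (\sum_(i < n) iter i (nmul x) x)).
by rewrite sumE xn addr0.
Qed.

Fact zero_submod : submod_closed (fun x : A => x == 0).
Proof. by split=> [|a x y /eqP -> /eqP ->]; rewrite ?unfold_in ?scaler0 ?addr0. Qed.
Fact zero_nmull a x : x \in (fun x : A => x == 0) -> a ** x \in (fun x : A => x == 0).
Proof. by move=> /eqP ->; rewrite unfold_in nmul0r. Qed.
Fact zero_nmulr a x : x \in (fun x : A => x == 0) -> x ** a \in (fun x : A => x == 0).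
Proof. by move=> /eqP ->; rewrite unfold_in nmul0l. Qed.
Definition zero_ideal := NuIdeal zero_submod zero_nmull zero_nmulr.

Lemma nil_ideal0 : nil_ideal zero_ideal.
Proof. by move=> x /eqP ->; exists 0%N. Qed.

(** Modulo [J] the powers of u + w are those of u, so some power of u + w lies in [J] and is itself
    nilpotent. *)
Lemma nil_ideal_add (I J : nuIdeal A) : nil_ideal I -> nil_ideal J ->
  nil_ideal (ideal_gen ([set` I] `|` [set` J])).
Proof.
move=> nI nJ x Kx; have {Kx} [u [w [uI wJ ->]]] : exists u w, [/\ u \in I, w \in J & x = u + w].
  elim/ideal_gen_ind: Kx => [y [Iy|Jy]||a y z [u [w [uI wJ ->]]] [u' [w' [uI' wJ' ->]]]|
      a y [u [w [uI wJ ->]]]|a y [u [w [uI wJ ->]]]].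
  - by exists y, 0; rewrite rpred0 addr0.
  - by exists 0, y; rewrite rpred0 add0r.
  - by exists 0, 0; rewrite !rpred0 addr0.
  - exists (a *: u + u'), (a *: w + w').
    by rewrite !rpredD ?rpredZ // scalerDr addrACA.
  - by exists (a ** u), (a ** w); rewrite !ideal_nmull // nmulDr.
  - by exists (u ** a), (w ** a); rewrite !ideal_nmulr // nmulDl.
have [n un] := nI _ uI.
have diff i : iter i (nmul (u + w)) (u + w) - iter i (nmul u) u \in J.
  elim: i => /= [|i IH]; first by rewrite addrAC subrr add0r.
  rewrite nmulDl addrAC -nmulBr; apply: rpredD; first exact: ideal_nmull.
  exact: ideal_nmulr.
have [m xm] : exists m, iter m (nmul (iter n (nmul (u + w)) (u + w)))
    (iter n (nmul (u + w)) (u + w)) = 0.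
  by apply: nJ; have := diff n; rewrite un subr0.
(* [iter k] stands for the power k + 1, so the exponent is (m + 1)(n + 1) - 1. *)
by exists (m * n.+1 + n)%N; rewrite iterD -iter_iter_nmul.
Qed.

(** By [nil_ideal_add] the elements lying in some nil ideal are closed under sums, so each element
    of the generated ideal lies in one. *)
Lemma nilradical_nil : nil_ideal (nilradical A).
Proof.
move=> x Nx; suff [I nI xI] : exists2 I : nuIdeal A, nil_ideal I & x \in I by exact: nI.
elim/ideal_gen_ind: Nx => [//||a y z [I nI Iy] [J nJ Jz]|a y [I nI Iy]|a y [I nI Iy]].
- by exists zero_ideal; [exact: nil_ideal0|exact: rpred0].
- exists (ideal_gen ([set` I] `|` [set` J])); first exact: nil_ideal_add.
  by apply: rpredD; [apply: rpredZ|]; apply: ideal_gen_sub; [left|right].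
- by exists I => //; exact: ideal_nmull.
- by exists I => //; exact: ideal_nmulr.
Qed.

Lemma nilradical_sub_jacobson : [set` nilradical A] `<=` jacobson_radical A.
Proof. by apply: lqr_ideal_jacobson => x /nilradical_nil[n]; exact: nilpotent_lqr. Qed.

(* The ideal of [y] raised to the power [n.+1] lies in the ideal of [y ^ n.+1],
   because [y] can be moved across [v ** c ** v]. *)
Lemma central_nilpotent_nilradical (v y : A) n : v ** y = y -> y ** v = y ->
  (forall c, v ** c ** v ** y = y ** (v ** c ** v)) -> iter n (nmul y) y = 0 ->
  y \in nilradical A.
Proof.
move=> vy yv yc yn; pose I k := ideal_gen [set iter k (nmul y) y].
have vyk k : v ** iter k (nmul y) y = iter k (nmul y) y.
  by case: k => //= k; rewrite nmulA vy.
have step k x z : x \in I 0%N -> z \in I k -> x ** z \in I k.+1.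
  move=> Ix Iz; have gk : iter k.+1 (nmul y) y \in I k.+1 by exact: ideal_gen_sub.
  elim/ideal_gen_ind: Ix z Iz => [_ -> z Iz||a t t' IHx IHy z Iz|a t IHx z Iz|a t IHx z Iz].
  - suff [] : y ** z \in I k.+1 /\ forall c, y ** (c ** z) \in I k.+1 by [].
    elim/ideal_gen_ind: Iz => [_ ->||a t t' [Hx Hx'] [Hy Hy']|a t [Hx Hx']|a t [Hx Hx']].
    + split=> [//|c].
      (* Inserting [v] on both sides of [c] makes it a corner element, which [y] can cross to reach
         the power of [y] in [z]. *)
      rewrite -{1}yv -nmulA -vyk !nmulA -[_ ** v ** c](nmulA y).
      rewrite -[_ ** _ ** v](nmulA y) -yc -nmulA.
      by apply: ideal_nmull.
    + by split=> [|c]; rewrite ?nmul0r; exact: rpred0.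
    + split=> [|c]; rewrite !(nmulDr, nmulZr); apply: rpredD => //; apply: rpredZ => //.
    + by split=> [|c]; [exact: Hx'|rewrite (nmulA c); exact: Hx'].
    + by split=> [|c]; rewrite ?(nmulA c) nmulA; exact: ideal_nmulr.
  - by move=> z _; rewrite nmul0l; exact: rpred0.
  - by rewrite nmulDl nmulZl; apply: rpredD; [apply: rpredZ; exact: IHx|exact: IHy].
  - by rewrite -nmulA; apply: ideal_nmull; exact: IHx.
  - by rewrite -nmulA; apply: IHx; exact: ideal_nmull.
have pow x k : x \in I 0%N -> iter k (nmul x) x \in I k.
  by move=> Ix; elim: k => //= k IH; exact: step.
apply: ideal_gen_sub; exists (I 0%N); last exact: ideal_gen_sub.
move=> x Ix; exists n; have := pow x n Ix; rewrite /I yn => H.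
by elim/ideal_gen_ind: H => //= [a u w -> ->|a u ->|a u ->];
  rewrite ?scaler0 ?addr0 ?nmul0r ?nmul0l.
Qed.

End Radical.

Section Semiprimitive.
Context (F : fieldType) (G : digraph).
Local Notation P := (canonical_family F G).

(** The hypothesis passes to all [b ** (x ** a ** y)] by [lqr_swap]. If z + v = z v for an
    idempotent v, right multiplication by v gives v = 0; in the other case of the reduction, b = C
    produces C f(C). *)
Lemma leavitt_semiprimitive (a : leavitt F G) :
  (forall b, left_quasi_regular (b ** a)) -> a = 0.
Proof.
move=> aq; apply: contrapT => /reduction[x [y H]].
have {}aq b : left_quasi_regular (b ** (x ** a ** y)).
  by rewrite !nmulA; apply: lqr_swap; rewrite !nmulA; exact: aq.
case: H => [[v vE]|[c [f [exc f0 cE]]]].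
  have vv : lvertex F v ** lvertex F v = lvertex F v := fvK P v.
  have [z] := aq (lvertex F v); rewrite vE vv => /(congr1 (nmul^~ (lvertex F v))) /=.
  rewrite nmulDl vv -nmulA vv => /eqP; rewrite addrC -subr_eq0 addrK => /eqP.
  exact: lvertex_neq0.
have [z zE] := aq (celt P c); apply: (@cycle_eval_not_quasiregular _ _ c f z) => //.
by move: zE; rewrite cE !cycle_evalE -cpolyXM.
Qed.

End Semiprimitive.

(** * Contributing cycles *)

Section CanonicalPoly.
Context (F : fieldType) (G : digraph) (I : nuIdeal (leavitt F G)).
Local Notation P := (canonical_family F G).
Implicit Types (c : gcycle G) (f g h : {poly F}).

Lemma cycle_evalM c f g : cycle_eval c (f * g) = cycle_eval c f ** cycle_eval c g :> leavitt F G.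
Proof. by rewrite !cycle_evalE cpolyM ?fvK ?fv_celt ?celt_fv. Qed.

Lemma cycle_eval1 c : cycle_eval c 1 = lvertex F (cycle_source c).
Proof. by rewrite cycle_evalE cpoly1. Qed.

(** Evaluation at C is injective, so a nonzero polynomial witnesses a nonzero intersection; an ideal
    of F[C] is proper when it misses the unit s(C). *)
Lemma contributesP c : contributes I c <->
  (exists2 f : {poly F}, f != 0 & cycle_eval c f \in I) /\ ~ ideal_vertices I (cycle_source c).
Proof.
split=> [cc|[[f f0 fI] vI]].
  split; last exact: contributes_notin cc.
  case: cc => nz _; apply: contrapT => H; apply: nz; apply/seteqP; split=> x /=.
    move=> [xI [f _ fx]]; have [f0|f0] := eqVneq f 0.
      by rewrite -fx f0 cycle_evalE linear0.
    by case: H; exists f; rewrite // fx.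
  move=> ->; split; first exact: rpred0.
  by exists 0; rewrite // cycle_evalE linear0.
split=> H.
  have : ([set` I] `&` @cycle_subalg F G c) (cycle_eval c f) by split=> //; exists f.
  by rewrite H => /= /cycle_eval_inj f00; rewrite f00 eqxx in f0.
apply: vI; have : @cycle_subalg F G c (lvertex F (cycle_source c)).
  by exists 1; rewrite // cycle_eval1.
by rewrite -H => -[].
Qed.

(** The polynomials [f] with f(C) in [I] form an ideal, generated by an element of least degree. The
    ghost of C is a left inverse of C in the corner, so a factor x can be divided out and the
    generator has a nonzero constant term. *)
Lemma canonical_polyP c : contributes I c ->
  (canonical_poly I c).[0] = 1 /\
  forall g, cycle_eval c g \in I <-> canonical_poly I c %| g.
Proof.
move=> /contributesP[[f1 f10 f1I] vI].
pose Z f := cycle_eval c f \in I.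
have ZB f g : Z f -> Z g -> Z (f - g).
  by rewrite /Z !cycle_evalE linearB; exact: rpredB.
have ZM f g : Z g -> Z (f * g) by rewrite /Z cycle_evalM; exact: ideal_nmull.
have ZX f : Z ('X * f) -> Z f.
  rewrite /Z !cycle_evalE cpolyXM => H.
  have := ideal_nmull (gelt P (cycle_source c) (cycle_seq c)) H.
  by rewrite nmulA geltK ?cycle_is_path // cycle_path_end cpoly_vl ?fvK ?fv_celt ?celt_fv.
have [|n /asboolP[g0 [g00 Zg0 sg0]] nmin] :=
    @ex_minnP (fun n => `[< exists g, [/\ g != 0, Z g & size g = n] >]).
  by exists (size f1); apply/asboolP; exists f1.
have {}nmin g : g != 0 -> Z g -> (size g0 <= size g)%N.
  by move=> g_neq0 Zg; rewrite sg0; apply: nmin; apply/asboolP; exists g.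
have Zdvd g : Z g <-> g0 %| g.
  split=> [Zg|/dvdpP[h ->]]; last exact: ZM.
  rewrite /dvdp; apply: contrapT => /negP r0.
  have : Z (g %% g0).
    have -> : g %% g0 = g - (g %/ g0) * g0 by rewrite {2}(divp_eq g g0) addrAC subrr add0r.
    by apply: ZB => //; exact: ZM.
  by move=> /(nmin _ r0); rewrite leqNgt ltn_modp g00.
have g0_0 : g0.[0] != 0.
  apply/negP => /factor_theorem[h]; rewrite subr0 => g0E.
  have h0 : h != 0 by apply: contraNneq g00 => h0; rewrite g0E h0 mul0r.
  have : Z h by apply: ZX; rewrite mulrC -g0E.
  move=> /(nmin _ h0); rewrite g0E size_mul ?polyX_eq0 // size_polyX addn2 /=.
  by rewrite ltnn.
have [] := @xgetPex _ 0 [set f | f.[0] = 1 /\ forall g, cycle_eval c g \in I <-> f %| g].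
  exists ((g0.[0])^-1 *: g0); split; first by rewrite hornerZ mulVf.
  by move=> g; rewrite dvdpZl ?invr_eq0 //; exact: Zdvd.
by [].
Qed.

End CanonicalPoly.

(** * The corner at a cycle whose arrows satisfy e e^* = s(e) *)

Section ExclusiveCycle.
Context (F : fieldType) (G : digraph) (B : nuAlgType F).
Context (q : {linear leavitt F G -> B}) (qM : {morph q : x y / x ** y}).
Local Notation P := (canonical_family F G).
Local Notation p := (map_family qM P).
Context (c : gcycle G).
Local Notation v := (cycle_source c).
Local Notation cs := (cycle_seq c).
Local Notation C := (celt p c).

Lemma map_pelt u s : q (pelt P u s) = pelt p u s.
Proof. by elim: s u => //= e s IH u; rewrite qM IH. Qed.

Lemma split_path s1 e s2 : cs = s1 ++ e :: s2 ->
  [/\ is_path v s1, path_end v s1 = source e & is_path (source e) (e :: s2)].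
Proof.
move=> csE; have := cycle_is_path c; rewrite csE is_path_cat /=.
by move=> /and3P[-> /eqP <- ->]; rewrite eqxx.
Qed.

(* Conjugating f(C) = 0 by the initial segment of C ending at s(e) yields
   s(e) + e r = 0 for some r. *)
Lemma exclusive_of_poly (f : {poly F}) : f.[0] = 1 -> q (cycle_eval c f) = 0 ->
  forall e, e \in cs -> fe p e ** fg p e = fv p (source e).
Proof.
move=> f0 qf e ecs; have [s1 [s2 csE]] : exists s1 s2, cs = s1 ++ e :: s2.
  by case/splitPr: ecs => s1 s2; exists s1, s2.
have [s1p s1e s2p] := split_path csE.
have /factor_theorem[h] : root (f - 1) 0 by rewrite /root !hornerE f0 subrr.
rewrite subr0 => fE.
have : gelt p v s1 ** q (cycle_eval c f) ** pelt p v s1 = 0.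
  by rewrite qf nmul0r nmul0l.
rewrite cycle_eval_cpoly -[f](subrK 1) fE mulrC linearD /= cpolyXM cpoly1.
rewrite nmulDr nmulDl gelt_fv // geltK // s1e.
have -> : celt p c = pelt p v s1 ** (fe p e ** pelt p (target e) s2).
  by rewrite /celt csE pelt_cat ?s1e // -csE cycle_is_path.
set H := cpoly _ _ _; rewrite !nmulA geltK // s1e fve -!nmulA.
set r := _ ** (H ** _) => /eqP; rewrite addr_eq0 => /eqP er.
(* e e^* fixes e r, which is - s(e); hence e e^* = s(e). *)
have eer : fe p e ** fg p e ** (fe p e ** r) = fe p e ** r.
  by rewrite -nmulA [fg p e ** _]nmulA fgeK nmulA fev.
move: eer; rewrite er nmulNr => /oppr_inj.
by rewrite -nmulA fgv.
Qed.

Hypothesis excl : forall e, e \in cs -> fe p e ** fg p e = fv p (source e).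

Lemma exclusive_fe e f : e \in cs -> source f = source e -> f != e -> fe p f = 0.
Proof.
by move=> ecs fe_ ef; rewrite -fve fe_ -excl // -nmulA fge_neq ?nmul0r // eq_sym.
Qed.

Lemma exclusive_fg e f : e \in cs -> source f = source e -> f != e -> fg p f = 0.
Proof.
by move=> ecs fe_ ef; rewrite -fgv fe_ -excl // nmulA fge_neq ?nmul0l.
Qed.

Lemma exclusive_peltK u s : is_path u s -> {subset s <= cs} ->
  pelt p u s ** gelt p u s = fv p u.
Proof.
elim: s u => [|e s IH] u /=; first by rewrite fvK.
move=> /andP[/eqP <- es] sub; rewrite -nmulA [_ ** (_ ** fg p e)]nmulA IH //.
  by rewrite fvg excl // sub // inE eqxx.
by move=> f fs; apply: sub; rewrite inE fs orbT.
Qed.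

Lemma iter_celt_mul k y :
  iter k (nmul C) (fv p v) ** y = iter k (nmul C) (fv p v ** y).
Proof. by elim: k => //= k IH; rewrite -nmulA IH. Qed.

Lemma iter_celtS k : iter k (nmul C) (fv p v) ** C = C ** iter k (nmul C) (fv p v).
Proof. by rewrite iter_celt_mul fv_celt -iterS iterSr celt_fv. Qed.

Definition cycle_ghost : B := gelt p v cs.

Lemma celtK : C ** cycle_ghost = fv p v.
Proof. exact: exclusive_peltK (cycle_is_path c) _. Qed.

Lemma cycle_ghostK : cycle_ghost ** C = fv p v.
Proof. by rewrite geltK ?cycle_path_end // cycle_is_path. Qed.

(** A path that leaves C vanishes by [exclusive_fe]; any other winds [k] times and stops after a
    proper initial segment. When its next arrow is the last one of C, a turn is completed and [k]
    increases. *)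
Lemma exclusive_path s : is_path v s -> pelt p v s = 0 \/
  exists k s1 f s2, cs = s1 ++ f :: s2 /\
    pelt p v s = iter k (nmul C) (fv p v) ** pelt p v s1.
Proof.
elim/last_ind: s => [_|s e IH].
  right; exists 0%N, [::], (val c).1, (val c).2; split=> //.
  by rewrite /= fvK.
rewrite -cats1 is_path_cat => /andP[sp ep].
have -> : pelt p v (s ++ [:: e]) = pelt p v s ** fe p e.
  by rewrite pelt_cat ?is_path_cat ?sp //= fev.
have [->|[k [s1 [f [s2 [csE ->]]]]]] := IH sp; first by left; rewrite nmul0l.
have [s1p s1e fp] := split_path csE.
have fcs : f \in cs by rewrite csE mem_cat inE eqxx orbT.
rewrite -nmulA -(pelt_fv p v s1) s1e -nmulA fv_fe.
have [fe_|_] := eqVneq (source f) (source e); last by left; rewrite scale0r !nmul0r.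
have [ef|ef] := eqVneq e f; last first.
  by left; rewrite (exclusive_fe fcs) ?scaler0 ?nmul0r.
rewrite scale1r ef; right; case: s2 => [|f' s2] in csE fp *.
  exists k.+1, [::], (val c).1, (val c).2; split=> //.
  have -> : pelt p v s1 ** fe p f = C.
    rewrite /celt csE pelt_cat ?s1e ?is_path_cat ?s1p // ?s1e ?pelt1 //.
  by rewrite iter_celtS /= -nmulA iter_celt_mul fvK.
exists k, (s1 ++ [:: f]), f', s2; rewrite -catA; split=> //.
by rewrite pelt_cat ?s1e ?pelt1 // is_path_cat s1p s1e /= eqxx.
Qed.

(* Multiplying by the ghosts of initial segments of C brings y back to the corner
   at s(C), so that commutation with C can be followed along y letter by letter. *)
Definition commutes_on_prefixes y : Prop := forall s1 f s2, cs = s1 ++ f :: s2 ->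
  y ** gelt p v s1 ** C = C ** (y ** gelt p v s1).

(** Sources on C are distinct, so two proper initial segments either coincide, and the product is
    C^k, or have orthogonal end vertices, and it is 0. *)
Lemma commutes_path k s1 f s2 : cs = s1 ++ f :: s2 ->
  commutes_on_prefixes (iter k (nmul C) (fv p v) ** pelt p v s1).
Proof.
move=> csE t1 g t2 csE'.
have [s1p s1e _] := split_path csE; have [t1p t1e _] := split_path csE'.
have [fg_|fg_] := eqVneq (source f) (source g).
  have st : size s1 = size t1.
    apply/eqP; rewrite -(nth_uniq (source f) _ _ (cycle_uniq c)) ?size_map.
    - rewrite {1}csE csE' !map_cat !nth_cat !size_map !ltnn !subnn /= fg_.
      by [].
    - by rewrite csE size_cat /= addnS ltnS leq_addr.
    - by rewrite csE' size_cat /= addnS ltnS leq_addr.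
  have -> : t1 = s1.
    have := congr1 (take (size s1)) csE; rewrite take_size_cat // => <-.
    by rewrite csE' st take_size_cat.
  rewrite -[_ ** pelt p v s1 ** _]nmulA exclusive_peltK //; last first.
    by move=> e es; rewrite csE mem_cat es.
  by rewrite iter_celt_mul fvK iter_celtS.
have -> : iter k (nmul C) (fv p v) ** pelt p v s1 ** gelt p v t1 = 0.
  rewrite -nmulA -pelt_fv -fv_gelt s1e t1e -nmulA [_ ** (fv p _ ** gelt _ _ _)]nmulA.
  by rewrite fv_neq // nmul0l !nmul0r.
by rewrite nmul0l nmul0r.
Qed.

(** The new ghost kills the segment, extends it by one arrow, or completes C. In the last case
    commutation with C yields commutation with its inverse [cycle_ghost]. *)
Lemma commutes_fg y e : commutes_on_prefixes y -> commutes_on_prefixes (y ** fg p e).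
Proof.
move=> yC s1 f s2 csE; have [s1p s1e fp] := split_path csE.
have fcs : f \in cs by rewrite csE mem_cat inE eqxx orbT.
rewrite -[y ** _ ** _]nmulA -fv_gelt s1e [fg p e ** _]nmulA fg_fv nmulZl.
have [ef|_] := eqVneq (source e) (source f); last by rewrite scale0r !nmul0r nmul0l.
have [->|ef'] := eqVneq e f; last first.
  by rewrite (exclusive_fg fcs) // nmul0l scaler0 !nmul0r nmul0l.
rewrite scale1r; have -> : fg p f ** gelt p v s1 = gelt p v (s1 ++ [:: f]).
  rewrite gelt_cat ?s1e ?gelt1 // is_path_cat s1p s1e /= eqxx //.
case: s2 => [|f' s2] in csE fp *; last first.
  by apply: (yC (s1 ++ [:: f]) f' s2); rewrite -catA.
rewrite -csE -/cycle_ghost -nmulA cycle_ghostK nmulA.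
have := yC [::] (val c).1 (val c).2 erefl; rewrite /= => yvC.
have -> : C ** y ** cycle_ghost = C ** (y ** fv p v) ** cycle_ghost.
  rewrite -!nmulA; congr (_ ** (_ ** _)).
  by rewrite /cycle_ghost -{1}[gelt p v cs]fv_gelt cycle_path_end.
by rewrite -yvC -nmulA celtK -nmulA fvK.
Qed.

Lemma commutes_all x : commutes_on_prefixes (fv p v ** q x).
Proof.
have lin a y z : commutes_on_prefixes y -> commutes_on_prefixes z ->
    commutes_on_prefixes (a *: y + z).
  move=> yC zC s1 f s2 csE; rewrite !(nmulDl, nmulDr, nmulZl, nmulZr).
  by rewrite (yC _ _ _ csE) (zC _ _ _ csE).
have sum (T : eqType) (r : seq T) (g : T -> B) :
    (forall t, t \in r -> commutes_on_prefixes (g t)) ->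
    commutes_on_prefixes (\sum_(t <- r) g t).
  move=> H; rewrite big_seq; elim/big_ind: _ => //.
    by move=> s1 f s2 _; rewrite !nmul0l nmul0r.
  by move=> y z yC zC; rewrite -[y]scale1r; exact: lin.
have scale a y : commutes_on_prefixes y -> commutes_on_prefixes (a *: y).
  move=> yC; rewrite -[_ *: _]addr0; apply: lin => //.
  by move=> s1 f s2 _; rewrite !nmul0l nmul0r.
have com0 : commutes_on_prefixes 0 by move=> s1 f s2 _; rewrite !nmul0l nmul0r.
have [n] := ghost_degreeP x; elim: n x => [|n IH] x /=.
  move=> [l lp ->]; rewrite linear_sum nmul_sumr; apply: sum => t /(allP lp) tp.
  rewrite linearZ /= nmulZr; apply: scale; rewrite map_pelt -[pelt _ _ _]fv_pelt // nmulA fvv.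
  rewrite nmulZl; have [vt|_] := eqVneq; last by rewrite scale0r.
  rewrite scale1r; rewrite -vt in tp *; rewrite fv_pelt //.
  have [->//|[k [s1 [f [s2 [csE ->]]]]]] := exclusive_path tp.
  exact: commutes_path csE.
move=> [b [l [rb lg ->]]]; rewrite linearD linear_sum nmulDr nmul_sumr -[_ ** q b]scale1r.
apply: lin; last first.
  apply: sum => t /lg gt; rewrite qM nmulA; apply: commutes_fg; exact: IH.
exact/IH/real_ghost.
Qed.

Lemma corner_commutes x :
  fv p v ** q x ** fv p v ** C = C ** (fv p v ** q x ** fv p v).
Proof. exact: (commutes_all x (s1 := [::])). Qed.

End ExclusiveCycle.

(** * Squarefree parts of split polynomials *)

Section PolyRadical.
Context (F : fieldType) (f : {poly F}).
Hypothesis f0 : f.[0] = 1.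

Lemma poly_radicalP : splits f ->
  exists rs, [/\ uniq rs, poly_radical f %= \prod_(a <- rs) ('X - a%:P) &
    exists m, f %| poly_radical f ^+ m].
Proof.
move=> [rs0 frs]; pose rs := undup rs0.
pose p := \prod_(a <- rs) ('X - a%:P).
have f_neq0 : f != 0.
  by apply/eqP => f00; move: f0; rewrite f00 horner0 => /esym/eqP; rewrite oner_eq0.
have rootf a : root f a = (a \in rs).
  by rewrite mem_undup -root_prod_XsubC (eqp_root frs).
have radE : poly_radical f = (p.[0])^-1 *: p.
  rewrite /poly_radical; set A := [set q | _].
  suff -> : \big[*%R/1]_(q \in A) q = p by [].
  have urs : uniq [seq 'X - a%:P | a <- rs].
    by rewrite map_inj_uniq ?undup_uniq // => a b /addrI/oppr_inj/polyC_inj.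
  rewrite /p -(big_map (fun a => 'X - a%:P) xpredT id) (fsbig_seq _ id urs).
  congr (\big[*%R/1]_(q \in _) q); apply/seteqP; split=> q /=.
    move=> [qm [sq qirr] qf]; have [a qa] : exists a, root q a.
      move: qf; rewrite (eqp_dvdr _ frs) => /dvdp_prod_XsubC[m qE].
      have : size q = size (\prod_(a <- mask m rs0) ('X - a%:P)) by exact: eqp_size.
      case: (mask m rs0) qE => [|a s] qE; first by rewrite big_nil size_poly1 => sq1; rewrite sq1 in sq.
      by move=> _; exists a; rewrite (eqp_root qE) root_prod_XsubC inE eqxx.
    have /qirr : size ('X - a%:P) != 1%N by rewrite size_XsubC.
    rewrite dvdp_XsubCl => /(_ qa); rewrite eqp_monic ?monicXsubC // => /eqP <-.
    apply/mapP; exists a => //.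
    by rewrite -rootf -dvdp_XsubCl (dvdp_trans _ qf) // dvdp_XsubCl.
  move=> /mapP[a ars ->]; split; [exact: monicXsubC|exact: irredp_XsubC|].
  by rewrite dvdp_XsubCl rootf.
have p0 : p.[0] != 0.
  by rewrite -/(root p 0) root_prod_XsubC -rootf /root f0 oner_eq0.
have radp : poly_radical f %= p by rewrite radE eqp_scale ?invr_eq0.
exists rs; split=> //; first exact: undup_uniq.
(* The number of roots with multiplicity: each linear factor of [f] is paid for by one copy of the
   radical. *)
exists (size rs0); rewrite (eqp_dvdl _ frs) (eqp_dvdr _ (eqp_exp _ radp)).
have : {subset rs0 <= rs} by move=> a; rewrite mem_undup.
elim: (rs0) => [|a s IH] sub; first by rewrite big_nil expr0 dvdpp.
rewrite big_cons exprS dvdp_mul //.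
  by rewrite dvdp_XsubCl root_prod_XsubC sub // inE eqxx.
by apply: IH => b bs; apply: sub; rewrite inE bs orbT.
Qed.

End PolyRadical.

(** * The ideal J' modulo J *)

Section IdealPrime.
Context (F : fieldType) (G : digraph) (J : nuIdeal (leavitt F G)).
Hypothesis roots_in_F : forall c : gcycle G, contributes J c -> splits (canonical_poly J c).
Local Notation P := (canonical_family F G).

Lemma to_quot_eq0 (A : nuAlgType F) (I : nuIdeal A) (x : A) : to_quot I x = 0 <-> x \in I.
Proof. by rewrite -(linear0 (to_quot I)) to_quotP subr0. Qed.

Lemma iter_to_quot (A : nuAlgType F) (I : nuIdeal A) (x : A) n :
  iter n (nmul (to_quot I x)) (to_quot I x) = to_quot I (iter n (nmul x) x).
Proof. by elim: n => //= n ->; rewrite to_quotM. Qed.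

Lemma iter_cycle_eval c (f : {poly F}) n :
  iter n (nmul (cycle_eval c f)) (cycle_eval c f) = cycle_eval c (f ^+ n.+1) :> leavitt F G.
Proof. by elim: n => [|n IH]; rewrite ?expr1 // iterS IH -cycle_evalM -exprS. Qed.

Lemma poly_radical_nilradical c : contributes J c ->
  to_quot J (cycle_eval c (poly_radical (canonical_poly J c))) \in nilradical (nuquot J).
Proof.
move=> cc; have [f0 fP] := canonical_polyP cc.
have [rs [_ _ [m fm]]] := poly_radicalP f0 (roots_in_F cc).
set f := canonical_poly J c in f0 fP fm *; set g := poly_radical f in fm *.
pose q : {linear leavitt F G -> nuquot J} := to_quot J.
have qM : {morph q : x y / x ** y} := to_quotM J.
have excl := exclusive_of_poly qM f0
  (proj2 (to_quot_eq0 _ _) (proj2 (fP f) (dvdpp f))).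
have gE : to_quot J (cycle_eval c g) = _ := cycle_eval_cpoly qM c g.
pose p := map_family qM P.
apply: (@central_nilpotent_nilradical _ _ (fv p (cycle_source c)) _ m).
- by rewrite gE cpoly_vl ?fvK ?fv_celt ?celt_fv.
- by rewrite gE cpoly_vr ?fvK ?fv_celt ?celt_fv.
- move=> y; have [x <-] : exists x, q x = y by exists (repr y); exact: to_quotK.
  have := corner_commutes excl x; rewrite gE -/p.
  set w := fv p _ ** q x ** fv p _ => wC.
  have wv : w ** fv p (cycle_source c) = w by rewrite /w -nmulA fvK.
  have vw : fv p (cycle_source c) ** w = w by rewrite /w !nmulA fvK.
  elim/poly_linear_ind: g {gE fm} => [i|a h k IHh IHk]; last first.
    by rewrite linearP /= nmulDr nmulZr IHh IHk nmulDl nmulZl.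
  rewrite cpolyXn; elim: i => [|i IH] /=; first by rewrite wv vw.
  by rewrite nmulA wC -nmulA IH nmulA.
- rewrite iter_to_quot iter_cycle_eval; apply/to_quot_eq0/fP.
  by apply: dvdp_trans fm _; rewrite exprS dvdp_mull.
Qed.

Lemma ideal_prime_nilradical x : x \in ideal_prime J ->
  to_quot J x \in nilradical (nuquot J).
Proof.
elim/ideal_gen_ind => [y [Jy|[c cc ->]]||a y z Hy Hz|a y Hy|a y Hy].
- by rewrite (proj2 (to_quot_eq0 _ _) Jy) rpred0.
- exact: poly_radical_nilradical.
- by rewrite linear0 rpred0.
- by rewrite linearP; apply: rpredD => //; exact: rpredZ.
- by rewrite to_quotM; exact: ideal_nmull.
- by rewrite to_quotM; exact: ideal_nmulr.
Qed.

Lemma ideal_prime_sub : [set` J] `<=` [set` ideal_prime J].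
Proof. by move=> x Jx; apply: ideal_gen_sub; left. Qed.

(** J'/J is nil, so if f(C) lies in J', a power of it lies in J. *)
Lemma contributes_ideal_prime c : contributes (ideal_prime J) c -> contributes J c.
Proof.
move=> /contributesP[[f f0 /ideal_prime_nilradical/nilradical_nil[n fn]] vJ'].
apply/contributesP; split; last by apply: contra_not vJ'; exact: ideal_prime_sub.
exists (f ^+ n.+1); first exact: expf_neq0.
by apply/to_quot_eq0; rewrite -iter_cycle_eval -iter_to_quot.
Qed.

(** The polynomial of J' at C divides g_C, because g_C(C) lies in J', and thus inherits distinct
    roots. *)
Lemma ideal_prime_separable c : contributes (ideal_prime J) c ->
  exists2 rs, uniq rs & canonical_poly (ideal_prime J) c %= \prod_(a <- rs) ('X - a%:P).
Proof.
move=> cc'; have cc := contributes_ideal_prime cc'.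
have [f0 _] := canonical_polyP cc; have [_ gP] := canonical_polyP cc'.
have [rs [urs rad _]] := poly_radicalP f0 (roots_in_F cc).
have : canonical_poly (ideal_prime J) c %| poly_radical (canonical_poly J c).
  by apply/gP/ideal_gen_sub; right; exists c.
rewrite (eqp_dvdr _ rad) => /dvdp_prod_XsubC[m gE].
by exists (mask m rs) => //; exact: mask_uniq.
Qed.

End IdealPrime.

Lemma lagrange_basis (F : fieldType) (rs : seq F) : uniq rs ->
  exists L : 'I_(size rs) -> {poly F},
    forall i j : 'I_(size rs), (L j).[rs`_i] = (i == j)%:R.
Proof.
move=> urs; pose L (j : 'I_(size rs)) : {poly F} :=
  \prod_(i < size rs | i != j) ((rs`_j - rs`_i)^-1 *: ('X - (rs`_i)%:P)).
exists L => i j; rewrite horner_prod.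
have [->|ij] := eqVneq i j; last first.
  by rewrite (bigD1 i) //= hornerZ hornerXsubC subrr mulr0 mul0r.
apply: big1 => k kj; rewrite hornerZ hornerXsubC mulVf //.
by rewrite subr_eq0 nth_uniq // eq_sym.
Qed.

(** * Cycles with a common vertex *)

Section CommonVertex.
Context (G : digraph).

Lemma rot_path (c : gcycle G) e : e \in cycle_seq c -> exists n s,
  [/\ (n <= size (cycle_seq c))%N, rot n (cycle_seq c) = e :: s, is_path (source e) (e :: s) &
      path_end (source e) (e :: s) = source e].
Proof.
move=> ec; have [s1 [s2 csE]] : exists s1 s2, cycle_seq c = s1 ++ e :: s2.
  by case/splitPr: ec => s1 s2; exists s1, s2.
have [p1 e1 p2 e2] : [/\ is_path (cycle_source c) s1, path_end (cycle_source c) s1 = source e,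
    is_path (target e) s2 & path_end (target e) s2 = cycle_source c].
  have := cycle_is_path c; have := cycle_path_end c.
  by rewrite csE path_end_cat is_path_cat path_end_cons /= => ? /and3P[-> /eqP <- ->].
exists (size s1), (s2 ++ s1); rewrite csE rot_size_cat size_cat leq_addr; split=> //.
  by rewrite /= eqxx is_path_cat p2 e2.
by rewrite path_end_cons path_end_cat e2.
Qed.

(** Rotated to start at [e0], one cycle is a prefix of the other, as a vertex on both determines the
    next arrow. A proper prefix would close up early and repeat the source of [e0]. *)
Lemma rotation_common (c c' : gcycle G) e0 : e0 \in cycle_seq c -> e0 \in cycle_seq c' ->
  (forall e f, e \in cycle_seq c -> f \in cycle_seq c' -> source e = source f -> e = f) ->
  rotation c c'.
Proof.
move=> e0c e0c' cc'; have [n [s [nc rn sp se]]] := rot_path e0c.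
have [m [t [_ rm tp te]]] := rot_path e0c'.
have pre r1 r2 u : is_path u r1 -> is_path u r2 -> {subset r1 <= cycle_seq c} ->
    {subset r2 <= cycle_seq c'} -> prefix r1 r2 || prefix r2 r1.
  elim: r1 r2 u => [|e r1 IH] [|f r2] u //= /andP[/eqP eu er] /andP[/eqP fu fr] sub1 sub2.
  have ef : e = f by apply: cc'; rewrite ?sub1 ?sub2 ?inE ?eqxx // eu fu.
  rewrite -ef eqxx /=; apply: (IH r2 (target e)) => //; first by rewrite ef.
  - by move=> x xr; apply: sub1; rewrite inE xr orbT.
  - by move=> x xr; apply: sub2; rewrite inE xr orbT.
have eqr r1 r2 : is_path (source e0) (e0 :: r2) -> uniq (map source (e0 :: r2)) ->
    path_end (source e0) (e0 :: r1) = source e0 -> prefix (e0 :: r1) (e0 :: r2) ->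
    e0 :: r1 = e0 :: r2.
  move=> p2 u2 end1 /prefixP[[|f r] rE]; first by rewrite rE cats0.
  move: p2 u2; rewrite rE is_path_cat end1 map_cat cat_uniq.
  move=> /andP[_ /andP[/eqP fe _]] /and3P[_ /hasPn/(_ (source e0))].
  by rewrite /= fe !inE eqxx => /(_ isT).
have st : e0 :: s = e0 :: t.
  have us : uniq (map source (e0 :: s)) by rewrite -rn map_rot rot_uniq cycle_uniq.
  have ut : uniq (map source (e0 :: t)) by rewrite -rm map_rot rot_uniq cycle_uniq.
  have [| |/eqr->//|/eqr->//] := orP (pre _ _ _ sp tp _ _).
  - by rewrite -rn => x; rewrite mem_rot.
  - by rewrite -rm => x; rewrite mem_rot.
rewrite /rotation -[cycle_seq c'](rotK m) rm -st -rn /rotr size_rot.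
by rewrite rot_add_mod ?leq_subr //; eexists.
Qed.

End CommonVertex.

(** * Contributing cycles modulo the ideal, and their idempotents *)

Section Transversal.
Context (F : fieldType) (G : digraph) (I : nuIdeal (leavitt F G)).
Context (B : nuAlgType F) (q : {linear leavitt F G -> B}) (qM : {morph q : x y / x ** y}).
Hypothesis qker : forall x, q x = 0 <-> x \in I.
Local Notation P := (canonical_family F G).
Local Notation p := (map_family qM P).
Local Notation H := (ideal_vertices I).

Lemma ideal_verticesE v : H v <-> fv p v = 0.
Proof. by split=> [Hv|/qker//]; apply/qker. Qed.

Lemma fe_eq0 e : fe p e = 0 <-> H (target e).
Proof.
rewrite ideal_verticesE; split=> e0; first by rewrite -fgeK e0 nmul0r.
by rewrite -fev e0 nmul0r.
Qed.

Lemma fg_eq0 e : H (target e) -> fg p e = 0.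
Proof. by move=> /ideal_verticesE e0; rewrite -fvg e0 nmul0l. Qed.

Section OneCycle.
Context (c : gcycle G) (cc : contributes I c).
Local Notation v := (cycle_source c).
Local Notation cs := (cycle_seq c).
Local Notation C := (celt p c).

Lemma contributes_exclusive e : e \in cs -> fe p e ** fg p e = fv p (source e).
Proof.
have [f0 fP] := canonical_polyP cc.
by apply: (exclusive_of_poly qM f0); apply/qker/fP; exact: dvdpp.
Qed.

(** If one vertex of C maps to 0, then so does C, and with it s(C), the product of C with its
    ghost. *)
Lemma contributes_source e : e \in cs -> ~ H (source e).
Proof.
move=> ec /ideal_verticesE e0; apply: (contributes_notin cc); apply/ideal_verticesE.
rewrite -(celtK contributes_exclusive) /celt.
have [s1 [s2 csE]] : exists s1 s2, cs = s1 ++ e :: s2.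
  by case/splitPr: ec => s1 s2; exists s1, s2.
have [_ s1e _] := split_path csE.
rewrite csE pelt_cat -?csE ?cycle_is_path // s1e /= -[fe p e]fve e0.
by rewrite !nmul0l nmul0r nmul0l.
Qed.

Lemma contributes_fe e : e \in cs -> fe p e <> 0.
Proof.
move=> ec e0; apply: (contributes_source ec); apply/ideal_verticesE.
by rewrite -contributes_exclusive // e0 nmul0l.
Qed.

Lemma contributes_no_exit e f : e \in cs -> fe p f <> 0 -> source f = source e -> f = e.
Proof.
move=> ec f0 fe_; apply: contrapT => /eqP ef; apply: f0.
exact: exclusive_fe contributes_exclusive _ _ ec fe_ ef.
Qed.

(** The only arrow leaving this vertex outside H is [e], and e e^* = s(e) modulo [I], so the
    breaking element lies in [I]. *)
Lemma contributes_primed e : e \in cs -> ~ primed I (source e).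
Proof.
move=> ec [br nbr]; apply: nbr; split=> //=; apply/qker.
have outE : out_notin I (source e) = [set e].
  apply/seteqP; split=> [f [/= fs Hf]|f ->] /=.
    by apply: contributes_no_exit => //; rewrite fe_eq0.
  by split=> //=; rewrite -fe_eq0; exact: contributes_fe.
rewrite /breaking_elt outE fsbig_set1 linearB /= qM.
by apply/eqP; rewrite subr_eq0; apply/eqP; exact: esym (contributes_exclusive ec).
Qed.

(** Chinese remainder theorem: modulo [I], an element of F[C] is determined by the values of its
    polynomial at the roots. The u_j are the Lagrange polynomials at C and the lam_j are the
    roots. *)
Lemma split_idempotents : (exists2 rs, uniq rs &
    canonical_poly I c %= \prod_(a <- rs) ('X - a%:P)) ->
  exists (u : 'I_(size (canonical_poly I c)).-1 -> B)
    (lam : 'I_(size (canonical_poly I c)).-1 -> F),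
   [/\ forall i j, u i ** u j = (i == j)%:R *: u i, fv p v = \sum_j u j,
       forall j, u j <> 0, forall j, lam j != 0 & C = \sum_j lam j *: u j].
Proof.
move=> [rs urs frs]; have [f0 fP] := canonical_polyP cc.
have -> : (size (canonical_poly I c)).-1 = size rs.
  by rewrite (eqp_size frs) size_prod_XsubC.
have [L LE] := lagrange_basis urs.
pose ev g := cpoly (fv p v) C g.
have evP (g h : {poly F}) : (forall i : 'I_(size rs), g.[rs`_i] = h.[rs`_i]) -> ev g = ev h.
  move=> gh; apply/eqP; rewrite -subr_eq0 -linearB /= /ev -(cycle_eval_cpoly qM).
  apply/eqP/qker/fP; rewrite (eqp_dvdl _ frs).
  apply: uniq_roots_dvdp; last by rewrite uniq_rootsE.
  apply/allP => a /(nthP 0)[i irs <-]; rewrite /root !hornerE.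
  by rewrite (gh (Ordinal irs)) subrr.
have evM (g h : {poly F}) : ev (g * h) = ev g ** ev h.
  by rewrite /ev cpolyM ?fvK ?fv_celt ?celt_fv.
exists (fun j => ev (L j)), (fun j => rs`_j); split.
- move=> i j; rewrite -evM -linearZ; apply: evP => k.
  rewrite !hornerE !LE; have [->|ij] := eqVneq i j.
    by rewrite mul1r; case: eqP; rewrite ?mulr1 ?mulr0.
  by rewrite mul0r; have [->|_] := eqVneq k i; rewrite ?(negbTE ij) ?mulr0 ?mul0r.
- rewrite -[LHS](cpoly1 _ C) -linear_sum; apply: evP => k.
  rewrite hornerC horner_sum (bigD1 k) //= LE eqxx big1 ?addr0 // => i ik.
  by rewrite LE eq_sym (negbTE ik).
- move=> j /eqP; rewrite /ev -(cycle_eval_cpoly qM) => /eqP/qker/fP.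
  rewrite (eqp_dvdl _ frs) => /dvdpP[h LjE].
  have := LE j j; rewrite LjE hornerM eqxx.
  have /rootP -> : root (\prod_(a <- rs) ('X - a%:P)) rs`_j.
    by rewrite root_prod_XsubC mem_nth.
  by rewrite mulr0 => /esym/eqP; rewrite oner_eq0.
- move=> j; apply: contra_eq_neq f0 => rj.
  have /rootP -> : root (canonical_poly I c) 0.
    by rewrite (eqp_root frs) root_prod_XsubC -rj mem_nth.
  by rewrite eq_sym oner_eq0.
- rewrite -[LHS](cpolyX (celt_fv p c)).
  under eq_bigr do rewrite -linearZ.
  rewrite -linear_sum; apply: evP => k.
  rewrite hornerX horner_sum (bigD1 k) //= hornerZ LE eqxx mulr1 big1 ?addr0 // => i ik.
  by rewrite hornerZ LE eq_sym (negbTE ik) mulr0.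
Qed.

End OneCycle.

Lemma common_source_rotation c c' e e' : contributes I c -> contributes I c' ->
  e \in cycle_seq c -> e' \in cycle_seq c' -> source e = source e' -> rotation c c'.
Proof.
move=> cc cc' ec ec' ee.
have cc'E e1 f1 : e1 \in cycle_seq c -> f1 \in cycle_seq c' -> source e1 = source f1 -> e1 = f1.
  move=> e1c f1c' ef; apply: contributes_no_exit cc' _ _ f1c' _ ef.
  exact: contributes_fe cc _ e1c.
apply: (@rotation_common _ _ _ e) => //.
by rewrite (cc'E _ _ ec ec' ee).
Qed.

Context (K : set (contributing_cycle I)) (choiceK : geometric_transversal K).

(** Contributing cycles that share a vertex are rotations of each other, and the transversal
    contains one rotation only. So a representative cycle is cut at a single vertex. *)
Lemma transversal_source (k k' : K) e e' : e \in cycle_seq (val (val k)) ->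
  e' \in cycle_seq (val (val k')) -> source e = source e' -> k = k'.
Proof.
move=> ek ek' ee; apply: val_inj.
have kc (k0 : K) : contributes I (val (val k0)) by exact: set_mem (valP (val k0)).
have [k0 [_ k0U]] := choiceK (val k).
rewrite -(k0U (val k)); last first.
  by split; [exact: set_mem (valP k)|exists 0%N; rewrite rot0].
apply: k0U; split; first exact: set_mem (valP k').
exact: common_source_rotation (kc k) (kc k') ek ek' ee.
Qed.

End Transversal.

(** * The split quotient digraph *)

Section SplitSinksTheory.
Context (D : digraph) (I : choiceType) (w : I -> vertex D) (d : I -> nat).
Local Notation S := (split_sinks w d).

(** Strips the membership proofs, so that vertices are compared by their data alone. *)
Definition skind (x : vertex S) : vertex D + {i : I & 'I_(d i)} :=
  match x with inl x => inl (val x) | inr y => inr y end.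

Definition sbase (x : vertex S) : vertex D :=
  match skind x with inl u => u | inr y => w (tag y) end.

Definition sunder (a : arrow S) : arrow D :=
  match a with inl x => val x | inr x => (val x).1 end.

Lemma skind_inj : injective skind.
Proof. by move=> [x|x] [y|y] //= [] => [/val_inj|] ->. Qed.

Lemma skind_old u : ~ range w u <-> exists x, skind x = inl u.
Proof.
split=> [uw|[[x|y] // [<-]]]; last exact: set_mem (valP x).
by exists (kept_vertex d uw).
Qed.

Lemma ssourceE a : skind (source a) = inl (source (sunder a)).
Proof. by case: a. Qed.

Lemma stargetE a : sbase (target a) = target (sunder a).
Proof. by case: a => [a|[[a y] aP]] //=; have [] := set_mem aP. Qed.

Lemma sunder_inj a b : sunder a = sunder b -> target a = target b -> a = b.
Proof.
move: a b => [a|[[a y] aP]] [b|[[b z] bP]] //=; first by move=> /val_inj ->.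
by move=> ab [yz]; congr inr; apply: val_inj => /=; rewrite ab yz.
Qed.

Lemma sunder_lift e x : ~ range w (source e) -> sbase x = target e ->
  exists a, sunder a = e /\ target a = x.
Proof.
case: x => [x|y] ew xe.
  have eP : kept_arrow w e by split=> //; rewrite -xe; exact: set_mem (valP x).
  exists (inl (SigSub (mem_set eP))); split=> //=.
  by congr inl; exact: val_inj.
have eP : new_arrow w (d := d) (e, y) by split=> //; rewrite -xe.
by exists (inr (SigSub (mem_set eP))).
Qed.

End SplitSinksTheory.

Section QuotientDigraphTheory.
Context (F : fieldType) (G : digraph) (I : nuIdeal (leavitt F G)).
Local Notation Q := (quotient_digraph I).
Local Notation H := (ideal_vertices I).

Definition qkind (x : vertex Q) : vertex G + vertex G :=
  match x with inl u => inl (val u) | inr u => inr (val u) end.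

Definition qbase (x : vertex Q) : vertex G :=
  match qkind x with inl u => u | inr u => u end.

Definition qunder (a : arrow Q) : arrow G :=
  match a with inl e => val e | inr e => val e end.

Lemma qkind_inj : injective qkind.
Proof. by move=> [x|x] [y|y] //= [] /val_inj ->. Qed.

Lemma qkind_old u : ~ H u <-> exists x, qkind x = inl u.
Proof.
split=> [uH|[[x|y] // [<-]]]; last exact: set_mem (valP x).
by exists (old_vertex uH).
Qed.

Lemma qkind_primed u : primed I u <-> exists x, qkind x = inr u.
Proof.
split=> [uH|[[x|y] // [<-]]]; last exact: set_mem (valP y).
by exists (inr (SigSub (mem_set uH))).
Qed.

Lemma qsourceE a : qkind (source a) = inl (source (qunder a)).
Proof. by case: a. Qed.

Lemma qtargetE a : qbase (target a) = target (qunder a).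
Proof. by case: a. Qed.

Lemma qunder_inj a b : qunder a = qunder b -> target a = target b -> a = b.
Proof. by move: a b => [a|a] [b|b] //= /val_inj ->. Qed.

Lemma qunder_lift e x : qbase x = target e -> exists a, qunder a = e /\ target a = x.
Proof.
case: x => [x|y] xe.
  have eP : [set e | ~ H (target e)] e by rewrite /= -xe; exact: set_mem (valP x).
  exists (inl (SigSub (mem_set eP))); split=> //=.
  by congr inl; exact: val_inj.
have eP : [set e | primed I (target e)] e by rewrite /= -xe; exact: set_mem (valP y).
exists (inr (SigSub (mem_set eP))); split=> //=.
by congr inr; exact: val_inj.
Qed.

End QuotientDigraphTheory.

Section SplitQuotientTheory.
Context (F : fieldType) (G : digraph) (I : nuIdeal (leavitt F G)).
Context (K : set (contributing_cycle I)).
Local Notation D := (split_quotient_digraph K).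
Local Notation H := (ideal_vertices I).

Definition rep_cycle (k : K) : gcycle G := val (val k).
Definition rep_degree (k : K) : nat := (size (canonical_poly I (rep_cycle k))).-1.

Lemma rep_contributes (k : K) : contributes I (rep_cycle k).
Proof. exact: set_mem (valP (val k)). Qed.

Definition cut (k : K) : vertex (quotient_digraph I) :=
  old_vertex (contributes_notin (rep_contributes k)).

Lemma split_quotient_digraphE : split_quotient_digraph K = split_sinks cut rep_degree.
Proof.
rewrite /split_quotient_digraph; congr split_sinks; apply/funext => k.
by congr old_vertex; exact: Prop_irrelevance.
Qed.

Definition kind_base (x : vertex G + vertex G + {k : K & 'I_(rep_degree k)}) : vertex G :=
  match x with
  | inl (inl u) => u
  | inl (inr u) => u
  | inr y => cycle_source (rep_cycle (tag y))
  end.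

(* The vertices of [D] are the old vertices [u], the primed vertices [u'] and
   the new sinks; [under a] is the arrow of [G] from which [a] arises. *)
Record split_presentation (D : digraph) := SplitPresentation {
  kind : vertex D -> vertex G + vertex G + {k : K & 'I_(rep_degree k)};
  under : arrow D -> arrow G;
  kind_inj : injective kind;
  kind_old : forall u, (exists x, kind x = inl (inl u)) <->
    ~ H u /\ forall k, cycle_source (rep_cycle k) <> u;
  kind_primed : forall u, (exists x, kind x = inl (inr u)) <-> primed I u;
  kind_sink : forall y, exists x, kind x = inr y;
  kind_source : forall a, kind (source a) = inl (inl (source (under a)));
  kind_target : forall a, kind_base (kind (target a)) = target (under a);
  under_inj : forall a b, under a = under b -> target a = target b -> a = b;
  under_lift : forall e x, ~ H (target e) ->
    (forall k, cycle_source (rep_cycle k) <> source e) ->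
    kind_base (kind x) = target e -> exists a, under a = e /\ target a = x
}.

Lemma split_quotient_presentation :
  inhabited (split_presentation (split_quotient_digraph K)).
Proof.
rewrite split_quotient_digraphE.
pose D := split_sinks cut rep_degree.
pose kd (x : vertex D) : vertex G + vertex G + {k : K & 'I_(rep_degree k)} :=
  match skind x with inl y => inl (qkind y) | inr y => inr y end.
have rangeE (x : vertex (quotient_digraph I)) u : qkind x = inl u ->
    ~ range cut x <-> forall k, cycle_source (rep_cycle k) <> u.
  move=> xu; split=> [xw k ku|ku [k _ kx]].
    by apply: xw; exists k => //; apply: qkind_inj; rewrite xu -ku.
  by apply: (ku k); move: xu; rewrite -kx => -[].
have bE x : kind_base (kd x) = qbase (sbase x).
  by rewrite /kd /sbase; case: (skind x).
suff pr : split_presentation D by constructor.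
apply: (@SplitPresentation D kd (fun a => qunder (sunder a))).
- move=> x y; rewrite /kd => xy; apply: skind_inj; move: xy.
  by case: (skind x) (skind y) => [x'|x'] [y'|y'] // [] => [/qkind_inj|] ->.
- move=> u; split=> [[x]|[uH uk]].
    rewrite /kd; case xE: (skind x) => [x'|//] [x'u].
    split; first by apply/qkind_old; exists x'.
    by apply/(rangeE _ _ x'u); apply/skind_old; exists x.
  have /qkind_old[x' x'u] := uH.
  have [x xE] : exists x : vertex D, skind x = inl x'.
    by apply/skind_old/(rangeE _ _ x'u).
  by exists x; rewrite /kd xE x'u.
- move=> u; split=> [[x]|up].
    by rewrite /kd; case: (skind x) => // x' [x'u]; apply/qkind_primed; exists x'.
  have /qkind_primed[x' x'u] := up.
  have [x xE] : exists x : vertex D, skind x = inl x'.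
    by apply/skind_old => -[k _ kx]; move: x'u; rewrite -kx.
  by exists x; rewrite /kd xE x'u.
- by move=> y; exists (inr y).
- by move=> a; rewrite /kd ssourceE qsourceE.
- by move=> a; rewrite bE stargetE qtargetE.
- move=> a b ab tab; apply: sunder_inj => //; apply: qunder_inj => //.
  by rewrite -!stargetE tab.
- move=> e x eH ek; rewrite bE => /qunder_lift[e' [e'e e't]].
  have [|//|a [ae at_]] := @sunder_lift _ _ cut rep_degree e' x.
    by apply/(rangeE _ _ (qsourceE e')); rewrite e'e.
  by exists a; rewrite ae.
Qed.

End SplitQuotientTheory.

(** * The isomorphism with the path algebra of the split digraph *)

Section SplitIsomorphism.
Context (F : fieldType) (G : digraph) (I : nuIdeal (leavitt F G)).
Context (B : nuAlgType F) (q : {linear leavitt F G -> B}) (qM : {morph q : x y / x ** y}).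
Hypothesis qker : forall x, q x = 0 <-> x \in I.
Context (K : set (contributing_cycle I)) (choiceK : geometric_transversal K).
Hypothesis separable : forall c, contributes I c ->
  exists2 rs, uniq rs & canonical_poly I c %= \prod_(a <- rs) ('X - a%:P).
Context (D : digraph) (pr : split_presentation K D).
Local Notation P := (canonical_family F G).
Local Notation p := (map_family qM P).
Local Notation H := (ideal_vertices I).
Local Notation base x := (kind_base (kind pr x)).
Local Notation und := (under pr).
Local Notation at_cycle u := (exists k : K, cycle_source (rep_cycle k) = u).

Let idempotents (k : K) :=
  split_idempotents qM qker (rep_contributes k) (separable (rep_contributes k)).

Definition sink_elt (k : K) : 'I_(rep_degree k) -> B := sval (cid (idempotents k)).
Definition sink_root (k : K) : 'I_(rep_degree k) -> F :=
  sval (cid (svalP (cid (idempotents k)))).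

Lemma sink_eltP (k : K) (u := @sink_elt k) (lam := @sink_root k) :
  [/\ forall i j, u i ** u j = (i == j)%:R *: u i,
      fv p (cycle_source (rep_cycle k)) = \sum_j u j,
      forall j, u j <> 0, forall j, lam j != 0 & celt p (rep_cycle k) = \sum_j lam j *: u j].
Proof. exact: svalP (cid (svalP (cid (idempotents k)))). Qed.

Definition inner u : B := \sum_(e \in out_notin I u) (fe p e ** fg p e).

(* The image of a vertex: an infinite emitter u with a primed copy u' is split as
   u = inner u + (u - inner u), and a cut vertex into its Lagrange idempotents. *)
Definition kind_elt (x : vertex G + vertex G + {k : K & 'I_(rep_degree k)}) : B :=
  match x with
  | inl (inl u) => if `[< primed I u >] then inner u else fv p u
  | inl (inr u) => fv p u - inner u
  | inr y => sink_elt (tagged y)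
  end.

Definition vertex_elt (x : vertex D) : B := kind_elt (kind pr x).

Lemma breaking_eltE u : finite_set (out_notin I u) ->
  q (breaking_elt I u) = fv p u - inner u.
Proof.
move=> fin; rewrite /breaking_elt /inner !fsbig_finite // linearB linear_sum.
by congr (_ - _); apply: eq_bigr => e _; exact: qM.
Qed.

Lemma inner_fe u e : finite_set (out_notin I u) -> out_notin I u e ->
  inner u ** fe p e = fe p e.
Proof.
move=> fin ue; rewrite /inner fsbig_finite // nmul_suml (bigD1_seq e) ?fset_uniq //=.
  rewrite -nmulA fgeK fev big1 ?addr0 // => f fe_.
  by rewrite -nmulA fge_neq ?nmul0r.
by rewrite in_fset_set // inE.
Qed.

Lemma fg_inner u e : finite_set (out_notin I u) -> out_notin I u e ->
  fg p e ** inner u = fg p e.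
Proof.
move=> fin ue; rewrite /inner fsbig_finite // nmul_sumr (bigD1_seq e) ?fset_uniq //=.
  rewrite nmulA fgeK fvg big1 ?addr0 // => f fe_.
  by rewrite nmulA fge_neq ?nmul0l // eq_sym.
by rewrite in_fset_set // inE.
Qed.

Lemma inner_idem u : finite_set (out_notin I u) -> inner u ** inner u = inner u.
Proof.
move=> fin; rewrite {2 3}/inner !fsbig_finite // nmul_sumr.
apply: eq_big_seq => e; rewrite in_fset_set // inE => ue.
by rewrite nmulA inner_fe.
Qed.

Lemma fv_inner u : finite_set (out_notin I u) -> fv p u ** inner u = inner u.
Proof.
move=> fin; rewrite /inner !fsbig_finite // nmul_sumr.
apply: eq_big_seq => e; rewrite in_fset_set // inE => -[/= <- _].
by rewrite nmulA fve.
Qed.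

Lemma inner_fv u : finite_set (out_notin I u) -> inner u ** fv p u = inner u.
Proof.
move=> fin; rewrite /inner !fsbig_finite // nmul_suml.
apply: eq_big_seq => e; rewrite in_fset_set // inE => -[/= <- _].
by rewrite -nmulA fgv.
Qed.

Lemma primed_finite u : primed I u -> finite_set (out_notin I u).
Proof. by move=> [[_ _]]. Qed.

Lemma base_notin x : ~ H (base x).
Proof.
case xE: (kind pr x) => [[u|u]|[k j]] /=.
- by have /kind_old[] : exists x, kind pr x = inl (inl u) by exists x.
- have /kind_primed up : exists x, kind pr x = inl (inr u) by exists x.
  exact: primed_notin up.
- exact: contributes_notin (rep_contributes k).
Qed.

Lemma sink_fv (k : K) (j : 'I_(rep_degree k)) :
  fv p (cycle_source (rep_cycle k)) ** sink_elt j = sink_elt j /\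
  sink_elt j ** fv p (cycle_source (rep_cycle k)) = sink_elt j.
Proof.
have [uu -> _ _ _] := sink_eltP k; split.
  rewrite nmul_suml (bigD1 j) //= uu eqxx scale1r big1 ?addr0 // => i ij.
  by rewrite uu (negbTE ij) scale0r.
rewrite nmul_sumr (bigD1 j) //= uu eqxx scale1r big1 ?addr0 // => i ij.
by rewrite uu eq_sym (negbTE ij) scale0r.
Qed.

Lemma fv_vertex_elt x : fv p (base x) ** vertex_elt x = vertex_elt x.
Proof.
rewrite /vertex_elt; case xE: (kind pr x) => [[u|u]|[k j]] /=.
- case: asboolP => up; last exact: fvK.
  exact: fv_inner (primed_finite up).
- have /kind_primed up : exists x, kind pr x = inl (inr u) by exists x.
  by rewrite nmulBr fvK fv_inner //; exact: primed_finite.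
- exact: (sink_fv j).1.
Qed.

Lemma vertex_elt_fv x : vertex_elt x ** fv p (base x) = vertex_elt x.
Proof.
rewrite /vertex_elt; case xE: (kind pr x) => [[u|u]|[k j]] /=.
- case: asboolP => up; last exact: fvK.
  exact: inner_fv (primed_finite up).
- have /kind_primed up : exists x, kind pr x = inl (inr u) by exists x.
  by rewrite nmulBl fvK inner_fv //; exact: primed_finite.
- exact: (sink_fv j).2.
Qed.

Lemma rep_source_inj (k k' : K) :
  cycle_source (rep_cycle k) = cycle_source (rep_cycle k') -> k = k'.
Proof.
by apply: (transversal_source qM qker choiceK (e := (val (rep_cycle k)).1)
  (e' := (val (rep_cycle k')).1)); rewrite inE eqxx.
Qed.

Lemma rep_not_primed (k : K) : ~ primed I (cycle_source (rep_cycle k)).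
Proof. by apply: (contributes_primed qM qker (rep_contributes k)); rewrite inE eqxx. Qed.

(** Different base vertices are orthogonal. Over one base there are only an old vertex and its
    primed copy, or the sinks of a single cycle, since a cut vertex is neither kept nor primed. *)
Lemma vertex_elt_mul x y : vertex_elt x ** vertex_elt y = (x == y)%:R *: vertex_elt x.
Proof.
have [bxy|bxy] := eqVneq (base x) (base y); last first.
  have -> : (x == y) = false by apply: contra_neqF bxy => /eqP ->.
  rewrite scale0r -(vertex_elt_fv x) -(fv_vertex_elt y) -nmulA [fv p _ ** (_ ** _)]nmulA.
  by rewrite fv_neq // nmul0l nmul0r.
rewrite -(inj_eq (@kind_inj _ _ _ _ _ pr)) /vertex_elt.
have xo : forall u, kind pr x = inl (inl u) -> ~ at_cycle u.
  by move=> u xu [k ku]; have [_ /(_ k)] := proj1 (kind_old pr u) (ex_intro _ x xu).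
have yo : forall u, kind pr y = inl (inl u) -> ~ at_cycle u.
  by move=> u yu [k ku]; have [_ /(_ k)] := proj1 (kind_old pr u) (ex_intro _ y yu).
have xp : forall u, kind pr x = inl (inr u) -> primed I u.
  by move=> u xu; apply/(kind_primed pr); exists x.
have yp : forall u, kind pr y = inl (inr u) -> primed I u.
  by move=> u yu; apply/(kind_primed pr); exists y.
case: (kind pr x) (kind pr y) bxy xo yo xp yp => [[u|u]|[k j]] [[u'|u']|[k' j']] /= bxy xo yo xp yp.
- rewrite bxy eqxx scale1r; case: asboolP => up; last exact: fvK.
  exact: inner_idem (primed_finite up).
- have up := yp _ erefl; have fin := primed_finite up.
  by rewrite bxy asboolT // scale0r nmulBr inner_fv // inner_idem // subrr.
- by case: (xo _ erefl); exists k'.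
- have up := xp _ erefl; have fin := primed_finite up.
  by rewrite -bxy asboolT // scale0r nmulBl fv_inner // inner_idem // subrr.
- have up := xp _ erefl; have fin := primed_finite up.
  rewrite -bxy eqxx scale1r nmulBl nmulBr fvK fv_inner // nmulBr inner_fv // inner_idem //.
  by rewrite subrr subr0.
- by case: (@rep_not_primed k'); rewrite /= -bxy; exact: xp.
- by case: (yo _ erefl); exists k.
- by case: (@rep_not_primed k); rewrite /= bxy; exact: yp.
- have kk := rep_source_inj bxy; move: j' {bxy xo yo xp yp}; case: k' / kk => j'.
  have [uu _ _ _ _] := sink_eltP k; rewrite uu; congr ((nat_of_bool _)%:R *: _).
  by apply/eqP/eqP => [->//|[/eqP]]; rewrite -tag_eqE /tag_eq /= eqxx tagged_asE => /eqP.
Qed.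

(** The vertices of [D] over [u] decompose the idempotent [u]; this yields both CK2 for the family
    and surjectivity. *)
Lemma fiber_sum u : ~ H u -> exists s : seq (vertex D),
  [/\ uniq s, forall x, x \in s = (base x == u) & \sum_(x <- s) vertex_elt x = fv p u].
Proof.
move=> uH; have [[k ku]|nk] := pselect (at_cycle u).
  have /choice[sk skE] : forall j : 'I_(rep_degree k), exists x,
      kind pr x = inr (Tagged (fun k => 'I_(rep_degree k)) j).
    by move=> j; exact: kind_sink.
  exists [seq sk j | j : 'I_(rep_degree k)]; split.
  - rewrite map_inj_uniq ?enum_uniq // => i j /(congr1 (kind pr)).
    by rewrite !skE => -[] /eqP; rewrite -tag_eqE /tag_eq /= eqxx tagged_asE => /eqP.
  - move=> x; apply/mapP/eqP => [[j _ ->]|]; first by rewrite skE.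
    case xE: (kind pr x) => [[u'|u']|[k' j]] /= xu.
    + have [_ /(_ k)] := proj1 (kind_old pr u') (ex_intro _ x xE).
      by rewrite ku xu.
    + case: (@rep_not_primed k); rewrite ku -xu.
      by apply/(kind_primed pr); exists x.
    + have kk := rep_source_inj (etrans ku (esym xu)); move: j xE {xu}.
      case: k' / kk => j xE; exists j; first by rewrite mem_enum.
      by apply: (kind_inj (s := pr)); rewrite skE xE.
  - rewrite big_map big_enum -ku; have [_ -> _ _ _] := sink_eltP k.
    by apply: eq_bigr => j _; rewrite /vertex_elt skE.
have [x0 x0E] : exists x, kind pr x = inl (inl u).
  by apply/(kind_old pr); split=> // k ku; apply: nk; exists k.
have baseu x : base x = u -> kind pr x = inl (inl u) \/ kind pr x = inl (inr u) /\ primed I u.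
  case xE: (kind pr x) => [[u'|u']|[k' j]] /= xu; rewrite -?xu; first by left.
    by right; split=> //; apply/(kind_primed pr); exists x.
  by case: nk; exists k'.
have [up|up] := pselect (primed I u); last first.
  exists [:: x0]; split=> // [x|]; last first.
    by rewrite big_seq1 /vertex_elt x0E /= asboolF.
  rewrite inE; apply/eqP/eqP => [->|/baseu[xE|[]//]]; first by rewrite x0E.
  by apply: (kind_inj (s := pr)); rewrite x0E.
have [x1 x1E] : exists x, kind pr x = inl (inr u) by apply/(kind_primed pr).
exists [:: x0; x1]; split=> [|x|].
- by rewrite /= inE andbT; apply/eqP => x01; move: x1E; rewrite -x01 x0E.
- rewrite !inE; apply/orP/eqP => [[/eqP ->|/eqP ->]|/baseu[xE|[xE _]]].
  + by rewrite x0E.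
  + by rewrite x1E.
  + by left; apply/eqP/(kind_inj (s := pr)); rewrite x0E.
  + by right; apply/eqP/(kind_inj (s := pr)); rewrite x1E.
- by rewrite big_cons big_seq1 /vertex_elt x0E x1E /= asboolT // addrC subrK.
Qed.

Lemma old_elt_fe e : ~ H (target e) ->
  kind_elt (inl (inl (source e))) ** fe p e = fe p e.
Proof.
move=> eH /=; case: asboolP => up; last exact: fve.
by rewrite inner_fe //; exact: primed_finite.
Qed.

Lemma old_elt_fg e : ~ H (target e) ->
  fg p e ** kind_elt (inl (inl (source e))) = fg p e.
Proof.
move=> eH /=; case: asboolP => up; last exact: fgv.
by rewrite fg_inner //; exact: primed_finite.
Qed.

Lemma vertex_elt_neq0 x : vertex_elt x <> 0.
Proof.
rewrite /vertex_elt; case xE: (kind pr x) => [[u|u]|[k j]] /=.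
- have [uH _] := proj1 (kind_old pr u) (ex_intro _ x xE).
  case: asboolP => [up u0|_ u0]; last by apply/uH/(ideal_verticesE qM qker).
  have [[_ [e ue] _] _] := up; case: (ue) => _; apply; apply/(fe_eq0 qM qker).
  by rewrite -(inner_fe (primed_finite up) ue) u0 nmul0l.
- have up : primed I u by apply/(kind_primed pr); exists x.
  move=> u0; have [br] := up; apply; split=> //=; apply/qker.
  by rewrite breaking_eltE //; exact: primed_finite.
- by have [_ _ + _ _] := sink_eltP k; apply.
Qed.

Lemma under_notin a : ~ H (target (und a)).
Proof. by rewrite -(kind_target pr); exact: base_notin. Qed.

Lemma under_not_cycle a : ~ at_cycle (source (und a)).
Proof.
move=> [k ku]; have [_ /(_ k)] := proj1 (kind_old pr _) (ex_intro _ _ (kind_source pr a)).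
by apply.
Qed.

Lemma source_under a b : source (und a) = source (und b) -> source a = source b.
Proof. by move=> ab; apply: (kind_inj (s := pr)); rewrite !kind_source ab. Qed.

Lemma under_source a b : source a = source b -> source (und a) = source (und b).
Proof. by move=> /(congr1 (kind pr)); rewrite !kind_source => -[]. Qed.

Lemma vertex_elt_source a :
  vertex_elt (source a) = kind_elt (inl (inl (source (und a)))).
Proof. by rewrite /vertex_elt kind_source. Qed.

Definition arrow_elt a : B := fe p (und a) ** vertex_elt (target a).
Definition ghost_elt a : B := vertex_elt (target a) ** fg p (und a).

Lemma vertex_eltK x : vertex_elt x ** vertex_elt x = vertex_elt x.
Proof. by rewrite vertex_elt_mul eqxx scale1r. Qed.

(** At a finite emitter this is CK2, arrows into H being 0. An infinite emitter without primed copy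
    is breaking with its breaking element in [I]. *)
Lemma old_elt_out u : ~ H u -> ~ at_cycle u -> finite_set (out_notin I u) ->
  out_notin I u !=set0 -> kind_elt (inl (inl u)) = inner u.
Proof.
move=> uH uk fin ne /=; case: asboolP => // nup.
have [ufin|uinf] := pselect (finite_set (out u)).
  rewrite (fCK2 p ufin); last by have [e [eu _]] := ne; exists e.
  rewrite /inner; apply/esym; apply: fsbig_widen; first by move=> e [].
  move=> e [/= eu] neu; suff -> : fe p e = 0 by rewrite nmul0l.
  apply/(fe_eq0 qM qker); apply: contrapT => eH; apply: neu.
  by split.
have br : breaking I u by split.
have : breaking_elt I u \in I by apply: contrapT => bI; apply: nup; split=> // -[].
by move=> /qker; rewrite breaking_eltE // => /eqP; rewrite subr_eq0 => /eqP.
Qed.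

(** Arrows at [x] correspond to pairs of an arrow e leaving [u] outside H and a vertex over t(e).
    Summing over the fiber of t(e) leaves e e^*, so the total is [inner u]. *)
Lemma split_CK2 x : finite_set (out x) -> out x !=set0 ->
  vertex_elt x = \sum_(a \in out x) (arrow_elt a ** ghost_elt a).
Proof.
move=> xfin [a0 a0x]; set u := source (und a0).
have xE : vertex_elt x = kind_elt (inl (inl u)) by rewrite -a0x vertex_elt_source.
have uk : ~ at_cycle u := @under_not_cycle a0.
have ouE a : out x a <-> source (und a) = u.
  split=> [ax|au]; first by apply: under_source; exact: etrans ax (esym a0x).
  by apply: etrans a0x; exact: source_under.
have /choice[ver verP] : forall e, exists s : seq (vertex D), ~ H (target e) ->
   [/\ uniq s, forall x, x \in s = (base x == target e) &
       \sum_(x <- s) vertex_elt x = fv p (target e)].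
  move=> e; have [eH|eH] := pselect (H (target e)); first by exists [::].
  by have [s sP] := fiber_sum eH; exists s.
have imE : out_notin I u = und @` out x.
  apply/seteqP; split=> [e [/= eu eH]|_ [a /ouE au <-]]; last first.
    by split=> //=; exact: under_notin.
  have [s [us sE sS]] := fiber_sum eH.
  (* An empty fiber would make t(e) an empty sum, hence put it in H. *)
  have [y ys] : exists y, y \in s.
    case: s {us sE} sS => [|y s] sS; last by exists y; rewrite inE eqxx.
    by case: eH; apply/(ideal_verticesE qM qker); rewrite -sS big_nil.
  have [|a [ae ay]] := under_lift eH (s := pr) (x := y) _ (eqP (etrans (esym (sE y)) ys)).
    by move=> k ku; apply: uk; exists k; rewrite ku.
  by exists a => //; apply/ouE; rewrite ae.
have fin : finite_set (out_notin I u) by rewrite imE; exact: finite_image.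
have ne : out_notin I u !=set0 by rewrite imE; exists (und a0), a0.
rewrite xE old_elt_out //; last by have [e [<- eH]] := ne; exact: source_notin.
pose g (z : arrow G * vertex D) := fe p z.1 ** vertex_elt z.2 ** fg p z.1.
transitivity (\sum_(a \in out x) g (und a, target a)); last first.
  apply: eq_fsbigr => a _; rewrite /g /arrow_elt /ghost_elt /= nmulA.
  by rewrite -[_ ** vertex_elt _ ** vertex_elt _]nmulA vertex_eltK.
pose S := [seq (e, y) | e <- fset_set (out_notin I u), y <- ver e].
have SE z : z \in S = (z.1 \in fset_set (out_notin I u)) && (base z.2 == target z.1).
  apply/allpairsPdep/andP => [[e [y [eu yv ->]]]|[zu zt]].
    split=> //=; have := eu; rewrite in_fset_set // inE => -[_ eH].
    by have [_ <- _] := verP e eH.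
  exists z.1, z.2; split=> //; last by case: z {zu zt}.
  have := zu; rewrite in_fset_set // inE => -[_ eH].
  by have [_ -> _] := verP _ eH.
have uS : uniq S.
  apply: allpairs_uniq_dep; first exact: fset_uniq.
  - move=> e; rewrite in_fset_set // inE => -[_ eH].
    by have [] := verP e eH.
  - by move=> [e y] [e' y'] _ _ /= [-> ->].
rewrite -(reindex_fsbig (fun a => (und a, target a)) (out x) [set` S] g); last first.
  split=> [a ax|a b _ _ [ab tab]|[e y]] /=.
  - rewrite SE /= kind_target eqxx andbT in_fset_set //; apply/mem_set; rewrite imE.
    by exists a.
  - exact: under_inj ab tab.
  - rewrite SE in_fset_set //= => /andP[/set_mem[eu eH] /eqP ye].
    have [|a [ae ay]] := under_lift eH (s := pr) (x := y) _ ye.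
      by move=> k ku; apply: uk; exists k; rewrite ku.
    by exists a; rewrite ?ae ?ay //; apply/ouE; rewrite ae.
rewrite -fsbig_seq // big_allpairs_dep /inner fsbig_finite //.
apply: eq_big_seq => e; rewrite in_fset_set // inE => -[_ eH].
rewrite /g /= -nmul_suml -nmul_sumr; have [_ _ ->] := verP e eH.
by rewrite fev.
Qed.

Lemma vertex_elt_arrow a : vertex_elt (source a) ** fe p (und a) = fe p (und a).
Proof. by rewrite vertex_elt_source old_elt_fe //; exact: under_notin. Qed.

Lemma vertex_elt_ghost a : fg p (und a) ** vertex_elt (source a) = fg p (und a).
Proof. by rewrite vertex_elt_source old_elt_fg //; exact: under_notin. Qed.

Definition split_family : leavitt_family D B.
Proof.
apply: (@LeavittFamily F D B vertex_elt arrow_elt ghost_elt).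
- exact: vertex_elt_mul.
- by move=> a; rewrite /arrow_elt nmulA vertex_elt_arrow.
- by move=> a; rewrite /arrow_elt -nmulA vertex_eltK.
- by move=> a; rewrite /ghost_elt nmulA vertex_eltK.
- by move=> a; rewrite /ghost_elt -nmulA vertex_elt_ghost.
- move=> a b; rewrite /ghost_elt /arrow_elt -nmulA [fg p _ ** _]nmulA fge.
  have [ab|ab] := eqVneq (und a) (und b); last first.
    have -> : (a == b) = false by apply: contra_neqF ab => /eqP ->.
    by rewrite !scale0r nmul0l nmul0r.
  rewrite scale1r -(kind_target pr) nmulA vertex_elt_fv vertex_elt_mul.
  congr ((nat_of_bool _)%:R *: _); apply/eqP/eqP => [|->//].
  exact: under_inj ab.
- exact: split_CK2.
Defined.

Local Notation R := split_family.
Local Notation phi := (leavitt_eval R).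

Lemma split_path_elt x s : is_path x s ->
  pelt R x s = vertex_elt x ** pelt p (base x) (map und s) ** vertex_elt (path_end x s).
Proof.
elim: s x => [|a s IH] x /=; first by rewrite -nmulA fv_vertex_elt vertex_eltK.
move=> /andP[/eqP <- as_]; rewrite IH // -[fe R a]/(arrow_elt a) /arrow_elt path_end_cons.
rewrite (nmulA (vertex_elt (source a))) vertex_elt_arrow -(kind_target pr) -!nmulA.
congr (_ ** _); case: s as_ {IH} => [_|b s /= /andP[/eqP <- _]] /=.
  by rewrite fv_vertex_elt !vertex_eltK.
by rewrite -!nmulA [vertex_elt _ ** (fe _ _ ** _)]nmulA vertex_elt_arrow
  [vertex_elt _ ** (fe _ _ ** _)]nmulA vertex_elt_arrow.
Qed.

Lemma base_source a : base (source a) = source (und a).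
Proof. by rewrite kind_source. Qed.

Lemma under_path x s : is_path x s -> is_path (base x) (map und s).
Proof.
elim: s x => //= a s IH x /andP[/eqP <- /IH].
by rewrite base_source eqxx kind_target.
Qed.

Lemma under_path_end x s : base (path_end x s) = path_end (base x) (map und s).
Proof. by elim: s x => //= a s IH x; rewrite !path_end_cons IH kind_target. Qed.

Lemma under_cycle (c : gcycle D) : exists2 c' : gcycle G,
  cycle_seq c' = map und (cycle_seq c) & cycle_source c' = base (cycle_source c).
Proof.
have cc : is_cycle (und (val c).1 :: map und (val c).2).
  have E : source (und (val c).1) = base (cycle_source c) by rewrite -base_source.
  rewrite is_cycleE E -[_ :: _]/(map und (cycle_seq c)).
  rewrite under_path ?cycle_is_path // -under_path_end cycle_path_end eqxx /=.
  rewrite -[(_ \notin _) && _]/(uniq (map source (map und (cycle_seq c)))) -map_comp.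
  rewrite (eq_map (g := (fun x => base x) \o source)); last by move=> a /=; rewrite base_source.
  rewrite map_comp map_inj_in_uniq ?cycle_uniq // => x y /mapP[a _ ->] /mapP[b _ ->].
  by rewrite !base_source; exact: source_under.
exists (exist _ (und (val c).1, map und (val c).2) cc) => //.
by rewrite /cycle_source /= base_source.
Qed.

Lemma split_injective : injective phi.
Proof.
suff phi0 x : phi x = 0 -> x = 0.
  by move=> x y xy; apply/eqP; rewrite -subr_eq0; apply/eqP/phi0; rewrite linearB /= xy subrr.
move=> phix; apply: contrapT => /reduction[a [b]].
have {phix} : phi (a ** x ** b) = 0 by rewrite !leavitt_evalM phix nmul0r nmul0l.
move=> phix [[y yE]|[c [f [_ f0 cE]]]].
  by move: phix; rewrite yE leavitt_evalV; exact: vertex_elt_neq0.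
move: phix; rewrite cE leavitt_eval_cycle => fc0.
have [c' c'seq c'src] := under_cycle c.
set x0 := cycle_source c in fc0 c'src; set X := vertex_elt x0.
set v := fv p (cycle_source c'); set C := celt p c'.
have vX : v ** X = X by rewrite /v c'src fv_vertex_elt.
have XC : X ** C = C.
  rewrite /C /celt c'seq /= nmulA /X -[x0]/(source (val c).1) vertex_elt_arrow.
  by [].
have CX : celt R c = C ** X.
  have CE : pelt p (base x0) (map und (cycle_seq c)) = C by rewrite /C /celt c'seq c'src.
  by rewrite {1}/celt split_path_elt ?cycle_is_path // cycle_path_end CE -/X XC.
have iterX i : iter i (nmul (celt R c)) X = iter i (nmul C) v ** X.
  have Xi j : X ** (iter j (nmul C) v ** X) = iter j (nmul C) v ** X.
    case: j => [|j]; first by rewrite /= vX /X vertex_eltK.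
    by rewrite iterS -(nmulA C _ X) (nmulA X C) XC.
  by elim: i => [|i IH] //=; rewrite IH CX -!nmulA Xi.
(* The kernel condition only gives f(C') X = 0; multiplying by C' = X C' removes [X] at the cost of
   the extra factor ['X]. *)
have fX0 : cycle_eval c' (f * 'X) \in I.
  apply/qker; rewrite (cycle_eval_cpoly qM) cpolyM ?fvK ?fv_celt ?celt_fv // cpolyX ?celt_fv //.
  rewrite -/v -/C; have -> : cpoly v C f ** C = cpoly v C f ** X ** C by rewrite -nmulA XC.
  suff -> : cpoly v C f ** X = 0 by rewrite nmul0l.
  rewrite -fc0 /cpoly nmul_suml; apply: eq_bigr => i _.
  by rewrite nmulZl; congr (_ *: _); exact: esym (iterX i).
have cc' : contributes I c'.
  apply/contributesP; split; last by rewrite c'src; exact: base_notin.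
  by exists (f * 'X) => //; apply: mulf_neq0; rewrite ?polyX_eq0.
(* The chosen rotation of [c'] is cut at the source of some arrow under [c], but no arrow of [D]
   starts over a cut vertex. *)
have [kk [[Kk [n rotk]] _]] := choiceK (SigSub (mem_set cc') : contributing_cycle I).
pose k : K := SigSub (mem_set Kk).
have : (val (rep_cycle k)).1 \in cycle_seq c'.
  by rewrite -(mem_rot n) -[rot _ _]rotk inE eqxx.
rewrite c'seq => /mapP[d _ dE]; apply: (@under_not_cycle d).
by exists k; rewrite -dE.
Qed.

Definition in_image (y : B) : Prop := exists x, phi x = y.

Lemma image_sum (T : eqType) (r : seq T) (g : T -> B) :
  (forall t, t \in r -> in_image (g t)) -> in_image (\sum_(t <- r) g t).
Proof.
move=> H; rewrite big_seq; elim/big_ind: _ => //; first by exists 0; rewrite linear0.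
by move=> _ _ [x <-] [y <-]; exists (x + y); rewrite linearD.
Qed.

Lemma image_mul y z : in_image y -> in_image z -> in_image (y ** z).
Proof. by move=> [x <-] [x' <-]; exists (x ** x'); rewrite leavitt_evalM. Qed.

Lemma image_scale a y : in_image y -> in_image (a *: y).
Proof. by move=> [x <-]; exists (a *: x); rewrite linearZ. Qed.

Lemma image_vertex u : in_image (fv p u).
Proof.
have [uH|uH] := pselect (H u).
  by exists 0; rewrite linear0 (proj1 (ideal_verticesE qM qker u) uH).
have [s [_ _ <-]] := fiber_sum uH; apply: image_sum => x _.
by exists (lvertex F x); rewrite leavitt_evalV.
Qed.

Lemma image_arrow_off e : ~ at_cycle (source e) -> in_image (fe p e) /\ in_image (fg p e).
Proof.
move=> ek; have [eH|eH] := pselect (H (target e)).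
  rewrite (proj2 (fe_eq0 qM qker e) eH) (fg_eq0 qM qker eH).
  by split; exists 0; rewrite linear0.
have [s [_ sE sS]] := fiber_sum eH.
have lift x : x \in s -> exists a, und a = e /\ target a = x.
  rewrite sE => /eqP xe; apply: (under_lift eH _ xe) => k ku.
  by apply: ek; exists k.
rewrite -fev -fvg -sS nmul_sumr nmul_suml; split; apply: image_sum => x /lift[a [ae ax]].
  by exists (larrow F a); rewrite leavitt_evalA -ae -ax.
by exists (lghost F a); rewrite leavitt_evalG -ae -ax.
Qed.

(** Only the deleted arrow e_C is in question. With t the rest of the cycle, e_C = C t^* and its
    ghost is t C^-1, where C and C^-1 are combinations of the sink idempotents with coefficients
    lam_j and 1/lam_j. *)
Lemma image_arrow e : in_image (fe p e) /\ in_image (fg p e).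
Proof.
have [[k ku]|] := pselect (at_cycle (source e)); last exact: image_arrow_off.
have [eH|eH] := pselect (H (target e)).
  rewrite (proj2 (fe_eq0 qM qker e) eH) (fg_eq0 qM qker eH).
  by split; exists 0; rewrite linear0.
set c := rep_cycle k in ku; set e0 := (val c).1; set t := (val c).2.
have cc : contributes I c := rep_contributes k.
have e0c : e0 \in cycle_seq c by rewrite inE eqxx.
have -> : e = e0.
  apply: (contributes_no_exit qker cc e0c _ (esym ku)).
  by rewrite (fe_eq0 qM qker).
have tc f : f \in t -> f \in cycle_seq c by move=> ft; rewrite inE ft orbT.
have toff f : f \in t -> ~ at_cycle (source f).
  move=> ft [k' k'f].
  have kk : k' = k.
    apply: (transversal_source qM qker choiceK (e := (val (rep_cycle k')).1) (e' := f)) => //.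
      by rewrite inE eqxx.
    exact: tc.
  have := cycle_uniq c; rewrite /= => /andP[/negP + _]; apply.
  by apply/mapP; exists f; rewrite // -k'f kk.
have tpath : is_path (target e0) t.
  by have := cycle_is_path c; rewrite /= => /andP[].
have tim : in_image (pelt p (target e0) t) /\ in_image (gelt p (target e0) t).
  elim: t (target e0) toff {tc tpath} => [|f t IH] u /= toff.
    by split; exact: image_vertex.
  have [|ip ig] := IH (target f).
    by move=> g gt; apply: toff; rewrite inE gt orbT.
  have [fi gi] := image_arrow_off (toff f (mem_head _ _)).
  by split; apply: image_mul.
have [uu vE _ lam0 CE] := sink_eltP k; rewrite -/c in vE CE.
have sink_im (g : 'I_(rep_degree k) -> F) : in_image (\sum_j g j *: @sink_elt k j).
  apply: image_sum => j _; apply: image_scale.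
  have [x xE] := kind_sink pr (Tagged (fun k => 'I_(rep_degree k)) j).
  by exists (lvertex F x); rewrite leavitt_evalV /= /fv /= /vertex_elt xE.
have tt : pelt p (target e0) t ** gelt p (target e0) t = fv p (target e0).
  exact: (exclusive_peltK (contributes_exclusive qM qker cc)).
have CE0 : celt p c = fe p e0 ** pelt p (target e0) t by [].
pose Cinv := \sum_j (@sink_root k j)^-1 *: @sink_elt k j.
have CCinv : celt p c ** Cinv = fv p (cycle_source c).
  rewrite CE vE /Cinv nmul_suml; apply: eq_bigr => i _.
  rewrite nmulZl nmul_sumr (bigD1 i) //= nmulZr uu eqxx scale1r big1 ?addr0.
    by rewrite scalerA mulfV // scale1r.
  by move=> j ji; rewrite nmulZr uu eq_sym (negbTE ji) scale0r scaler0.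
split.
  have -> : fe p e0 = celt p c ** gelt p (target e0) t.
    by rewrite CE0 -nmulA tt fev.
  by apply: image_mul tim.2; rewrite CE; exact: sink_im.
have -> : fg p e0 = pelt p (target e0) t ** Cinv.
  rewrite -[fg p e0]fgv -[source e0]/(cycle_source c) -CCinv CE0 !nmulA fgeK.
  by rewrite fv_pelt.
by apply: image_mul tim.1 _; exact: sink_im.
Qed.

Lemma split_surjective x : in_image (q x).
Proof.
elim/leavitt_ind: x => [a x y [x' xE] [y' yE]||x y ix iy|v|e|e].
- by exists (a *: x' + y'); rewrite !linearP /= xE yE.
- by exists 0; rewrite !linear0.
- by rewrite qM; exact: image_mul.
- exact: (image_vertex v).
- exact: (image_arrow e).1.
- exact: (image_arrow e).2.
Qed.

Lemma split_bijective : (forall y, exists x, q x = y) -> bijective phi.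
Proof.
move=> qsurj; have /choice[g gK] : forall y, exists x, phi x = y.
  by move=> y; have [x <-] := qsurj y; exact: split_surjective.
by exists g => // x; apply: split_injective; rewrite gK.
Qed.

End SplitIsomorphism.

Lemma nu_isomorphic_sym (F : fieldType) (A B : nuAlgType F) (f : {linear A -> B}) :
  bijective f -> {morph f : x y / x ** y} -> nu_isomorphic B A.
Proof.
move=> [g fK gK] fM.
have gl : linear g by move=> a x y; apply: (can_inj fK); rewrite linearP !gK.
pose g' := GRing.isLinear.Build F B A _ g gl.
pose G : {linear B -> A} := HB.pack g g'.
exists G; split; first by exists f.
by move=> x y; apply: (can_inj fK); rewrite fM /= !gK.
Qed.

Lemma split_quotient_iso (F : fieldType) (G : digraph) (I : nuIdeal (leavitt F G))
    (B : nuAlgType F) (q : {linear leavitt F G -> B}) (qM : {morph q : x y / x ** y})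
    (K : set (contributing_cycle I)) :
  (forall x, q x = 0 <-> x \in I) -> (forall y, exists x, q x = y) ->
  (forall c, contributes I c ->
    exists2 rs, uniq rs & canonical_poly I c %= \prod_(a <- rs) ('X - a%:P)) ->
  geometric_transversal K ->
  exists f : {linear leavitt F (split_quotient_digraph K) -> B},
    bijective f /\ {morph f : x y / x ** y}.
Proof.
move=> qker qsurj sep choiceK; have [pr] := split_quotient_presentation K.
exists (leavitt_eval (split_family qM qker choiceK sep pr)); split.
  exact: split_bijective.
exact: leavitt_evalM.
Qed.

Theorem theorem31 (F : fieldType) (G : digraph) (J : nuIdeal (leavitt F G))
    (roots_in_F : forall c : gcycle G, contributes J c -> splits (canonical_poly J c))
    (K : set (contributing_cycle (ideal_prime J)))
    (choiceK : geometric_transversal K) :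
  jacobson_radical (nuquot J) = [set` nilradical (nuquot J)]%classic /\
  nu_isomorphic (nuquot (nilradical (nuquot J)))
                (leavitt F (split_quotient_digraph K)).
Proof.
have sep := ideal_prime_separable roots_in_F.
have jac x : jacobson_radical (nuquot J) (to_quot J x) -> x \in ideal_prime J.
  move=> Jx; have [f [[g fK gK] fM]] := split_quotient_iso
    (to_quotM (ideal_prime J)) (to_quot_eq0 (ideal_prime J))
    (fun y => ex_intro _ (repr y) (to_quotK y)) sep choiceK.
  apply/to_quot_eq0; rewrite -(gK (to_quot _ x)).
  rewrite (leavitt_semiprimitive (a := g (to_quot _ x))) ?linear0 // => b.
  have [|z zE] := @jacobson_lqr _ (nuquot J) (to_quot J (repr (f b)) ** to_quot J x).
    by move=> M Mmax Mmod; have [[_ _ MM] _ _] := Mmax; apply: MM; exact: Jx.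
  (* A quasi-inverse in L/J is lifted to L, read modulo the larger ideal J', and carried to the path
     algebra by [g]. *)
  exists (g (to_quot _ (repr z))); apply: (can_inj fK).
  rewrite linearD !fM !gK -(to_quotK (f b)) /=.
  move: zE; rewrite -{1 2}(to_quotK z) -!to_quotM -!to_quotD.
  by move=> /to_quotP /ideal_prime_sub H; apply/to_quotP.
have radE x : to_quot J x \in nilradical (nuquot J) <-> x \in ideal_prime J.
  split; last exact: ideal_prime_nilradical.
  by move=> /nilradical_sub_jacobson; exact: jac.
split.
  apply/seteqP; split; last exact: nilradical_sub_jacobson.
  by move=> a; rewrite -(to_quotK a) => /jac/radE.
(* The iterated quotient is itself a surjective image of L with kernel J', so the isomorphism
   applies to it directly. *)
pose q : {linear leavitt F G -> nuquot (nilradical (nuquot J))} :=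
  to_quot (nilradical (nuquot J)) \o to_quot J.
have qM : {morph q : x y / x ** y} by move=> x y; rewrite /q /= !to_quotM.
have qker x : q x = 0 <-> x \in ideal_prime J.
  by rewrite -radE; exact: to_quot_eq0.
have qsurj y : exists x, q x = y.
  by exists (repr (repr y)); rewrite /q /= !to_quotK.
have [f [fbij fM]] := split_quotient_iso qM qker qsurj sep choiceK.
exact: nu_isomorphic_sym fbij fM.
Qed.
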